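(* Let $F$ be a finite field, and let $\mathcal V$ be a non-prime variety of associative $F$-algebras. Then $\mathcal V$ is almost Lie nilpotent if and only if $\mathcal V$ is generated by one of the following algebras: $A(F)$, $A(F)^{\star}$, $A(C)$, $A(C)^{\star}$, or $B(F,G,\sigma)$ for some finite field extension $G$ of $F$ and some automorphism $\sigma$ of $G$ such that the invariant field $G^{\sigma}$ is the unique maximal (proper) subfield of $G$ containing $F$.
   Context: All algebras are associative, not necessarily unital. $F\langle X\rangle$ is the free (non-unital) associative $F$-algebra on a countable set $X$; its elements are called polynomials. A variety of $F$-algebras is the class of all $F$-algebras satisfying some given set of polynomial identities; the variety generated by an algebra is the smallest variety containing it. For a variety $\mathcal V$, $T(\mathcal V)$ is the ideal of all polynomials $f$ such that $f=0$ is an identity of $\mathcal V$. A T-ideal is an ideal of $F\langle X\rangle$ closed under all endomorphisms of $F\langle X\rangle$. A variety $\mathcal V$ is prime (verbally prime) if for all T-ideals $I_1,I_2$ the inclusion $I_1\cdot I_2\subseteq T(\mathcal V)$ implies $I_1\subseteq T(\mathcal V)$ or $I_2\subseteq T(\mathcal V)$; otherwise it is non-prime. Put $[x,y]=xy-yx$, $W_2(x_1,x_2)=[x_1,x_2]$ and $W_n(x_1,\dots,x_n)=[W_{n-1}(x_1,\dots,x_{n-1}),x_n]$. A variety is Lie nilpotent if it satisfies the identity $W_n(x_1,\dots,x_n)=0$ for some $n$. A variety is almost Lie nilpotent if it is not Lie nilpotent but all its proper subvarieties are Lie nilpotent. $C$ denotes the (non-unital) $F$-algebra generated by $c_1,c_2,\dots$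 with defining relations $c_ic_j=c_jc_i$, $c_i^2=0$ for $i,j=1,2,\dots$. For an $F$-algebra $U$, $A(U)$ is the algebra of all matrices $\begin{pmatrix} u & v\\ 0&0\end{pmatrix}$ with $u,v\in U$, under matrix operations. $A^{\star}$ denotes the algebra anti-isomorphic (opposite) to $A$. For a finite extension $G$ of $F$ and an automorphism $\sigma$ of $G$ whose invariant field $G^\sigma=\{g\in G:\sigma(g)=g\}$ is the unique maximal (proper) subfield of $G$ containing $F$, $B(F,G,\sigma)$ is the $F$-algebra of all matrices $\begin{pmatrix} b & c\\ 0&\sigma(b)\end{pmatrix}$ with $b,c\in G$. *)

(* Defs.v *)
(* boolp is used only to turn an ideal, a Prop-valued predicate, into the boolean
   predicate that the quotient construction requires. *)
From HB Require Import structures.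
From mathcomp Require Import all_boot all_order all_algebra all_field.
From mathcomp Require Import generic_quotient ring_quotient.
From mathcomp Require Import finmap boolp.
From mathcomp.multinomials Require Import monalg.

Set Implicit Arguments.
Unset Strict Implicit.
Unset Printing Implicit Defensive.

Import GRing.Theory.
Local Open Scope ring_scope.
Local Open Scope quotient_scope.

Declare Scope nualg_scope.
Delimit Scope nualg_scope with nu.
Local Open Scope nualg_scope.

(* MathComp rings are unital, hence a separate structure for associative,
   not necessarily unital, algebras. *)
HB.mixin Record Lmodule_isNUAlgebra (R : pzRingType) V
    of GRing.Lmodule R V := {
  numul : V -> V -> V;
  numulA : associative numul;
  numulDl : left_distributive numul +%R;
  numulDr : right_distributive numul +%R;
  numulZl : forall (a : R) (x y : V), numul (a *: x) y = a *: numul x y;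
  numulZr : forall (a : R) (x y : V), numul x (a *: y) = a *: numul x y
}.

#[short(type="nualgType")]
HB.structure Definition NUAlgebra (R : pzRingType) :=
  {V of GRing.Lmodule R V & Lmodule_isNUAlgebra R V}.

Infix "**" := numul (at level 40, left associativity) : nualg_scope.

Section NUAlgebraTheory.
Variables (R : pzRingType) (A : nualgType R).
Implicit Types x y z : A.

Definition nucomm x y : A := x ** y - y ** x.

(* The product of a nonempty word; the value on [::] is never used. *)
Definition nuprod (s : seq A) : A :=
  if s is x :: s' then foldl numul x s' else 0.

Lemma numul0r x : 0 ** x = 0 :> A.
Proof. by rewrite -(scale0r x) numulZl !scale0r. Qed.

Lemma numulr0 x : x ** 0 = 0 :> A.
Proof. by rewrite -(scale0r x) numulZr !scale0r. Qed.

Lemma numulNr x y : (- x) ** y = - (x ** y).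
Proof. by rewrite -scaleN1r numulZl scaleN1r. Qed.

Lemma numulrN x y : x ** (- y) = - (x ** y).
Proof. by rewrite -scaleN1r numulZr scaleN1r. Qed.

Lemma numulBl x y z : (x - y) ** z = x ** z - y ** z.
Proof. by rewrite numulDl numulNr. Qed.

Lemma numulBr x y z : x ** (y - z) = x ** y - x ** z.
Proof. by rewrite numulDr numulrN. Qed.

Definition nuideal (I : A -> Prop) : Prop :=
  [/\ I 0,
      forall x y, I x -> I y -> I (x + y),
      forall a x, I x -> I (a *: x)
    & forall x y, I y -> I (x ** y) /\ I (y ** x)].

Definition nuideal_gen (S : A -> Prop) (x : A) : Prop :=
  forall I : A -> Prop, nuideal I -> (forall s, S s -> I s) -> I x.

(* The product of two ideals: all finite sums of products. *)
Definition nuideal_mul (I J : A -> Prop) (x : A) : Prop :=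
  exists (n : nat) (u v : 'I_n -> A),
    [/\ forall i, I (u i), forall i, J (v i) & x = \sum_i u i ** v i].

End NUAlgebraTheory.

Definition nualg_morphism (R : pzRingType) (A B : nualgType R) (f : A -> B) :
    Prop :=
  linear f /\ {morph f : x y / x ** y}.

(* The quotient of A by the ideal generated by S. *)
Section Quotient.
Variables (R : pzRingType) (A : nualgType R) (S : A -> Prop).

Definition nuideal_genb : A -> bool := fun x => `[< nuideal_gen S x >].

Lemma nuideal_genbP x : reflect (nuideal_gen S x) (x \in nuideal_genb).
Proof. exact: asboolP. Qed.

Lemma nuideal_genP : nuideal (nuideal_gen S).
Proof.
split.
- by move=> I [].
- move=> x y Ix Iy I idI sI; have [_ addI _ _] := idI.
  by apply: addI; [apply: Ix|apply: Iy].
- by move=> a x Ix I idI sI; have [_ _ scI _] := idI; apply: scI; apply: Ix.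
- move=> x y Iy; split=> I idI sI; have [_ _ _ mulI] := idI.
  + by have [] := mulI x y (Iy I idI sI).
  + by have [] := mulI x y (Iy I idI sI).
Qed.

Lemma nuideal_genb_submod : subsemimod_closed nuideal_genb.
Proof.
have [gen0 genD genZ _] := nuideal_genP.
split; first split.
- exact/nuideal_genbP.
- move=> x y /nuideal_genbP Ix /nuideal_genbP Iy.
  by apply/nuideal_genbP; exact: genD.
- by move=> a x /nuideal_genbP Ix; apply/nuideal_genbP; exact: genZ.
Qed.

HB.instance Definition _ :=
  GRing.isSubmodClosed.Build R A nuideal_genb nuideal_genb_submod.

Definition nuquot : Type :=
  Quotient.quot (GRing.ZmodClosed.clone A nuideal_genb _).

HB.instance Definition _ := GRing.Zmodule.on nuquot.
HB.instance Definition _ := EqQuotient.on nuquot.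

Definition nuquot_pi (x : A) : nuquot := \pi_nuquot x.
Definition nuquot_repr (q : nuquot) : A := repr q.

Lemma nuquot_reprK : cancel nuquot_repr nuquot_pi.
Proof. exact: reprK. Qed.

Lemma nuquotP x y :
  reflect (nuquot_pi x = nuquot_pi y) (x - y \in nuideal_genb).
Proof. by rewrite Quotient.idealrBE; apply: eqP. Qed.

Lemma nuquot_piB x : nuquot_repr (nuquot_pi x) - x \in nuideal_genb.
Proof. by apply/nuquotP; rewrite nuquot_reprK. Qed.

Lemma nuquot_piD x y : nuquot_pi (x + y) = nuquot_pi x + nuquot_pi y.
Proof. exact: Quotient.pi_add. Qed.

Definition nuquot_scale (a : R) (q : nuquot) : nuquot :=
  nuquot_pi (a *: nuquot_repr q).

Definition nuquot_mul (p q : nuquot) : nuquot :=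
  nuquot_pi (nuquot_repr p ** nuquot_repr q).

Lemma nuquot_scaleE a x : nuquot_scale a (nuquot_pi x) = nuquot_pi (a *: x).
Proof. by apply/nuquotP; rewrite -scalerBr rpredZ // nuquot_piB. Qed.

Lemma nuquot_mulE x y :
  nuquot_mul (nuquot_pi x) (nuquot_pi y) = nuquot_pi (x ** y).
Proof.
have [_ _ _ genM] := nuideal_genP.
have xI := nuquot_piB x; have yI := nuquot_piB y; apply/nuquotP.
move: (nuquot_repr (nuquot_pi x)) (nuquot_repr (nuquot_pi y)) xI yI => x' y'.
move=> /nuideal_genbP xI /nuideal_genbP yI.
rewrite -(subrKA (x ** y')) -numulBl -numulBr rpredD //.
  by apply/nuideal_genbP; have [] := genM y' _ xI.
by apply/nuideal_genbP; have [] := genM x _ yI.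
Qed.

Lemma nuquot_scaleA a b q :
  nuquot_scale a (nuquot_scale b q) = nuquot_scale (a * b) q.
Proof.
rewrite -(nuquot_reprK q) (nuquot_scaleE b).
by rewrite (nuquot_scaleE a) nuquot_scaleE scalerA.
Qed.

Lemma nuquot_scale1 : left_id 1 nuquot_scale.
Proof. by move=> q; rewrite -(nuquot_reprK q) nuquot_scaleE scale1r. Qed.

Lemma nuquot_scaleDr : right_distributive nuquot_scale +%R.
Proof.
move=> a p q; rewrite -(nuquot_reprK p) -(nuquot_reprK q) -nuquot_piD.
by rewrite !nuquot_scaleE scalerDr nuquot_piD.
Qed.

Lemma nuquot_scaleDl q : {morph nuquot_scale^~ q : a b / a + b}.
Proof.
by move=> a b; rewrite -(nuquot_reprK q) !nuquot_scaleE scalerDl nuquot_piD.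
Qed.

HB.instance Definition _ := GRing.Zmodule_isLmodule.Build R nuquot
  nuquot_scaleA nuquot_scale1 nuquot_scaleDr nuquot_scaleDl.

Lemma nuquot_mulA : associative nuquot_mul.
Proof.
move=> p q r.
rewrite -(nuquot_reprK p) -(nuquot_reprK q) -(nuquot_reprK r).
set x := nuquot_repr p; set y := nuquot_repr q; set z := nuquot_repr r.
by rewrite (nuquot_mulE y z) (nuquot_mulE x y) !nuquot_mulE numulA.
Qed.

Lemma nuquot_mulDl : left_distributive nuquot_mul +%R.
Proof.
move=> p q r.
rewrite -(nuquot_reprK p) -(nuquot_reprK q) -(nuquot_reprK r).
by rewrite -nuquot_piD !nuquot_mulE numulDl nuquot_piD.
Qed.

Lemma nuquot_mulDr : right_distributive nuquot_mul +%R.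
Proof.
move=> p q r.
rewrite -(nuquot_reprK p) -(nuquot_reprK q) -(nuquot_reprK r).
by rewrite -nuquot_piD !nuquot_mulE numulDr nuquot_piD.
Qed.

Lemma nuquot_piZ (a : R) x : nuquot_pi (a *: x) = a *: nuquot_pi x.
Proof. by rewrite -nuquot_scaleE. Qed.

Lemma nuquot_mulZl (a : R) (p q : nuquot) :
  nuquot_mul (a *: p) q = a *: nuquot_mul p q.
Proof.
rewrite -(nuquot_reprK p) -(nuquot_reprK q).
by rewrite -nuquot_piZ !nuquot_mulE numulZl nuquot_piZ.
Qed.

Lemma nuquot_mulZr (a : R) (p q : nuquot) :
  nuquot_mul p (a *: q) = a *: nuquot_mul p q.
Proof.
rewrite -(nuquot_reprK p) -(nuquot_reprK q).
by rewrite -nuquot_piZ !nuquot_mulE numulZr nuquot_piZ.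
Qed.

HB.instance Definition _ := Lmodule_isNUAlgebra.Build R nuquot
  nuquot_mulA nuquot_mulDl nuquot_mulDr nuquot_mulZl nuquot_mulZr.

End Quotient.

(* The free non-unital algebra on the variables x_0, x_1, ...: the elements of
   the free unital algebra (the monoid algebra of the free monoid on nat)
   whose constant coefficient is zero. *)
Section FreeAlgebra.
Variable F : fieldType.

Definition no_const : {malg F[{fmonom nat}]} -> bool :=
  fun p => mcoeff mone p == 0.

Lemma no_const_submod : subsemimod_closed no_const.
Proof.
split; first split.
- by rewrite unfold_in /no_const mcoeff0.
- move=> p q; rewrite !unfold_in /no_const mcoeffD => /eqP-> /eqP->.
  by rewrite addr0.
- move=> a p; rewrite !unfold_in /no_const mcoeffZ => /eqP->.
  by rewrite mulr0.
Qed.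

HB.instance Definition _ :=
  GRing.isSubmodClosed.Build F {malg F[{fmonom nat}]} no_const no_const_submod.

Record free_nualg : predArgType :=
  FreeNUAlg { free_val :> {malg F[{fmonom nat}]}; _ : free_val \in no_const }.

HB.instance Definition _ := [isSub for free_val].
HB.instance Definition _ := [Choice of free_nualg by <:].
HB.instance Definition _ := [SubChoice_isSubLmodule of free_nualg by <:].

Lemma no_constM p q : p \in no_const -> p * q \in no_const.
Proof.
rewrite !unfold_in /no_const => /eqP p0.
have -> := rmorphM (mcoeff (mone : {fmonom nat}) : {malg F[_]} -> F) p q.
by rewrite /= p0 mul0r.
Qed.

Definition free_mul (p q : free_nualg) : free_nualg :=
  FreeNUAlg (no_constM (val q) (valP p)).

Lemma free_mulA : associative free_mul.
Proof. by move=> p q r; apply: val_inj; rewrite /= mulrA. Qed.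

Lemma free_mulDl : left_distributive free_mul +%R.
Proof. by move=> p q r; apply: val_inj; rewrite /= mulrDl. Qed.

Lemma free_mulDr : right_distributive free_mul +%R.
Proof. by move=> p q r; apply: val_inj; rewrite /= mulrDr. Qed.

Lemma free_mulZl (a : F) (p q : free_nualg) :
  free_mul (a *: p) q = a *: free_mul p q.
Proof. by apply: val_inj; rewrite /= -scalerAl. Qed.

Lemma free_mulZr (a : F) (p q : free_nualg) :
  free_mul p (a *: q) = a *: free_mul p q.
Proof.
apply: val_inj => /=; apply/malgP=> k.
rewrite mcoeffZ (mcoeffMlw k (fsubset_refl _) (msuppZ_le a _)) mcoeffMl.
rewrite mulr_sumr; apply: eq_bigr => u _.
rewrite mulr_sumr; apply: eq_bigr => v _.
by rewrite mcoeffZ mulrnAr mulrCA.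
Qed.

HB.instance Definition _ := Lmodule_isNUAlgebra.Build F free_nualg
  free_mulA free_mulDl free_mulDr free_mulZl free_mulZr.

Lemma free_var_subproof (i : nat) :
  (<< fmu i >> : {malg F[{fmonom nat}]}) \in no_const.
Proof. by rewrite unfold_in /no_const mcoeffU1 fm1_eq1. Qed.

Definition free_var (i : nat) : free_nualg := FreeNUAlg (free_var_subproof i).

Definition free_eval (A : nualgType F) (rho : nat -> A) (f : free_nualg) : A :=
  \sum_(w <- msupp (val f)) (val f)@_w *: nuprod [seq rho i | i <- w : seq nat].

End FreeAlgebra.

Section Constructions.
Variable F : fieldType.

(* A unital algebra, forgetting the unit. *)
Definition forget_unit (A : algType F) : Type := A.

Section ForgetUnit.
Variable A : algType F.
HB.instance Definition _ := GRing.Lmodule.on (forget_unit A).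

Lemma forget_unit_mulZl (a : F) (x y : A) : (a *: x) * y = a *: (x * y).
Proof. by rewrite -scalerAl. Qed.

Lemma forget_unit_mulZr (a : F) (x y : A) : x * (a *: y) = a *: (x * y).
Proof. by rewrite -scalerAr. Qed.

HB.instance Definition _ := Lmodule_isNUAlgebra.Build F (forget_unit A)
  (@mulrA A) (@mulrDl A) (@mulrDr A) forget_unit_mulZl forget_unit_mulZr.
End ForgetUnit.

Definition opposite (A : nualgType F) : Type := A.

Section Opposite.
Variable A : nualgType F.
HB.instance Definition _ := GRing.Lmodule.on (opposite A).

Definition opposite_mul (x y : opposite A) : opposite A :=
  (y : A) ** (x : A).

Lemma opposite_mulA : associative opposite_mul.
Proof. by move=> x y z; rewrite /opposite_mul numulA. Qed.

Lemma opposite_mulDl : left_distributive opposite_mul +%R.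
Proof. by move=> x y z; apply: (@numulDr _ A). Qed.

Lemma opposite_mulDr : right_distributive opposite_mul +%R.
Proof. by move=> x y z; apply: (@numulDl _ A). Qed.

Lemma opposite_mulZl (a : F) (x y : opposite A) :
  opposite_mul (a *: x) y = a *: opposite_mul x y.
Proof. exact: (@numulZr _ A). Qed.

Lemma opposite_mulZr (a : F) (x y : opposite A) :
  opposite_mul x (a *: y) = a *: opposite_mul x y.
Proof. exact: (@numulZl _ A). Qed.

HB.instance Definition _ := Lmodule_isNUAlgebra.Build F (opposite A)
  opposite_mulA opposite_mulDl opposite_mulDr opposite_mulZl opposite_mulZr.
End Opposite.

(* The row-by-column product over a possibly non-unital algebra, for which
   MathComp's *m is not available. *)
Definition numulmx (U : nualgType F) (M N : 'M[U]_2) : 'M[U]_2 :=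
  \matrix_(i, k) \sum_j M i j ** N j k.

(* The pair (u, v) stands for the matrix with rows (u, v) and (0, 0); see
   Aalg_mxD, Aalg_mxZ and Aalg_mxM. *)
Definition Aalg (U : nualgType F) : Type := (U * U)%type.

Section AAlgebra.
Variable U : nualgType F.
HB.instance Definition _ := GRing.Lmodule.on (Aalg U).

Definition Aalg_mul (x y : Aalg U) : Aalg U := (x.1 ** y.1, x.1 ** y.2).

Lemma Aalg_mulA : associative Aalg_mul.
Proof. by move=> x y z; rewrite /Aalg_mul /= !numulA. Qed.

Lemma Aalg_mulDl : left_distributive Aalg_mul +%R.
Proof. by move=> x y z; rewrite /Aalg_mul /= !numulDl. Qed.

Lemma Aalg_mulDr : right_distributive Aalg_mul +%R.
Proof. by move=> x y z; rewrite /Aalg_mul /= !numulDr. Qed.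

Lemma Aalg_mulZl (a : F) (x y : Aalg U) :
  Aalg_mul (a *: x) y = a *: Aalg_mul x y.
Proof. by rewrite /Aalg_mul /= !numulZl. Qed.

Lemma Aalg_mulZr (a : F) (x y : Aalg U) :
  Aalg_mul x (a *: y) = a *: Aalg_mul x y.
Proof. by rewrite /Aalg_mul /= !numulZr. Qed.

HB.instance Definition _ := Lmodule_isNUAlgebra.Build F (Aalg U)
  Aalg_mulA Aalg_mulDl Aalg_mulDr Aalg_mulZl Aalg_mulZr.

Definition Aalg_mx (x : Aalg U) : 'M[U]_2 :=
  \matrix_(i, j) if i == 0 then if j == 0 then x.1 else x.2 else 0.

Lemma Aalg_mx_inj : injective Aalg_mx.
Proof.
move=> [u v] [u' v'] /matrixP e.
by have := e 0 0; have := e 0 1; rewrite !mxE /= => -> ->.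
Qed.

Lemma Aalg_mxD x y : Aalg_mx (x + y) = Aalg_mx x + Aalg_mx y.
Proof.
by apply/matrixP=> i j; rewrite !mxE; case: (i == 0); case: (j == 0);
  rewrite ?addr0.
Qed.

Lemma Aalg_mxZ (a : F) x : Aalg_mx (a *: x) = map_mx ( *:%R a) (Aalg_mx x).
Proof.
by apply/matrixP=> i j; rewrite !mxE; case: (i == 0); case: (j == 0);
  rewrite ?scaler0.
Qed.

Lemma Aalg_mxM x y : Aalg_mx (x ** y) = numulmx (Aalg_mx x) (Aalg_mx y).
Proof.
apply/matrixP=> i k; rewrite !mxE big_ord_recl big_ord1 !mxE /=.
by case: (i == 0); case: (k == 0); rewrite ?numulr0 ?numul0r ?addr0.
Qed.
End AAlgebra.

(* The pair (b, c) stands for the matrix with rows (b, c) and (0, sigma b);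
   see Balg_mxD, Balg_mxZ and Balg_mxM.  'AEnd(G) is the type of F-algebra
   endomorphisms of G, which are automorphisms since G is a finite extension of
   F (AEnd_lker0); an automorphism of G whose invariant field contains F is
   F-linear, so these are all the automorphisms that matter. *)
Definition Balg (G : fieldExtType F) (sigma : 'AEnd(G)) : Type := (G * G)%type.

Section BAlgebra.
Variables (G : fieldExtType F) (sigma : 'AEnd(G)).
HB.instance Definition _ := GRing.Lmodule.on (Balg sigma).

Definition Balg_mul (x y : Balg sigma) : Balg sigma :=
  (x.1 * y.1, x.1 * y.2 + x.2 * sigma y.1).

Lemma Balg_mulA : associative Balg_mul.
Proof.
move=> x y z; rewrite /Balg_mul /= rmorphM mulrA.
by congr pair; rewrite mulrDr mulrDl !mulrA addrA.
Qed.

Lemma Balg_mulDl : left_distributive Balg_mul +%R.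
Proof.
by move=> x y z; rewrite /Balg_mul /= !mulrDl; congr pair; rewrite addrACA.
Qed.

Lemma Balg_mulDr : right_distributive Balg_mul +%R.
Proof.
move=> x y z; rewrite /Balg_mul /= raddfD /= !mulrDr.
by congr pair; rewrite addrACA.
Qed.

Lemma Balg_mulZl (a : F) (x y : Balg sigma) :
  Balg_mul (a *: x) y = a *: Balg_mul x y.
Proof.
by rewrite /Balg_mul /= -!scalerAl; congr pair; rewrite /= scalerDr.
Qed.

Lemma Balg_mulZr (a : F) (x y : Balg sigma) :
  Balg_mul x (a *: y) = a *: Balg_mul x y.
Proof.
by rewrite /Balg_mul /= linearZ /= -!scalerAr; congr pair; rewrite /= scalerDr.
Qed.

HB.instance Definition _ := Lmodule_isNUAlgebra.Build F (Balg sigma)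
  Balg_mulA Balg_mulDl Balg_mulDr Balg_mulZl Balg_mulZr.

Definition Balg_mx (x : Balg sigma) : 'M[G]_2 :=
  \matrix_(i, j) if i == 0 then if j == 0 then x.1 else x.2
                 else if j == 0 then 0 else sigma x.1.

Lemma Balg_mx_inj : injective Balg_mx.
Proof.
move=> [b c] [b' c'] /matrixP e.
by have := e 0 0; have := e 0 1; rewrite !mxE /= => -> ->.
Qed.

Lemma Balg_mxD x y : Balg_mx (x + y) = Balg_mx x + Balg_mx y.
Proof.
apply/matrixP=> i j; rewrite !mxE.
by case: (i == 0); case: (j == 0); rewrite ?addr0 ?raddfD.
Qed.

Lemma Balg_mxZ (a : F) x : Balg_mx (a *: x) = a%:A *: Balg_mx x.
Proof.
apply/matrixP=> i j; rewrite !mxE mulr_algl.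
by case: (i == 0); case: (j == 0); rewrite ?scaler0 ?linearZ.
Qed.

Lemma Balg_mxM x y : Balg_mx (x ** y) = Balg_mx x *m Balg_mx y.
Proof.
apply/matrixP=> i k; rewrite !mxE big_ord_recl big_ord1 !mxE /=.
by case: (i == 0); case: (k == 0); rewrite ?mulr0 ?mul0r ?addr0 ?add0r ?rmorphM.
Qed.
End BAlgebra.

(* The defining relations of C, and C itself by generators and relations. *)
Inductive Calg_rel : free_nualg F -> Prop :=
| Calg_rel_comm i j : Calg_rel (nucomm (free_var F i) (free_var F j))
| Calg_rel_sq i : Calg_rel (free_var F i ** free_var F i).

Definition Calg : nualgType F := nuquot Calg_rel.

Definition Falg : nualgType F := forget_unit F^o.

(* {subfield G} ranges over the subfields of G that contain F. *)
Definition maximal_subfield (G : fieldExtType F) (K : {subfield G}) : Prop :=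
  (K : {vspace G}) <> fullv /\
  forall L : {subfield G}, (K <= L)%VS ->
    L = K :> {vspace G} \/ L = fullv :> {vspace G}.

Definition unique_maximal_subfield (G : fieldExtType F) (K : {subfield G}) :
    Prop :=
  maximal_subfield K /\
  forall L : {subfield G}, maximal_subfield L -> L = K :> {vspace G}.

End Constructions.

Section Varieties.
Variable F : fieldType.
Notation FX := (free_nualg F).

Definition satisfies (A : nualgType F) (f : FX) : Prop :=
  forall rho : nat -> A, free_eval rho f = 0.

(* Classes of algebras are predicates. *)
Definition is_variety (V : nualgType F -> Prop) : Prop :=
  exists S : FX -> Prop,
    forall A : nualgType F, V A <-> (forall f, S f -> satisfies A f).

Definition subvariety (W V : nualgType F -> Prop) : Prop :=
  is_variety W /\ forall A, W A -> V A.

Definition proper_subvariety (W V : nualgType F -> Prop) : Prop :=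
  subvariety W V /\ ~ (forall A, V A -> W A).

Definition generated_by (V : nualgType F -> Prop) (A : nualgType F) : Prop :=
  [/\ is_variety V, V A &
      forall W, is_variety W -> W A -> forall B, V B -> W B].

Definition identities (V : nualgType F -> Prop) (f : FX) : Prop :=
  forall A, V A -> satisfies A f.

Definition T_ideal (I : FX -> Prop) : Prop :=
  nuideal I /\
  forall phi : FX -> FX, nualg_morphism phi -> forall f, I f -> I (phi f).

Definition prime_variety (V : nualgType F -> Prop) : Prop :=
  forall I J : FX -> Prop, T_ideal I -> T_ideal J ->
    (forall f, nuideal_mul I J f -> identities V f) ->
    (forall f, I f -> identities V f) \/ (forall f, J f -> identities V f).

(* lie_word m is the left-normed commutator of the m + 2 variables
   x_0, ..., x_(m + 1), that is W_(m + 2). *)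
Fixpoint lie_word (m : nat) : FX :=
  if m is m'.+1 then nucomm (lie_word m') (free_var F m.+1)
  else nucomm (free_var F 0) (free_var F 1).

Definition lie_nilpotent (V : nualgType F -> Prop) : Prop :=
  exists m, identities V (lie_word m).

Definition almost_lie_nilpotent (V : nualgType F -> Prop) : Prop :=
  ~ lie_nilpotent V /\ forall W, proper_subvariety W V -> lie_nilpotent W.

End Varieties.

(* Main.v *)
(* Let R be the relatively free algebra of an almost Lie nilpotent non-prime
   variety V.  A nonzero ideal of R stable under endomorphisms contains all the
   left-normed commutators of some length, so non-primeness gives an ideal L
   generated by commutators with L^2 = 0.  Let A be the set of elements of R
   whose endomorphic images commute with R on both sides of L.  The left and
   right actions of A on L are two homomorphisms l, r from A to the centroid E of
   L, and f = 0 in R forces f to vanish on the triangular matrices with diagonal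
   (l a, r a) and arbitrary entry of E above it.  If l and r differ, one of the
   five algebras lies in V: if l a = (l a)^i (r a)^j holds for all a only
   when (i, j) = (1, 0), then the independence of characters yields A(C) (and
   its opposite if this holds with l and r exchanged); otherwise l = l^Q and
   r = r^Q for a power Q of |F|, so that everything takes place in finite fields,
   where a pair of non-conjugate eigenvalues of l a and r a gives A(F) or its
   opposite and a conjugate pair gives B(F, G, sigma).  If l = r,
   then A commutes with L and a descent on the length of the commutators that
   annihilate L makes R Lie nilpotent, a contradiction.

   Conversely, a proper subvariety of the variety of one of the five algebras
   which is not Lie nilpotent contains, by Zorn's lemma, an almost Lie nilpotent
   one; it satisfies [x,y]s[z,t] = 0, so the argument above finds one of the five
   algebras in it, and identities in few variables show that this algebra
   generates the whole variety. *)
From HB Require Import structures.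
Require Import Defs.
From mathcomp Require Import all_boot all_order all_algebra all_field.
From mathcomp Require Import finmap boolp classical_sets.
From mathcomp Require Import ring zify cyclic.
From mathcomp.multinomials Require Import monalg.

Set Implicit Arguments.
Unset Strict Implicit.
Unset Printing Implicit Defensive.

Import GRing.Theory.
Local Open Scope ring_scope.
Local Open Scope nualg_scope.

(** * Evaluation in the free algebra *)

(** The ring E has zero divisors, so the vanishing of a single product says nothing. Primeness holds
    only for whole families of elements of E that are indexed by tuples from A and equivariant under
    endomorphisms: if two of them annihilate each other, one is zero, since otherwise the images of
    both contain all commutators of some length and the longer ones would vanish. The characters l^i
    r^j are such families. The triangular matrices come from evaluating f at a_k + e_k(w) with w in
    L: as L^2 = 0, the part in L is additive in w, with left factors acting through l and right
    factors through r. C appears because the only assumption is that l is no other l^i r^j;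
    independence then forces exactly the coefficients at monomials squarefree in l to vanish. The
    condition on the invariant field comes from a choice of least degree: a polynomial that
    annihilates l a on a part of E where l a and r a differ is taken of least degree over all a at
    once, and so every element of G moved by sigma has full degree, that is, generates G. *)

Section LinearExtension.
Variables (F : fieldType) (K : choiceType) (M : lmodType F) (k : K -> M).

Definition malg_lin (p : {malg F[K]}) : M := \sum_(w <- msupp p) p@_w *: k w.

Lemma malg_linEw (d : {fset K}) p : (msupp p `<=` d)%fset ->
  malg_lin p = \sum_(w <- d) p@_w *: k w.
Proof.
move=> sub; rewrite /malg_lin (big_fset_incl _ sub) // => w _.
by move=> /mcoeff_outdom->; rewrite scale0r.
Qed.

Lemma malg_lin_linear : linear malg_lin.
Proof.
move=> a p q.
have sub: (msupp (a *: p + q) `<=` msupp p `|` msupp q)%fset.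
  apply: fsubset_trans (msuppD_le _ _) _.
  by apply: fsetSU; apply: msuppZ_le.
rewrite (malg_linEw sub) (malg_linEw (fsubsetUl _ (msupp q)))
   (malg_linEw (fsubsetUr (msupp p) _)) scaler_sumr -big_split /=.
by apply: eq_bigr => w _; rewrite mcoeffD mcoeffZ scalerDl scalerA.
Qed.

HB.instance Definition _ := GRing.isLinear.Build F _ _ _ malg_lin malg_lin_linear.

Lemma malg_linU w : malg_lin << w >> = k w.
Proof. by rewrite (malg_linEw msuppU_le) big_seq_fset1 mcoeffUU scale1r. Qed.
End LinearExtension.

Section FreeTheory.
Variable F : fieldType.
Implicit Types A B : nualgType F.

Lemma nuprod_cons A (x : A) s : s != [::] -> nuprod (x :: s) = x ** nuprod s.
Proof.
case: s => // y s _ /=; elim: s x y => //= z s IH x y.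
by rewrite (IH (x ** y) z) (IH y z) numulA.
Qed.

Lemma nuprod_cat A (s t : seq A) : s != [::] -> t != [::] ->
  nuprod (s ++ t) = nuprod s ** nuprod t.
Proof.
elim: s => // x s IH _ t0; case: (eqVneq s [::]) => [->|s0].
  exact: nuprod_cons.
have st0: s ++ t != [::] by case: (s) s0.
by rewrite cat_cons !nuprod_cons // IH // numulA.
Qed.

Lemma nuprod_map A B (f : A -> B) : {morph f : x y / x ** y} ->
  forall s, s != [::] -> nuprod (map f s) = f (nuprod s).
Proof.
move=> fM; case=> // x s _ /=; elim: s x => //= y s IH x.
by rewrite -fM IH.
Qed.

Definition wev A (rho : nat -> A) (w : seq nat) : A := nuprod [seq rho i | i <- w].

Definition malg_ev A (rho : nat -> A) : {malg F[{fmonom nat}]} -> A :=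
  malg_lin (fun w : {fmonom nat} => wev rho (w : seq nat)).

HB.instance Definition _ A (rho : nat -> A) := GRing.Linear.on (malg_ev rho).

Lemma malg_evU A (rho : nat -> A) w : malg_ev rho << w >> = wev rho (w : seq nat).
Proof. exact: malg_linU. Qed.

Lemma free_evalE A (rho : nat -> A) f : free_eval rho f = malg_ev rho (val f).
Proof. by []. Qed.

Lemma monalgUZ (c : F) (w : {fmonom nat}) :
  << c *g w >> = c *: << w >> :> {malg F[{fmonom nat}]}.
Proof.
apply/malgP => k; rewrite mcoeffZ.
by rewrite (mcoeffU w c k) (mcoeffU w 1 k) mulrnAr mulr1.
Qed.

Lemma monalgEZ (p : {malg F[{fmonom nat}]}) : p = \sum_(w <- msupp p) p@_w *: << w >>.
Proof. by rewrite {1}[p]monalgE; apply: eq_bigr => w _; apply: monalgUZ. Qed.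

Lemma free_eval_linear A (rho : nat -> A) : linear (free_eval rho).
Proof. by move=> a p q; rewrite !free_evalE linearP. Qed.

HB.instance Definition _ A (rho : nat -> A) :=
  GRing.isLinear.Build F _ _ _ (free_eval rho) (free_eval_linear rho).

Lemma msupp_free (f : free_nualg F) (w : {fmonom nat}) :
  w \in msupp (val f) -> (w : seq nat) != [::].
Proof.
have /= f0 := valP f.
rewrite -mcoeff_neq0; apply: contraNneq => w0.
move: f0; rewrite unfold_in /no_const.
by congr (_ == _); congr (mcoeff _ _); apply/eqP; rewrite fmP w0 fm1.
Qed.

(** Constant terms must be absent here: [nuprod] is multiplicative for the concatenation of nonempty
    words only. *)
Lemma free_evalM A (rho : nat -> A) : {morph free_eval rho : f g / f ** g}.
Proof.
move=> f g; rewrite !free_evalE /=.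
have -> : val f * val g = \sum_(u <- msupp (val f)) \sum_(v <- msupp (val g))
    ((val f)@_u * (val g)@_v) *: << mmul u v >>.
  rewrite malgME; apply: eq_bigr => u _; apply: eq_bigr => v _.
  exact: monalgUZ.
rewrite raddf_sum /= {2}/malg_ev.
rewrite (big_morph (fun x => x ** malg_ev rho (val g)) (id1 := 0) (op1 := +%R));
  [|by move=> x y; rewrite numulDl|by rewrite numul0r].
apply: eq_big_seq => u /msupp_free u0.
rewrite raddf_sum /= /malg_ev (big_morph (numul ((val f)@_u *: wev rho (u : seq nat)))
  (id1 := 0) (op1 := +%R)); [|by move=> x y; rewrite numulDr|by rewrite numulr0].
apply: eq_big_seq => v /msupp_free v0.
rewrite -/(malg_ev _ _) linearZ /= malg_evU numulZl numulZr scalerA.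
rewrite /wev fmM map_cat nuprod_cat //; last by case: (v : seq _) v0.
by case: (u : seq _) u0.
Qed.

Lemma free_eval_var A (rho : nat -> A) i : free_eval rho (free_var F i) = rho i.
Proof. by rewrite free_evalE malg_evU /wev fmU. Qed.

Lemma free_eval_morphism A (rho : nat -> A) : nualg_morphism (free_eval rho).
Proof. by split; [apply: linearP | apply: free_evalM]. Qed.

Lemma free_valZ (a : F) (f : free_nualg F) : val (a *: f) = a *: val f.
Proof. exact: linearZ. Qed.

Lemma free_val_sum (I : Type) (r : seq I) (h : I -> free_nualg F) :
  val (\sum_(i <- r) h i) = \sum_(i <- r) val (h i).
Proof. exact: raddf_sum. Qed.

Lemma free_val_word (s : seq nat) : s != [::] ->
  val (nuprod [seq free_var F i | i <- s]) = << FMonom s >>.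
Proof.
elim: s => // i s IH _; case: (eqVneq s [::]) => [->|s0].
  by rewrite /= fmuE.
have s0' : [seq free_var F i | i <- s] != [::] by case: (s) s0.
rewrite map_cons nuprod_cons //=.
rewrite IH // malgME !msuppU1 !big_seq_fset1 !mcoeffU1 !eqxx mulr1.
by congr (<< _ *g _ >>); apply/eqP; rewrite fmP fmM fmU.
Qed.

Lemma free_eval_id f : free_eval (free_var F) f = f.
Proof.
apply: val_inj; rewrite /free_eval free_val_sum [RHS]monalgEZ.
apply: eq_big_seq => w /msupp_free w0.
by rewrite free_valZ; congr (_ *: _); rewrite (free_val_word w0) fmK.
Qed.

Lemma free_nualg_ind (P : free_nualg F -> Prop) :
  (forall i, P (free_var F i)) -> P 0 ->
  (forall f g, P f -> P g -> P (f + g)) ->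
  (forall a f, P f -> P (a *: f)) ->
  (forall f g, P f -> P g -> P (f ** g)) -> forall f, P f.
Proof.
move=> Pv P0 PD PZ PM f; rewrite -[f]free_eval_id /free_eval.
apply: big_ind => // w _; apply: PZ.
case: (w : seq nat) => [//|i s]; elim/last_ind: s => [|s j IH]; first exact: Pv.
have -> : [seq free_var F i | i <- i :: rcons s j] =
  [seq free_var F i | i <- i :: s] ++ [:: free_var F j].
  by rewrite -rcons_cons map_rcons cats1.
by rewrite nuprod_cat; [apply: PM IH (Pv j)|..].
Qed.

Lemma nualg_morphism_free_eval A B (h : A -> B) (rho : nat -> A) f :
  nualg_morphism h -> h (free_eval rho f) = free_eval (h \o rho) f.
Proof.
move=> [hl hM].
have hD : {morph h : x y / x + y} by move=> x y; rewrite -[x]scale1r hl !scale1r.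
have h0 : h 0 = 0 by apply: (addrI (h 0)); rewrite -hD !addr0.
have hZ a x : h (a *: x) = a *: h x by rewrite -[a *: x]addr0 hl h0 addr0.
elim/free_nualg_ind: f => [i||f g IHf IHg|a f IHf|f g IHf IHg].
- by rewrite !free_eval_var.
- by rewrite !linear0.
- by rewrite !linearD hD /= IHf IHg.
- by rewrite !linearZ hZ /= IHf.
- by rewrite !free_evalM hM IHf IHg.
Qed.

Lemma nualg_morphism0 A B (h : A -> B) : nualg_morphism h -> h 0 = 0.
Proof.
move=> [hl _]; apply: (addrI (h 0)); have := hl 1 0 0.
by rewrite !scale1r !addr0 => <-.
Qed.

Lemma nualg_morphismD A B (h : A -> B) : nualg_morphism h -> {morph h : x y / x + y}.
Proof. by move=> [hl _] x y; rewrite -[x]scale1r hl !scale1r. Qed.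

Lemma nualg_morphismZ A B (h : A -> B) : nualg_morphism h ->
  forall a x, h (a *: x) = a *: h x.
Proof.
move=> hm a x; have [hl _] := hm.
by rewrite -[a *: x]addr0 hl (nualg_morphism0 hm) addr0.
Qed.

Lemma nualg_morphismN A B (h : A -> B) : nualg_morphism h -> {morph h : x / - x}.
Proof. by move=> hm x; rewrite -scaleN1r (nualg_morphismZ hm) scaleN1r. Qed.

Lemma nualg_morphismM A B (h : A -> B) : nualg_morphism h -> {morph h : x y / x ** y}.
Proof. by case. Qed.

Lemma nualg_morphism_comp A B (C : nualgType F) (h : A -> B) (k : B -> C) :
  nualg_morphism h -> nualg_morphism k -> nualg_morphism (k \o h).
Proof.
move=> [hl hM] [kl kM]; split=> [a x y|x y] /=; first by rewrite hl kl.
by rewrite hM kM.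
Qed.

Lemma nualg_morphism_id A : nualg_morphism (@id A).
Proof. by []. Qed.

(** Induction on f with a relation in place of a map: it compares evaluations in two algebras that
    no homomorphism need connect. *)
Lemma free_eval_rel A B (rel : A -> B -> Prop) (rho : nat -> A) (tau : nat -> B) :
  (forall i, rel (rho i) (tau i)) -> rel 0 0 ->
  (forall x y x' y', rel x x' -> rel y y' -> rel (x + y) (x' + y')) ->
  (forall a x x', rel x x' -> rel (a *: x) (a *: x')) ->
  (forall x y x' y', rel x x' -> rel y y' -> rel (x ** y) (x' ** y')) ->
  forall f, rel (free_eval rho f) (free_eval tau f).
Proof.
move=> rv r0 rD rZ rM; elim/free_nualg_ind => [i||f g|a f|f g].
- by rewrite !free_eval_var.
- by rewrite !linear0.
- by rewrite !linearD; apply: rD.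
- by rewrite !linearZ; apply: rZ.
- by rewrite !free_evalM; apply: rM.
Qed.

End FreeTheory.

(** * Independence of characters *)

(* The triple (x, v, y) stands for the matrix with rows (x, v) and (0, y). *)
Definition Trialg (F : fieldType) (E : comAlgType F) : Type := (E * E * E)%type.

Section TriAlgebra.
Variables (F : fieldType) (E : comAlgType F).
HB.instance Definition _ := GRing.Lmodule.on (Trialg E).

Definition Tri_mul (s t : Trialg E) : Trialg E :=
  (s.1.1 * t.1.1, s.1.1 * t.1.2 + s.1.2 * t.2, s.2 * t.2).

Lemma Tri_mulA : associative Tri_mul.
Proof.
by move=> [[x v] y] [[x' v'] y'] [[x2 v2] y2]; rewrite /Tri_mul /=; congr (_, _, _); ring.
Qed.

Lemma Tri_mulDl : left_distributive Tri_mul +%R.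
Proof.
by move=> [[x v] y] [[x' v'] y'] [[x2 v2] y2]; rewrite /Tri_mul /=; congr (_, _, _)=> /=; ring.
Qed.

Lemma Tri_mulDr : right_distributive Tri_mul +%R.
Proof.
by move=> [[x v] y] [[x' v'] y'] [[x2 v2] y2]; rewrite /Tri_mul /=; congr (_, _, _)=> /=; ring.
Qed.

Lemma Tri_mulZl (a : F) (s t : Trialg E) : Tri_mul (a *: s) t = a *: Tri_mul s t.
Proof. by rewrite /Tri_mul /= -!scalerAl -scalerDr. Qed.

Lemma Tri_mulZr (a : F) (s t : Trialg E) : Tri_mul s (a *: t) = a *: Tri_mul s t.
Proof. by rewrite /Tri_mul /= -!scalerAr -scalerDr. Qed.

HB.instance Definition _ := Lmodule_isNUAlgebra.Build F (Trialg E)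
  Tri_mulA Tri_mulDl Tri_mulDr Tri_mulZl Tri_mulZr.

Lemma Tri_addE x v y x' v' y' :
  ((x, v, y) : Trialg E) + ((x', v', y') : Trialg E) = (x + x', v + v', y + y').
Proof. by []. Qed.

Lemma Tri_scaleE a x v y : a *: ((x, v, y) : Trialg E) = (a *: x, a *: v, a *: y).
Proof. by []. Qed.

Lemma Tri_mulE x v y x' v' y' :
  ((x, v, y) : Trialg E) ** ((x', v', y') : Trialg E) =
  (x * x', x * v' + v * y', y * y').
Proof. by []. Qed.
End TriAlgebra.

Section AalgE.
Variables (F : fieldType) (U : nualgType F).

Lemma Aalg_addE (u v u' v' : U) : ((u, v) : Aalg U) + ((u', v') : Aalg U) = (u + u', v + v').
Proof. by []. Qed.

Lemma Aalg_mulE (u v u' v' : U) : ((u, v) : Aalg U) ** ((u', v') : Aalg U) = (u ** u', u ** v').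
Proof. by []. Qed.
End AalgE.

Section Characters.
Variables (F : fieldType) (A : nualgType F) (E : comAlgType F).
Variables (l r : A -> E) (nat_fam : forall I : Type, ((I -> A) -> E) -> Prop).

(* The families of elements of E indexed by tuples of elements of A compatibly
   with substitutions.  For them, nat_prime makes up for the zero divisors of
   E. *)
Record natural_family : Prop := NaturalFamily {
  nat_l : forall I (i : I), nat_fam (fun a => l (a i));
  nat_r : forall I (i : I), nat_fam (fun a => r (a i));
  nat_scale : forall I c X, @nat_fam I X -> nat_fam (fun a => c *: X a);
  nat_one : forall I, nat_fam (fun _ : I -> A => 1);
  nat_add : forall I X Y, @nat_fam I X -> nat_fam Y -> nat_fam (fun a => X a + Y a);
  nat_mul : forall I X Y, @nat_fam I X -> nat_fam Y -> nat_fam (fun a => X a * Y a);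
  nat_reindex : forall I J (h : I -> J) X, nat_fam X -> nat_fam (fun a => X (a \o h));
  nat_prime : forall I J X Y, @nat_fam I X -> @nat_fam J Y ->
    (forall a b, X a * Y b = 0) -> (forall a, X a = 0) \/ (forall b, Y b = 0) }.

Definition alg_map (f : A -> E) : Prop :=
  linear f /\ (forall x y, f (x ** y) = f x * f y).

Hypothesis lm : alg_map l.
Hypothesis rm : alg_map r.
Hypothesis nf : natural_family.

Lemma nat_sub I X Y : @nat_fam I X -> nat_fam Y -> nat_fam (fun a => X a - Y a).
Proof.
move=> nX nY; have := nat_add nf nX (nat_scale nf (-1) nY).
by congr nat_fam; apply/funext => a; rewrite scaleN1r.
Qed.

Lemma nat_exp I X n : @nat_fam I X -> nat_fam (fun a => X a ^+ n).
Proof.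
move=> nX; elim: n => [|n IH]; first exact: nat_one.
have := nat_mul nf nX IH; by congr nat_fam; apply/funext => a; rewrite exprS.
Qed.

Lemma nat_prod I (J : Type) (s : seq J) (X : J -> (I -> A) -> E) :
  (forall j, nat_fam (X j)) -> nat_fam (fun a => \prod_(j <- s) X j a).
Proof.
move=> nX; elim: s => [|j s IH].
  by have := @nat_one nf I; congr nat_fam; apply/funext => a; rewrite big_nil.
have := nat_mul nf (nX j) IH; by congr nat_fam; apply/funext => a; rewrite big_cons.
Qed.

Definition tmul I (a b : I -> A) : I -> A := fun i => a i ** b i.

Definition character I (X : (I -> A) -> E) : Prop :=
  nat_fam X /\ forall a b, X (tmul a b) = X a * X b.

(* Artin's proof of the independence of characters, with primeness in place of
   the absence of zero divisors. *)
Lemma character_indep I J (n : nat) (Y0 : (J -> A) -> E) (X0 : (I -> A) -> E)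
    (Y : nat -> (J -> A) -> E) (X : nat -> (I -> A) -> E) :
  nat_fam Y0 -> character X0 -> (forall i, nat_fam (Y i)) ->
  (forall i, character (X i)) ->
  (forall a b, Y0 b * X0 a + \sum_(i < n) Y i b * X i a = 0) ->
  (forall b, Y0 b = 0) \/ (forall a, X0 a = 0) \/
  (exists2 i, (i < n)%N & forall a, X i a = X0 a).
Proof.
move=> nY0 [nX0 mX0] nY cX; elim: n J Y0 Y nY0 nY => [|n IH] J Y0 Y nY0 nY eq0.
  have prm b a : Y0 b * X0 a = 0 by have := eq0 a b; rewrite big_ord0 addr0.
  by have [z|z] := nat_prime nf nY0 nX0 prm; [left|right; left].
have [nXn mXn] := cX n.
(* The relation at [a' a] minus [X n a'] times the relation at [a]: the n-th term cancels, and the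
   new coefficients depend on both b and a', hence the index type [J + I]. *)
case: (IH (J + I)%type (fun c => Y0 (c \o inl) * (X0 (c \o inr) - X n (c \o inr)))
     (fun i c => Y i (c \o inl) * (X i (c \o inr) - X n (c \o inr)))).
- apply: nat_mul => //; first exact: (nat_reindex nf inl).
  apply: nat_sub; exact: (nat_reindex nf inr).
- move=> i; apply: nat_mul => //; first exact: (nat_reindex nf inl).
  have [nXi _] := cX i; apply: nat_sub; exact: (nat_reindex nf inr).
- move=> a c; set b := c \o inl; set a' := c \o inr.
  have e1 := eq0 (tmul a' a) b; have e2 := eq0 a b.
  rewrite big_ord_recr /= mX0 mXn in e1; rewrite big_ord_recr /= in e2.
  transitivity ((Y0 b * (X0 a' * X0 a) +
     (\sum_(i < n) Y i b * X i (tmul a' a) + Y n b * (X n a' * X n a)))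
     - X n a' * (Y0 b * X0 a + (\sum_(i < n) Y i b * X i a + Y n b * X n a))).
    rewrite [X in _ + X = _](_ : _ =
      \sum_(i < n) Y i b * X i (tmul a' a) - X n a' * \sum_(i < n) Y i b * X i a).
      by ring.
    rewrite mulr_sumr -sumrB; apply: eq_bigr => i _.
    have [_ ->] := cX i; ring.
  by rewrite e1 e2 mulr0 subr0.
(* If the new leading coefficient vanishes, primeness gives Y0 = 0 or X0 = X n. *)
- move=> z; have [//| |b a||e] := @nat_prime nf J I Y0 (fun a => X0 a - X n a).
  + exact: nat_sub.
  + have := z (fun c => match c with inl j => b j | inr i => a i end).
    by congr (Y0 _ * (X0 _ - X n _) = 0); apply/funext.
  + by left.
  + right; right; exists n => // a; apply/esym/eqP; by rewrite -subr_eq0 e.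
- case=> [z|[i ltin e]]; [by right; left|right; right].
  by exists i => //; apply: ltnW.
Qed.
End Characters.

(** * Commutative polynomials and the algebra C *)

Section CommEval.
Variables (F : fieldType) (I : choiceType) (E : comAlgType F).
Implicit Types (u : I -> E) (m : {cmonom I}).

Definition cm_eval u m : E := \prod_(i <- finsupp m) u i ^+ m i.

Lemma cm_evalEw u m (d : {fset I}) : (finsupp m `<=` d)%fset ->
  cm_eval u m = \prod_(i <- d) u i ^+ m i.
Proof.
move=> sub; rewrite /cm_eval (big_fset_incl _ sub) // => i _.
by rewrite -cmE_eq0 => /eqP->; rewrite expr0.
Qed.

Lemma cm_eval_mmorphism u : mmorphism (cm_eval u).
Proof.
split=> [m n|]; last first.
  by rewrite /cm_eval mdom1 big_seq_fset0.
rewrite (cm_evalEw u (fsubsetUl (finsupp m) (finsupp n))).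
rewrite (cm_evalEw u (fsubsetUr (finsupp m) (finsupp n))).
rewrite /cm_eval mdomD -big_split /=; apply: eq_bigr => i _.
by rewrite cmM exprD.
Qed.

HB.instance Definition _ u := isMultiplicative.Build _ _ (cm_eval u) (cm_eval_mmorphism u).

Lemma cm_evalU u i : cm_eval u (ucm i) = u i.
Proof. by rewrite /cm_eval mdomU big_seq_fset1 cmUU expr1. Qed.

Lemma cm_eval_prod u v m : cm_eval (fun i => u i * v i) m = cm_eval u m * cm_eval v m.
Proof. by rewrite /cm_eval -big_split; apply: eq_bigr => i _; rewrite exprMn. Qed.

Definition poly_eval u : {malg F[{cmonom I}]} -> E := mmap (in_alg E) (cm_eval u).

HB.instance Definition _ u := GRing.RMorphism.on (poly_eval u).

Lemma poly_evalE u p : poly_eval u p = \sum_(m <- msupp p) p@_m *: cm_eval u m.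
Proof. by rewrite /poly_eval mmapE; apply: eq_bigr => m _; rewrite /= mulr_algl. Qed.

Lemma poly_evalZ u c p : poly_eval u (c *: p) = c *: poly_eval u p.
Proof. by rewrite /poly_eval mmapZ /= mulr_algl. Qed.

Lemma poly_evalX u i : poly_eval u << ucm i >> = u i.
Proof. by rewrite /poly_eval mmapU /= scale1r mul1r cm_evalU. Qed.

(** The values 1 elsewhere isolate two exponents; this tells how a monomial changes when one entry
    of a tuple is multiplied by t. *)
Lemma cm_eval2 (i j : I) (x y : E) m : i != j ->
  cm_eval (fun k => if k == i then x else if k == j then y else 1) m
    = x ^+ m i * y ^+ m j.
Proof.
move=> nij; have sub : (finsupp m `<=` i |` (j |` finsupp m))%fset.
  by apply: fsubset_trans (fsubsetU1 _ _); apply: fsubsetU1.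
rewrite (cm_evalEw _ sub) (big_fsetD1 i) ?fset1U1 //= eqxx; congr (_ * _).
rewrite (big_fsetD1 j) /=; last first.
  by rewrite !inE eqxx eq_sym nij /= orbT.
rewrite eqxx eq_sym (negPf nij) big_seq big1 ?mulr1 // => k.
by rewrite !inE => /and3P[/negPf-> /negPf-> _]; rewrite expr1n.
Qed.
End CommEval.

Section Squarefree.
Variables (F : fieldType) (A : nualgType F) (E : comAlgType F).
Variables (l r : A -> E) (nat_fam : forall I : Type, ((I -> A) -> E) -> Prop).
Hypotheses (lm : alg_map l) (rm : alg_map r) (nf : natural_family l r nat_fam).

Lemma alg_mapD (f : A -> E) : alg_map f -> {morph f : x y / x + y}.
Proof. by move=> [fl _] x y; rewrite -[x]scale1r fl !scale1r. Qed.

Lemma alg_map0 (f : A -> E) : alg_map f -> f 0 = 0.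
Proof. by move=> fm; apply: (addrI (f 0)); rewrite -(alg_mapD fm) !addr0. Qed.

Lemma alg_mapZ (f : A -> E) : alg_map f -> forall c x, f (c *: x) = c *: f x.
Proof. by move=> fm c x; rewrite -[c *: x]addr0 fm.1 (alg_map0 fm) addr0. Qed.

Definition two_sided (a : nat -> A) (z : nat + nat) : E :=
  match z with inl i => l (a i) | inr i => r (a i) end.

(** Apart from 1, these monomials correspond to the nonzero products of generators of C. *)
Definition squarefree (m : {cmonom (nat + nat)%type}) : Prop :=
  forall i, (m (inl i) <= 1)%N /\ m (inr i) = 0%N.

(** The negation keeps the character l apart from 0 and from all other l^i r^j, which separates the
    squarefree monomials from the rest. *)
Definition degenerate : Prop :=
  (forall a, l a = 0) \/
  (exists2 ij : nat * nat, ij != (1, 0)%N &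
     forall a, l a = l a ^+ ij.1 * r a ^+ ij.2).

(** The variables are distinct, so their values can be chosen independently and primeness peels off
    one factor at a time. *)
Lemma prime_prod_l (s : seq (nat + nat)%type) : uniq s ->
  all (fun z => if z is inl _ then true else false) s ->
  (forall a, \prod_(z <- s) two_sided a z = 0) -> forall a, l a = 0.
Proof.
elim: s => [_ _ /(_ (fun => 0)) /eqP|[i|//] s IH /= /andP[nis us] als pr0].
  by rewrite big_nil oner_eq0.
have := @nat_prime _ _ _ _ _ _ nf unit nat (fun a => l (a tt))
  (fun b => \prod_(z <- s) two_sided b z) (nat_l nf tt).
case=> [|a b||]; last 1 [exact: IH].
- apply: (nat_prod nf s (X := fun z b => two_sided b z)) => -[j|j].
    exact: (nat_l nf).
  exact: (nat_r nf).
- have := pr0 (fun j => if j == i then a tt else b j).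
  rewrite big_cons /= eqxx => e; rewrite -[RHS]e; congr (_ * _).
  apply: eq_big_seq => -[j|j] js /=; last by have /allP /(_ _ js) := als.
  by case: eqP js nis => // -> ->.
- by move=> z a; have := z (fun=> a).
Qed.

Lemma character_monom m : character nat_fam (fun a : nat -> A => cm_eval (two_sided a) m).
Proof.
split.
  apply: (nat_prod nf (finsupp m) (X := fun z a => two_sided a z ^+ m z)) => -[j|j].
    exact: (nat_exp nf _ (nat_l nf j)).
  exact: (nat_exp nf _ (nat_r nf j)).
move=> a b; rewrite -cm_eval_prod; congr cm_eval; apply/funext => -[i|i] /=.
  by rewrite lm.2.
by rewrite rm.2.
Qed.

(** Each monomial is a character of the tuple a. If m had a nonzero coefficient, independence would
    equate its character with that of another monomial m' of p; varying one entry at which the two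
    differ then makes l degenerate. *)
Lemma squarefree_coef p : ~ degenerate ->
  (forall a : nat -> A, poly_eval (two_sided a) p = 0) ->
  forall m, squarefree m -> p@_m = 0.
Proof.
move=> ndeg p0 m sqm; apply/eqP; apply: contraT => pm0.
have mp : m \in msupp p by rewrite -mcoeff_neq0.
have lzero : (forall a, cm_eval (two_sided a) m = 0) -> False.
  move=> z; apply: ndeg; left.
  apply: (@prime_prod_l (finsupp m)).
  - exact: fset_uniq.
  - apply/allP => -[i|i] //; rewrite -cmE_neq0.
    by have [_ ->] := sqm i.
  - move=> a; rewrite -[RHS](z a); apply: eq_big_seq => -[i|i]; rewrite -cmE_neq0.
      by have [] := sqm i; case: (m _) => [|[|k]] //; rewrite expr1.
    by have [_ ->] := sqm i.
set s : seq {cmonom (nat + nat)%type} := (msupp p `\ m)%fset.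
have := @character_indep _ _ _ _ _ _ nf nat nat (size s) (fun=> p@_m *: 1)
   (fun a => cm_eval (two_sided a) m) (fun i _ => p@_(nth m s i) *: 1)
   (fun i a => cm_eval (two_sided a) (nth m s i)).
have ncst c : nat_fam (fun _ : nat -> A => c *: 1).
  by apply: (nat_scale nf); apply: (nat_one nf).
case.
- exact: ncst.
- exact: character_monom.
- by move=> i; apply: ncst.
- by move=> i; apply: character_monom.
- move=> a b; rewrite -[RHS](p0 a) poly_evalE (big_fsetD1 m) //=.
  rewrite mulr_algl (big_nth m) big_mkord; congr (_ + _).
  by apply: eq_bigr => i _; rewrite mulr_algl.
- move=> /(_ (fun=> 0)) /eqP; rewrite scaler_eq0 oner_eq0 orbF.
  by rewrite (negPf pm0).
case=> [/lzero //|[k ks e]].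
set m' := nth m s k in e.
have m'm : m' != m.
  have : m' \in s by apply: mem_nth.
  by rewrite !inE => /andP[].
have [i ni] : exists i, (m' (inl i), m' (inr i)) != (m (inl i), 0%N).
  apply: contraPP m'm => /forallNP z; apply/negP; rewrite negbK.
  apply/cmP => -[i|i]; have := z i => /negP; rewrite negbK => /eqP[] //.
  by move=> _ ->; have [_ ->] := sqm i.
(* The i-th entry of a is replaced by [t ** a i] in the equality of the two characters. *)
have scale t a : (l t ^+ m (inl i) - l t ^+ m' (inl i) * r t ^+ m' (inr i)) *
    cm_eval (two_sided a) m = 0.
  pose b := fun j => if j == i then t ** a j else a j.
  have eb n : cm_eval (two_sided b) n =
     l t ^+ n (inl i) * r t ^+ n (inr i) * cm_eval (two_sided a) n.
    rewrite -cm_eval2 // -cm_eval_prod; congr cm_eval; apply/funext => -[j|j].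
      rewrite /= /b [inl j == _](_ : _ = (j == i)) //.
      by case: eqP => _ /=; rewrite ?mul1r // lm.2.
    rewrite /= /b [inr j == _](_ : _ = (j == i)) //.
    by case: eqP => _ /=; rewrite ?mul1r // rm.2.
  have h := e b; have [_ m0] := sqm i.
  by rewrite !eb e m0 expr0 mulr1 in h; rewrite mulrBl h subrr.
have := @nat_prime _ _ _ _ _ _ nf unit nat (fun t => l (t tt) ^+ m (inl i) -
  l (t tt) ^+ m' (inl i) * r (t tt) ^+ m' (inr i)) (fun a => cm_eval (two_sided a) m).
case.
- apply: (nat_sub nf); first exact: (nat_exp nf _ (nat_l nf tt)).
  apply: (nat_mul nf); first exact: (nat_exp nf _ (nat_l nf tt)).
  exact: (nat_exp nf _ (nat_r nf tt)).
- by have [] := character_monom m.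
- by move=> t a; apply: scale.
- move=> z; have {z}z t : l t ^+ m (inl i) = l t ^+ m' (inl i) * r t ^+ m' (inr i).
    by apply/eqP; rewrite -subr_eq0; apply/eqP/(z (fun=> t)).
  have [m1 _] := sqm i; case: (m (inl i)) m1 ni z => [|[|//]] _ ni z; last first.
    by case: ndeg; right; exists (m' (inl i), m' (inr i)) => // a; rewrite -z expr1.
  (* Here m omits the index i while m' involves it: at t = 0 the equality reads 1 = 0. *)
  have := z 0; rewrite (alg_map0 lm) (alg_map0 rm) expr0 !expr0n.
  move: ni; rewrite xpair_eqE; case: (_ == _); case: (_ == _) => // _ /eqP;
  by rewrite ?mul0r ?mulr0 oner_eq0.
- by move=> /lzero.
Qed.
End Squarefree.

Definition pvar (F : fieldType) (z : (nat + nat)%type) :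
  {malg F[{cmonom (nat + nat)%type}]} := << ucm z >>.

(* Locked: unification would otherwise unfold the evaluation. *)
HB.lock Definition ab_l (F : fieldType) (f : free_nualg F) :
    {malg F[{cmonom (nat + nat)%type}]} :=
  free_eval (fun i => pvar F (inl i) : forget_unit {malg F[{cmonom (nat + nat)%type}]}) f.

Section Commutative.
Variables (F : fieldType).

Lemma nuprod_perm (B : nualgType F) : (forall x y : B, x ** y = y ** x) ->
  forall s t : seq B, perm_eq s t -> nuprod s = nuprod t.
Proof.
move=> cB s t st; pose P u := nuprod s = nuprod u.
apply: (catCA_perm_ind (P := P) _ st) => // s1 s2 s3; rewrite /P => ->.
have [->|n1] := eqVneq s1 [::]; first by [].
have [->|n2] := eqVneq s2 [::]; first by [].
have [->|n3] := eqVneq s3 [::].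
  by rewrite !cats0 !nuprod_cat // cB.
have nn (u : seq B) v : u != [::] -> u ++ v != [::] by case: u.
by rewrite !nuprod_cat ?nn // !numulA [nuprod s1 ** _]cB.
Qed.

Notation P := {malg F[{cmonom (nat + nat)%type}]}.
Notation FX := (free_nualg F).
Local Notation pvar := (pvar F).
Implicit Types (f g : FX).

Lemma ab_lM f g : ab_l (f ** g) = ab_l f * ab_l g.
Proof. by rewrite ab_l.unlock free_evalM. Qed.

Lemma ab_lD f g : ab_l (f + g) = ab_l f + ab_l g.
Proof. by rewrite ab_l.unlock linearD. Qed.

Lemma ab_lB f g : ab_l (f - g) = ab_l f - ab_l g.
Proof. by rewrite ab_l.unlock linearB. Qed.

Lemma ab_lZ a f : ab_l (a *: f) = a *: ab_l f.
Proof. by rewrite ab_l.unlock linearZ. Qed.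

Lemma ab_l_var i : ab_l (free_var F i) = pvar (inl i).
Proof. by rewrite ab_l.unlock free_eval_var. Qed.

Definition cword (w : seq nat) : {cmonom (nat + nat)%type} :=
  foldr (fun i m => mmul (ucm (inl i)) m) mone w.

Lemma cword_l w i : cword w (inl i) = count_mem i w.
Proof.
elim: w => [|j w IH] /=; first by rewrite cm1.
by rewrite cmM cmU IH [inl j == _](_ : _ = (j == i)).
Qed.

Lemma cword_r w i : cword w (inr i) = 0%N.
Proof. by elim: w => [|j w IH] /=; rewrite ?cm1 // cmM cmU IH. Qed.

Lemma cword_perm v w : cword v = cword w -> perm_eq v w.
Proof. by move=> e; apply/allP => i _ /=; rewrite -!cword_l e. Qed.

Lemma malg_UM (m n : {cmonom (nat + nat)%type}) : << m >> * << n >> = << mmul m n >> :> P.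
Proof. by rewrite malgM_def (fgmulUU 1 1 m n) mulr1. Qed.

Lemma ab_l_word w : w != [::] ->
  ab_l (nuprod [seq free_var F i | i <- w]) = << cword w >>.
Proof.
elim: w => // i w IH _; case: (eqVneq w [::]) => [->|w0].
  by rewrite /= ab_l_var mulm1.
have w0' : [seq free_var F i | i <- w] != [::] by case: (w) w0.
by rewrite map_cons nuprod_cons // ab_lM IH // ab_l_var malg_UM.
Qed.

Lemma squarefree_M m n : squarefree (mmul m n) -> squarefree m /\ squarefree n.
Proof.
by move=> sq; split=> i; have := sq i; rewrite !cmM; case; lia.
Qed.

(** On polynomials [ab_l f] this describes the kernel of the map to C, by [Cpi_nosqf] and
    [nosqf_Cpi]. *)
Definition nosqf (p : P) : Prop := forall m, squarefree m -> p@_m = 0.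

Lemma nosqfM p q : nosqf q -> nosqf (p * q).
Proof.
move=> qn m sqm; rewrite mcoeffMl big1_fset // => u _ _; rewrite big1_fset // => v _ _.
case: eqP => [e|]; last by rewrite mulr0n.
have [|_ sqv] := @squarefree_M u v; first by rewrite e.
by rewrite (qn v sqv) mulr0 mul0rn.
Qed.

Lemma nosqfD p q : nosqf p -> nosqf q -> nosqf (p + q).
Proof. by move=> pn qn m sqm; rewrite mcoeffD pn // qn // addr0. Qed.

Lemma nosqfZ a p : nosqf p -> nosqf (a *: p).
Proof. by move=> pn m sqm; rewrite mcoeffZ pn // mulr0. Qed.

Lemma nosqf0 : nosqf 0.
Proof. by move=> m _; rewrite mcoeff0. Qed.

Lemma nosqf_sq i : nosqf (pvar (inl i) * pvar (inl i)).
Proof.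
move=> m sqm; rewrite /pvar malg_UM mcoeffU1; case: eqP => // e.
by have [] := sqm i; rewrite -e cmM !cmUU.
Qed.

Lemma nosqf_ideal : nuideal (fun f => nosqf (ab_l f)).
Proof.
split.
- by rewrite ab_l.unlock linear0; exact: nosqf0.
- by move=> f g; rewrite ab_lD; apply: nosqfD.
- by move=> a f; rewrite ab_lZ; apply: nosqfZ.
- move=> f g h; rewrite !ab_lM; split; first exact: nosqfM.
  by rewrite mulrC; apply: nosqfM.
Qed.

Lemma Calg_rel_nosqf f : nuideal_gen (@Calg_rel F) f -> nosqf (ab_l f).
Proof.
move=> If; apply: (If (fun f => nosqf (ab_l f)) nosqf_ideal).
move=> _ [i j|i]; last by rewrite ab_lM !ab_l_var; apply: nosqf_sq.
rewrite /nucomm ab_lB !ab_lM.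
by rewrite mulrC subrr; apply: nosqf0.
Qed.

Definition Cpi (f : FX) : Calg F := nuquot_pi (@Calg_rel F) f.

Lemma Cpi_morphism : nualg_morphism Cpi.
Proof.
split=> [a x y|x y]; first by rewrite /Cpi nuquot_piD nuquot_piZ.
by rewrite /Cpi -nuquot_mulE.
Qed.

Lemma Cpi_eq0 f : Cpi f = 0 <-> nuideal_gen (@Calg_rel F) f.
Proof.
have e0 : Cpi 0 = 0 := nualg_morphism0 Cpi_morphism.
rewrite -e0; split=> [/nuquotP|h]; last apply/nuquotP.
  by rewrite subr0 => /nuideal_genbP.
by rewrite subr0; apply/nuideal_genbP.
Qed.

Lemma Calg_lift (x : Calg F) : exists f, x = Cpi f.
Proof. by exists (nuquot_repr x); rewrite /Cpi nuquot_reprK. Qed.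

Lemma Calg_comm (x y : Calg F) : x ** y = y ** x.
Proof.
have [f ->] := Calg_lift x; have [g ->] := Calg_lift y => {x y}.
have CM := nualg_morphismM Cpi_morphism.
have CD := nualg_morphismD Cpi_morphism; have CZ := nualg_morphismZ Cpi_morphism.
elim/free_nualg_ind: f => [i||f1 f2 IH1 IH2|a f IH|f1 f2 IH1 IH2].
- elim/free_nualg_ind: g => [j||f1 f2 IH1 IH2|a f IH|f1 f2 IH1 IH2].
  + rewrite -!CM; apply/nuquotP/nuideal_genbP.
    by move=> I _; apply; apply: Calg_rel_comm.
  + by rewrite (nualg_morphism0 Cpi_morphism) numul0r numulr0.
  + by rewrite CD numulDl numulDr IH1 IH2.
  + by rewrite CZ numulZl numulZr IH.
  + by rewrite CM numulA IH1 -numulA IH2 numulA.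
- by rewrite (nualg_morphism0 Cpi_morphism) numul0r numulr0.
- by rewrite CD numulDl numulDr IH1 IH2.
- by rewrite CZ numulZl numulZr IH.
- by rewrite CM -numulA IH2 numulA IH1 numulA.
Qed.

Definition Cword (w : seq nat) : Calg F := nuprod [seq Cpi (free_var F i) | i <- w].

Lemma Cword_perm v w : perm_eq v w -> Cword v = Cword w.
Proof. by move=> vw; apply: (nuprod_perm Calg_comm); apply: perm_map. Qed.

Lemma Cvar_sq i : Cpi (free_var F i) ** Cpi (free_var F i) = 0.
Proof.
rewrite -(nualg_morphismM Cpi_morphism); apply/Cpi_eq0 => I _; apply.
exact: Calg_rel_sq.
Qed.

Lemma Cword_dup w : ~~ uniq w -> Cword w = 0.
Proof.
move=> nu; have [i iw] : exists i, (1 < count_mem i w)%N.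
  apply: contraPP nu => /forallNP h; apply/negP; rewrite negbK.
  apply: count_mem_uniq => i; have [iw|niw] := boolP (i \in w); last exact/count_memPn.
  apply/eqP; rewrite eqn_leq -has_count has_pred1 iw andbT leqNgt.
  exact/negP.
have iw1 : i \in w by rewrite -has_pred1 has_count; apply: ltnW.
have p1 := perm_to_rem iw1.
have iw2 : i \in rem i w.
  by rewrite -has_pred1 has_count; move/permP/(_ (pred1 i)): p1 iw => /= ->; rewrite eqxx.
have p2 := perm_to_rem iw2.
have : perm_eq w [:: i, i & rem i (rem i w)].
  by apply: perm_trans p1 _; rewrite perm_cons.
move/Cword_perm => ->; case: (rem i (rem i w)) => [|j s].
  by rewrite /Cword /= Cvar_sq.
rewrite /Cword map_cons nuprod_cons // map_cons nuprod_cons // numulA.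
by rewrite Cvar_sq numul0r.
Qed.
End Commutative.

(** Setting the right variables to 0 kills the diagonal entry [ab_r] of a triangular matrix and
    leaves an element of A, or of its opposite, over the polynomials. Squarefree coefficients are
    unaffected ([kill_r_coef]). *)
HB.lock Definition kill_r (F : fieldType) :
    {malg F[{cmonom (nat + nat)%type}]} -> {malg F[{cmonom (nat + nat)%type}]} :=
  poly_eval (fun z => if z is inl i then pvar F (inl i) else 0).

Section CKernel.
Variable F : fieldType.
Notation P := {malg F[{cmonom (nat + nat)%type}]}.
Notation FX := (free_nualg F).
Implicit Types (f g : FX).

(** Words with the same commutative monomial agree in C, so the choice of w is harmless; the default
    0 is taken at monomials with a right variable. *)
Definition Cmonom (m : {cmonom (nat + nat)%type}) : Calg F :=
  if pselect (exists w, cword w = m) is left e then Cword F (projT1 (cid e)) else 0.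

Lemma Cmonom_word w : Cmonom (cword w) = Cword F w.
Proof.
rewrite /Cmonom; case: pselect => [e|[]]; last by exists w.
by case: (cid e) => v /= /cword_perm; apply: Cword_perm.
Qed.

Lemma Cmonom_nosqf m : ~ squarefree m -> Cmonom m = 0.
Proof.
rewrite /Cmonom; case: pselect => // e nsq; case: (cid e) => v /= vm.
apply: Cword_dup; apply/negP => uv; apply: nsq => i.
by rewrite -vm cword_l cword_r count_uniq_mem //; case: (_ \in _).
Qed.

Lemma Cword_pi w : w != [::] ->
  Cword F w = Cpi (nuprod [seq free_var F i | i <- w]).
Proof.
move=> w0; rewrite -(nuprod_map (nualg_morphismM (Cpi_morphism F))); last by case: (w) w0.
by rewrite -map_comp.
Qed.

(** The map to C factors through commutative polynomials, so vanishing in C is read off from the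
    coefficients of [ab_l f]. *)
Lemma Cpi_ab f : Cpi f = malg_lin Cmonom (ab_l f).
Proof.
rewrite -[f in LHS]free_eval_id -[f in RHS]free_eval_id /free_eval.
have CD := nualg_morphismD (Cpi_morphism F).
rewrite (big_morph _ CD (nualg_morphism0 (Cpi_morphism F))).
have abD : {morph @ab_l F : x y / x + y} by move=> x y; apply: ab_lD.
have ab0 : ab_l (0 : FX) = 0 by rewrite -(scale0r (0 : FX)) ab_lZ scale0r.
rewrite (big_morph _ abD ab0) raddf_sum /=; apply: eq_big_seq => w /msupp_free w0.
rewrite (nualg_morphismZ (Cpi_morphism F)) ab_lZ linearZ /=; congr (_ *: _).
by rewrite ab_l_word // malg_linU Cmonom_word Cword_pi.
Qed.

Lemma nosqf_Cpi f : nosqf (ab_l f) -> Cpi f = 0.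
Proof.
move=> nq; rewrite Cpi_ab /malg_lin big1_fset // => m _ _.
have [sq|nsq] := pselect (squarefree m); first by rewrite nq // scale0r.
by rewrite Cmonom_nosqf // scaler0.
Qed.

Lemma Cpi_nosqf f : Cpi f = 0 -> nosqf (ab_l f).
Proof. by move/Cpi_eq0/Calg_rel_nosqf. Qed.

Lemma Cword_neq0 w : w != [::] -> uniq w -> Cword F w <> 0.
Proof.
move=> w0 uw; rewrite Cword_pi //; move/Cpi_nosqf => /(_ (cword w)); rewrite ab_l_word // mcoeffUU.
move=> h; have := oner_neq0 F; rewrite h ?eqxx // => i.
by rewrite cword_l cword_r count_uniq_mem //; case: (_ \in _).
Qed.

Lemma pvar_monom (m : {cmonom (nat + nat)%type}) : cm_eval (pvar F) m = << m >>.
Proof.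
pose h (m : {cmonom (nat + nat)%type}) : P := << m >>.
have hM : {morph h : x y / mmul x y >-> x * y} by move=> x y; rewrite /h malg_UM.
have hX i n : h (ucm i) ^+ n = h (\big[mmul/mone]_(k < n) ucm i).
  by rewrite (big_morph h hM (erefl _)) prodr_const card_ord.
have cb (J : Type) (s : seq J) (c : J -> {cmonom (nat + nat)%type}) j :
    (\big[mmul/mone]_(i <- s) c i) j = (\sum_(i <- s) c i j)%N.
  by elim/big_rec2: _ => [|i x y _ <-]; rewrite ?cm1 // cmM.
rewrite /cm_eval -/(h m).
under eq_bigr do rewrite hX.
rewrite -(big_morph h hM (erefl _)); congr h; apply/eqP/cmP => j; rewrite cb.
transitivity (\sum_(i <- finsupp m) ((i == j) * m i))%N.
  by apply: eq_bigr => i _; rewrite cb; under eq_bigr do rewrite cmU;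
    rewrite sum_nat_const card_ord mulnC.
have [jm|njm] := boolP (j \in finsupp m).
  rewrite (big_fsetD1 j) //= eqxx mul1n big_seq big1 ?addn0 // => i.
  by rewrite !inE => /andP[/negPf->].
rewrite big_seq big1 => [|i im]; first by apply/esym/eqP; rewrite cmE_eq0.
by case: eqP njm => // <-; rewrite im.
Qed.

Lemma kill_r_coef (p : P) m : squarefree m -> (kill_r p)@_m = p@_m.
Proof.
move=> sqm; rewrite kill_r.unlock poly_evalE raddf_sum /=.
have ev n : (cm_eval (fun z => if z is inl i then pvar F (inl i) else 0) n : P)@_m =
    (n == m)%:R.
  have [[i ni]|/forallNP h] := pselect (exists i, n (inr i) <> 0%N).
    rewrite /cm_eval (big_fsetD1 (inr i)) /=; last by rewrite -cmE_neq0; apply/eqP.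
    rewrite expr0n (_ : (n (inr i) == 0%N) = false) ?mul0r ?mcoeff0; last exact/eqP.
    by case: eqP => // e; have [_] := sqm i; rewrite -e.
  have -> : cm_eval (fun z => if z is inl i then pvar F (inl i) else 0) n = cm_eval (pvar F) n.
    apply: eq_big_seq => -[i _|i]; first by [].
    by rewrite -cmE_neq0 => /eqP /h [].
  by rewrite (pvar_monom n) (mcoeffU n 1 m).
transitivity (\sum_(n <- msupp p) p@_n * (n == m)%:R).
  by apply: eq_bigr => n _; rewrite (mcoeffZ p@_n _ m) ev.
have [mp|nmp] := boolP (m \in msupp p).
  rewrite (big_fsetD1 m mp) /= eqxx mulr1 big_seq big1 ?addr0 // => n.
  by rewrite !inE => /andP[/negPf->]; rewrite mulr0.
rewrite big_seq big1 => [|n np]; first by rewrite (mcoeff_outdom nmp).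
by case: eqP nmp => [<-|]; rewrite ?np ?mulr0.
Qed.
End CKernel.

(** * From triangular matrices to the identities of A(C) and its opposite *)

HB.lock Definition ab_r (F : fieldType) (f : free_nualg F) :
    {malg F[{cmonom (nat + nat)%type}]} :=
  free_eval (fun i => pvar F (inr i) : forget_unit {malg F[{cmonom (nat + nat)%type}]}) f.

Section TestC.
Variables (F : fieldType) (A : nualgType F) (E : comAlgType F).
Notation P := {malg F[{cmonom (nat + nat)%type}]}.
Notation FX := (free_nualg F).

Lemma ab_rM (f g : FX) : ab_r (f ** g) = ab_r f * ab_r g.
Proof. by rewrite ab_r.unlock free_evalM. Qed.

Lemma ab_rD (f g : FX) : ab_r (f + g) = ab_r f + ab_r g.
Proof. by rewrite ab_r.unlock linearD. Qed.

Lemma ab_rZ c (f : FX) : ab_r (c *: f) = c *: ab_r f.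
Proof. by rewrite ab_r.unlock linearZ. Qed.

Lemma ab_r_var i : ab_r (free_var F i) = pvar F (inr i).
Proof. by rewrite ab_r.unlock free_eval_var. Qed.

Lemma ab_r0 : ab_r (0 : FX) = 0.
Proof. by rewrite -(scale0r (0 : FX)) ab_rZ scale0r. Qed.

Lemma ab_l0 : ab_l (0 : FX) = 0.
Proof. by rewrite -(scale0r (0 : FX)) ab_lZ scale0r. Qed.

Lemma poly_eval_pvar (B : comAlgType F) (u : _ -> B) z : poly_eval u (pvar F z) = u z.
Proof. exact: poly_evalX. Qed.

Lemma poly_eval_ab_l (h h' : A -> E) : alg_map h -> forall a f,
  poly_eval (two_sided h h' a) (ab_l f) = h (free_eval a f).
Proof.
move=> hm a; elim/free_nualg_ind => [i||f g IHf IHg|c f IH|f g IHf IHg].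
- by rewrite ab_l_var poly_eval_pvar free_eval_var.
- by rewrite ab_l0 rmorph0 linear0 (alg_map0 hm).
- by rewrite ab_lD rmorphD linearD /= (alg_mapD hm) IHf IHg.
- by rewrite ab_lZ poly_evalZ linearZ /= (alg_mapZ hm) IH.
- by rewrite ab_lM rmorphM free_evalM hm.2 /= IHf IHg.
Qed.

Lemma poly_eval_ab_r (h h' : A -> E) : alg_map h' -> forall a f,
  poly_eval (two_sided h h' a) (ab_r f) = h' (free_eval a f).
Proof.
move=> hm a; elim/free_nualg_ind => [i||f g IHf IHg|c f IH|f g IHf IHg].
- by rewrite ab_r_var poly_eval_pvar free_eval_var.
- by rewrite ab_r0 rmorph0 linear0 (alg_map0 hm).
- by rewrite ab_rD rmorphD linearD /= (alg_mapD hm) IHf IHg.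
- by rewrite ab_rZ poly_evalZ linearZ /= (alg_mapZ hm) IH.
- by rewrite ab_rM rmorphM free_evalM hm.2 /= IHf IHg.
Qed.

Lemma kill_r_ab_l (f : FX) : kill_r (ab_l f) = ab_l f.
Proof.
rewrite kill_r.unlock; elim/free_nualg_ind: f => [i||f g IHf IHg|c f IH|f g IHf IHg].
- by rewrite ab_l_var poly_eval_pvar.
- by rewrite ab_l0 rmorph0.
- by rewrite ab_lD rmorphD /= IHf IHg.
- by rewrite ab_lZ poly_evalZ IH.
- by rewrite ab_lM rmorphM /= IHf IHg.
Qed.

Lemma kill_r_ab_r (f : FX) : kill_r (ab_r f) = 0.
Proof.
rewrite kill_r.unlock; elim/free_nualg_ind: f => [i||f g IHf IHg|c f IH|f g IHf IHg].
- by rewrite ab_r_var poly_eval_pvar.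
- by rewrite ab_r0 rmorph0.
- by rewrite ab_rD rmorphD /= IHf IHg addr0.
- by rewrite ab_rZ poly_evalZ IH scaler0.
- by rewrite ab_rM rmorphM /= IHf IHg mul0r.
Qed.

Lemma kill_rD (p q : P) : kill_r (p + q) = kill_r p + kill_r q :> P.
Proof. by rewrite kill_r.unlock rmorphD. Qed.

Lemma kill_rM (p q : P) : kill_r (p * q) = kill_r p * kill_r q :> P.
Proof. by rewrite kill_r.unlock rmorphM. Qed.

Lemma kill_rZ c (p : P) : kill_r (c *: p) = c *: kill_r p :> P.
Proof. by rewrite kill_r.unlock poly_evalZ. Qed.

Definition Tri_map (B B' : comAlgType F) (h : B -> B') (t : Trialg B) : Trialg B' :=
  (h t.1.1, h t.1.2, h t.2).

Lemma Tri_map_morphism (B B' : comAlgType F) (h : B -> B') :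
  linear h -> {morph h : x y / x * y} -> nualg_morphism (Tri_map h).
Proof.
move=> hl hM.
have hD : {morph h : x y / x + y} by move=> x y; rewrite -[x]scale1r hl !scale1r.
split=> [c [[x v] y] [[x' v'] y']|[[x v] y] [[x' v'] y']]; rewrite /Tri_map /=.
  by rewrite !hl.
by rewrite hD !hM.
Qed.

(** Once [kl] kills the lower diagonal entry, the term w y' of the product disappears and the upper
    row multiplies as in [Aalg]. *)
Lemma Tri_Aalg_rel (B : comAlgType F) (al ar : FX -> B) (kl : B -> B)
    (s : nat -> Aalg FX) f :
  alg_map al -> linear kl -> {morph kl : x y / x * y} ->
  (forall g, kl (al g) = al g) -> (forall g, kl (ar g) = 0) ->
  let t := free_eval (fun k => (al (s k).1, al (s k).2, ar (s k).1) : Trialg B) f in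
  let g := free_eval s f in
  [/\ t.1.1 = al g.1, kl t.1.2 = al g.2 & kl t.2 = 0].
Proof.
move=> am kl_lin klM kal kar.
have klD : {morph kl : x y / x + y} by move=> x y; rewrite -[x]scale1r kl_lin !scale1r.
have kl0 : kl 0 = 0 by apply: (addrI (kl 0)); rewrite -klD !addr0.
have klZ c x : kl (c *: x) = c *: kl x by rewrite -[c *: x]addr0 kl_lin kl0 addr0.
apply: (@free_eval_rel F (Aalg FX) (Trialg B) (fun s p => [/\ p.1.1 = al s.1,
   kl p.1.2 = al s.2 & kl p.2 = 0])).
- by move=> i; split; rewrite ?kal ?kar.
- by split; rewrite ?(alg_map0 am) ?kl0.
- move=> [u v] [u' v'] [[x w] y] [[x' w'] y'] /= [-> e2 e3] [-> e5 e6].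
  by rewrite !(alg_mapD am) !klD e2 e3 e5 e6 addr0.
- move=> c [u v] [[x w] y] /= [-> e2 e3].
  by rewrite !(alg_mapZ am) !klZ e2 e3 scaler0.
- move=> [u v] [u' v'] [[x w] y] [[x' w'] y'] /= [-> e2 e3] [-> e5 e6].
  by rewrite !am.2 !(klD, klM) e3 e6 e5 !mulr0 addr0 kal.
Qed.

(** Now the upper diagonal entry is killed and w y' remains; commutativity of B puts the factors in
    the order of the opposite algebra. *)
Lemma Tri_opp_rel (B : comAlgType F) (al ar : FX -> B) (kl : B -> B)
    (s : nat -> opposite (Aalg FX)) f :
  alg_map al -> linear kl -> {morph kl : x y / x * y} ->
  (forall g, kl (al g) = al g) -> (forall g, kl (ar g) = 0) ->
  let t := free_eval (fun k => (ar (s k).1, al (s k).2, al (s k).1) : Trialg B) f in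
  let g := free_eval s f in
  [/\ t.2 = al g.1, kl t.1.2 = al g.2 & kl t.1.1 = 0].
Proof.
move=> am kl_lin klM kal kar.
have klD : {morph kl : x y / x + y} by move=> x y; rewrite -[x]scale1r kl_lin !scale1r.
have kl0 : kl 0 = 0 by apply: (addrI (kl 0)); rewrite -klD !addr0.
have klZ c x : kl (c *: x) = c *: kl x by rewrite -[c *: x]addr0 kl_lin kl0 addr0.
apply: (@free_eval_rel F (opposite (Aalg FX)) (Trialg B) (fun s p => [/\ p.2 = al s.1,
   kl p.1.2 = al s.2 & kl p.1.1 = 0])).
- by move=> i; split; rewrite ?kal ?kar.
- by split; rewrite ?(alg_map0 am) ?kl0.
- move=> [u v] [u' v'] [[x w] y] [[x' w'] y'] /= [-> e2 e3] [-> e5 e6].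
  by rewrite !(alg_mapD am) !klD e2 e3 e5 e6 addr0.
- move=> c [u v] [[x w] y] /= [-> e2 e3].
  by rewrite !(alg_mapZ am) !klZ e2 e3 scaler0.
- move=> [u v] [u' v'] [[x w] y] [[x' w'] y'] /= [-> e2 e3] [-> e5 e6].
  rewrite !am.2 !(klD, klM) e3 e2 e6 kal !mul0r add0r.
  by split; rewrite // mulrC.
Qed.

Definition Ppoly : comAlgType F := P.

Lemma ab_l_alg_map : alg_map (@ab_l F : FX -> Ppoly).
Proof.
split=> [c f g|f g]; last exact: ab_lM.
by rewrite ab_lD ab_lZ.
Qed.

Lemma kill_r_linear : linear (@kill_r F : Ppoly -> Ppoly).
Proof.
move=> c p q; transitivity (kill_r (c *: p : P) + kill_r (q : P) : P).
  exact: kill_rD.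
by congr (_ + _); exact: kill_rZ.
Qed.

Lemma poly_eval_linear (u : _ -> E) : linear (poly_eval u : Ppoly -> E).
Proof.
move=> c p q; transitivity (poly_eval u (c *: p : P) + poly_eval u (q : P)).
  exact: rmorphD.
by congr (_ + _); exact: poly_evalZ.
Qed.

Lemma poly_evalM (u : _ -> E) (p q : P) : poly_eval u (p * q) = poly_eval u p * poly_eval u q.
Proof. by rewrite rmorphM. Qed.

Lemma Aalg_Cpi_morphism :
  nualg_morphism (fun s : Aalg FX => (Cpi s.1, Cpi s.2) : Aalg (Calg F)).
Proof.
have [Cl CM] := Cpi_morphism F.
split=> [c [u v] [u' v']|[u v] [u' v']] /=; congr pair => /=.
- exact: Cl.
- exact: Cl.
- exact: CM.
- exact: CM.
Qed.

Variables (l r : A -> E) (nat_fam : forall I : Type, ((I -> A) -> E) -> Prop).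
Hypotheses (lm : alg_map l) (rm : alg_map r) (nf : natural_family l r nat_fam).
Variable (T : FX -> Prop).
Hypothesis (star : forall f, T f -> forall (a : nat -> A) (e : nat -> E),
  free_eval (fun k => (l (a k), e k, r (a k)) : Trialg E) f = 0).

(** f is evaluated at generic triangular matrices over commutative polynomials. Every specialization
    to values of l and r is zero by [star], so by [squarefree_coef] no squarefree monomial occurs in
    the first row, which therefore vanishes in C. *)
Lemma satisfies_Aalg_C : ~ degenerate l r -> forall f, T f -> satisfies (Aalg (Calg F)) f.
Proof.
move=> ndeg f Tf rho.
pose s k : Aalg FX := (nuquot_repr (rho k).1, nuquot_repr (rho k).2).
have -> : rho = (fun t : Aalg FX => (Cpi t.1, Cpi t.2) : Aalg (Calg F)) \o s.
  by apply/funext => k /=; rewrite /Cpi !nuquot_reprK; case: (rho k).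
rewrite -(nualg_morphism_free_eval _ _ Aalg_Cpi_morphism).
have [] := Tri_Aalg_rel s f ab_l_alg_map kill_r_linear kill_rM kill_r_ab_l kill_r_ab_r.
set t : nat -> Trialg Ppoly := fun k => _; move: (free_eval s f) => [g1 g2] /=.
have p0 a : Tri_map (poly_eval (two_sided l r a)) (free_eval t f) = 0.
  rewrite (nualg_morphism_free_eval _ _
    (Tri_map_morphism (poly_eval_linear (two_sided l r a)) (poly_evalM _))).
  rewrite -[RHS](star Tf (fun k => free_eval a (s k).1)
    (fun k => poly_eval (two_sided l r a) (ab_l (s k).2))).
  congr free_eval; apply/funext => k; rewrite /Tri_map /t; cbn [fst snd comp].
  by rewrite !(poly_eval_ab_l _ lm) (poly_eval_ab_r _ rm).
move: (free_eval t f) p0 => [[x w] y] p0 e1 e2 e3.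
suff [-> ->] : Cpi g1 = 0 /\ Cpi g2 = 0 by [].
split; apply: nosqf_Cpi.
  rewrite -e1; apply: (squarefree_coef lm rm nf ndeg) => a.
  by case: (p0 a).
move=> m sqm; rewrite -e2 kill_r_coef //.
by apply: (squarefree_coef lm rm nf ndeg) => // a; case: (p0 a).
Qed.

Lemma opposite_morphism (B D : nualgType F) (h : B -> D) : nualg_morphism h ->
  nualg_morphism (h : opposite B -> opposite D).
Proof. by move=> [hl hM]; split=> // x y; exact: hM. Qed.

Lemma natural_swap : natural_family r l nat_fam.
Proof. by case: nf. Qed.

Lemma satisfies_opposite_Aalg_C : ~ degenerate r l ->
  forall f, T f -> satisfies (opposite (Aalg (Calg F))) f.
Proof.
move=> ndeg f Tf rho.
pose s k : opposite (Aalg FX) := (nuquot_repr (rho k).1, nuquot_repr (rho k).2).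
pose pi (t : opposite (Aalg FX)) : opposite (Aalg (Calg F)) := (Cpi t.1, Cpi t.2).
have -> : rho = pi \o s.
  by apply/funext => k; rewrite /= /pi /Cpi !nuquot_reprK; case: (rho k).
rewrite -(nualg_morphism_free_eval _ _ (opposite_morphism Aalg_Cpi_morphism)).
have [] := Tri_opp_rel s f ab_l_alg_map kill_r_linear kill_rM kill_r_ab_l kill_r_ab_r.
set t : nat -> Trialg Ppoly := fun k => _; move: (free_eval s f) => [g1 g2] /=.
have p0 a : Tri_map (poly_eval (two_sided r l a)) (free_eval t f) = 0.
  rewrite (nualg_morphism_free_eval _ _
    (Tri_map_morphism (poly_eval_linear (two_sided r l a)) (poly_evalM _))).
  rewrite -[RHS](star Tf (fun k => free_eval a (s k).1 : A)
    (fun k => poly_eval (two_sided r l a) (ab_l (s k).2))).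
  congr free_eval; apply/funext => k; rewrite /Tri_map /t; cbn [fst snd comp].
  by rewrite !(poly_eval_ab_l _ rm) (poly_eval_ab_r _ lm).
move: (free_eval t f) p0 => [[x w] y] p0 e1 e2 e3.
suff [-> ->] : Cpi g1 = 0 /\ Cpi g2 = 0 by [].
split; apply: nosqf_Cpi.
  rewrite -e1; apply: (squarefree_coef rm lm natural_swap ndeg) => a.
  by case: (p0 a).
move=> m sqm; rewrite -e2 kill_r_coef //.
by apply: (squarefree_coef rm lm natural_swap ndeg) => // a; case: (p0 a).
Qed.
End TestC.

(** * Reduction to the algebraic case *)

Section Algebraic.
Variables (F : fieldType) (A : nualgType F) (E : comAlgType F).
Variable (nat_fam : forall I : Type, ((I -> A) -> E) -> Prop).
Implicit Types (l r : A -> E).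

(** The constant term is excluded because A need not have a unit. *)
Lemma alg_map_poly l r : alg_map l -> alg_map r -> forall (a : A) (g : {poly F}),
  g`_0 = 0 -> exists b, l b = horner_alg (l a) g /\ r b = horner_alg (r a) g.
Proof.
move=> lm rm a g g0.
have {g g0}[h ->] : exists h, g = 'X * h.
  exists (g %/ 'X); rewrite mulrC divpK //.
  by rewrite -(subr0 'X) dvdp_XsubCl /root horner_coef0 g0.
elim/poly_ind: h => [|h c [b [lb rb]]].
  by exists 0; rewrite mulr0 !rmorph0 (alg_map0 lm) (alg_map0 rm).
exists (b ** a + c *: a).
rewrite (alg_mapD lm) (alg_mapD rm) (alg_mapZ lm) (alg_mapZ rm) lm.2 rm.2 lb rb.
by rewrite mulrDr mulrA !rmorphD !rmorphM /= !horner_algX !horner_algC !mulr_algr.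
Qed.

Lemma alg_map_subX l r : alg_map l -> alg_map r -> forall (a : A) n, (0 < n)%N ->
  exists b, l b = l a - l a ^+ n /\ r b = r a - r a ^+ n.
Proof.
move=> lm rm a n n0; have [|b [lb rb]] := alg_map_poly lm rm a (g := 'X - 'X^n).
  by rewrite coefB coefX coefXn (ltn_eqF n0) subrr.
by exists b; rewrite lb rb !rmorphB !rmorphXn /= !horner_algX.
Qed.

Lemma absorb_exp (x z : E) k : x = x * z -> x = x * z ^+ k.
Proof. by move=> e; elim: k => [|k IH]; rewrite ?mulr1 // exprSr mulrA -IH -e. Qed.

(** For b = a - a^e one has l b = 0, and as d > 0 the formula for r then gives r b = 0. *)
Lemma exp_transfer l r c d e : alg_map l -> alg_map r -> (0 < d)%N -> (0 < e)%N ->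
  (forall a, r a = r a ^+ c * l a ^+ d) -> (forall a, l a = l a ^+ e) ->
  forall a, r a = r a ^+ e.
Proof.
move=> lm rm d0 e0 hr hl a; have [b [lb rb]] := alg_map_subX lm rm a e0.
apply/eqP; rewrite -subr_eq0 -rb hr lb -hl subrr expr0n.
by rewrite (gtn_eqF d0) mulr0.
Qed.

(** The exponents (0, 0) are refuted at a = 0, and (0, 1) would mean l = r. *)
Lemma degenerate_exps l r : alg_map l -> alg_map r -> (exists a, l a <> r a) ->
  degenerate l r -> (forall a, l a = 0) \/
  exists c d, [/\ (1 < c + d)%N, (c, d) != (0, 0)%N & forall a, l a = l a ^+ c * r a ^+ d].
Proof.
move=> lm rm [a0 ne] [z|[[c d] /= cd h]]; [by left|right; exists c, d].
have nz : (c, d) != (0, 0)%N.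
  apply/negP => /eqP[ec ed]; have := h 0.
  by rewrite ec ed (alg_map0 lm) !expr0 mulr1 => /esym/eqP; rewrite oner_eq0.
split=> //; case: c d h cd nz => [|[|c]] [|[|d]] // h _ _; try by rewrite ?addnS.
by case: ne; rewrite h expr0 mul1r.
Qed.

(** With x = l a and y = r a, substituting a + a^2 for a yields x + x^2 = x (1 + x)^c (1 + y)^d. In
    the expansion the terms (0, 0) and (c, d) are x and x^2; the rest is a relation among characters
    x^(i+1) y^j in which x y^d, the term (0, d), has coefficient 1. By independence x y^d is 0 or
    equals another of them, and then y can be eliminated. *)
Lemma hard_case l r c d : alg_map l -> alg_map r -> natural_family l r nat_fam ->
  (1 < c)%N -> (0 < d)%N -> (forall a, l a = l a ^+ c * r a ^+ d) ->
  (forall a, l a = 0) \/ exists2 n, (0 < n)%N & forall a, l a = l a ^+ n.+1.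
Proof.
move=> lm rm nf c1 d0 h.
have c0 : (0 < c)%N by apply: ltnW.
pose X (p : nat * nat) (a : unit -> A) : E := l (a tt) ^+ p.1.+1 * r (a tt) ^+ p.2.
have chX p : character nat_fam (X p).
  split.
    apply: (nat_mul nf); first exact: (nat_exp nf _ (nat_l nf tt)).
    exact: (nat_exp nf _ (nat_r nf tt)).
  by move=> a b; rewrite /X /tmul lm.2 rm.2 !exprMn; ring.
pose T := ('I_c.+1 * 'I_d.+1)%type.
pose v (p : T) : nat * nat := (val p.1, val p.2).
pose p0 : T := (ord0, ord_max); pose p1 : T := (ord0, ord0); pose p2 : T := (ord_max, ord_max).
have n10 : p1 != p0.
  by apply/negP => /eqP[e]; move: d0; rewrite -[d]/(val (@ord_max d)) -e.
have n20 : p2 != p0.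
  by apply/negP => /eqP[e]; move: c0; rewrite -[c]/(val (@ord_max c)) e.
have n21 : p2 != p1.
  by apply/negP => /eqP[e]; move: c0; rewrite -[c]/(val (@ord_max c)) e.
pose s := [seq p <- index_enum T | [&& p != p0, p != p1 & p != p2]].
pose co (p : T) : F := ('C(c, p.1) * 'C(d, p.2))%:R.
have rel a : X (0, d)%N a + \sum_(p <- s) co p *: X (v p) a = 0.
  have [|b [lb rb]] := alg_map_poly lm rm (a tt) (g := 'X + 'X^2).
    by rewrite coefD coefX coefXn addr0.
  have {}lb : l b = l (a tt) * (1 + l (a tt)).
    by rewrite lb rmorphD rmorphXn /= horner_algX; ring.
  have {}rb : r b = r (a tt) * (1 + r (a tt)).
    by rewrite rb rmorphD rmorphXn /= horner_algX; ring.
  have e1 : l (a tt) + l (a tt) ^+ 2 =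
      l (a tt) * (1 + l (a tt)) ^+ c * (1 + r (a tt)) ^+ d.
    transitivity (l b); first by rewrite lb; ring.
    by rewrite h lb rb !exprMn mulrACA -h mulrA.
  have e2 : l (a tt) * (1 + l (a tt)) ^+ c * (1 + r (a tt)) ^+ d =
      \sum_(p : T) co p *: X (v p) a.
    rewrite -(pair_bigA _ (fun i j => co (i, j) *: X (v (i, j)) a)) /=.
    rewrite [(1 + l _) ^+ c]exprDn [(1 + r _) ^+ d]exprDn -mulrA big_distrlr /= mulr_sumr.
    apply: eq_bigr => i _.
    rewrite mulr_sumr; apply: eq_bigr => j _.
    rewrite !expr1n !mul1r /co /X /v /= scaler_nat exprS.
    by rewrite mulrnAl !mulrnAr -mulrnA mulnC mulrA.
  move: e1; rewrite e2 (bigD1 p0) //= (bigD1 p1) //= (bigD1 p2) /=; last by rewrite n20.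
  rewrite /s big_filter; under eq_bigl do rewrite -andbA.
  have -> : co p0 *: X (v p0) a = X (0, d)%N a by rewrite /co /= bin0 binn scale1r.
  have -> : co p1 *: X (v p1) a = l (a tt).
    by rewrite /co /X /= !bin0 scale1r expr0 mulr1 expr1.
  have -> : co p2 *: X (v p2) a = l (a tt) ^+ 2.
    by rewrite /co /X /= !binn scale1r exprS -mulrA -h expr2.
  by move=> e3; apply: (addrI (l (a tt) + l (a tt) ^+ 2)); rewrite addr0 {2}e3; ring.
have [] := @character_indep F A E l r nat_fam nf unit unit (size s) (fun=> 1)
  (X (0, d)%N) (fun i _ => co (nth p0 s i) *: 1) (fun i => X (v (nth p0 s i))).
- exact: (nat_one nf).
- exact: chX.
- by move=> i; apply: (nat_scale nf); apply: (nat_one nf).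
- by move=> i; apply: chX.
- move=> a _; rewrite mul1r -[RHS](rel a) (big_nth p0) big_mkord; congr (_ + _).
  by apply: eq_bigr => i _; rewrite mulr_algl.
- by move=> /(_ (fun=> 0)) /eqP; rewrite oner_eq0.
case=> [z|[k ks e]]; [left|right] => [a|].
  have := z (fun=> a); rewrite /X /= expr1 => {}z.
  by rewrite h -(prednK c0) exprSr -mulrA z mulr0.
have : nth p0 s k \in s by apply: mem_nth.
rewrite mem_filter => /andP[/and3P[np0 np1 np2] _].
move: (nth p0 s k) np0 np1 np2 e => [i j] np0 np1 np2 e.
have {}e a : l a ^+ i.+1 * r a ^+ j = l a * r a ^+ d.
  by have := e (fun=> a); rewrite /X /= expr1.
have jd : (j <= d)%N by rewrite -ltnS.
(* Both x = x (x^(c-1) y^d)^j and x = x (x^(c-1+i) y^j)^d contain y^(j d); n is the difference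
   (c-1+i) d - (c-1) j of the exponents of x. *)
pose n := (c.-1 * (d - j) + i * d)%N.
have n0 : (0 < n)%N.
  rewrite /n addn_gt0 !muln_gt0 -ltnS prednK // c1 d0 andbT subn_gt0 /=.
  case: ltngtP jd => //= jd _; rewrite lt0n; apply: contraNneq np0 => i0.
  by rewrite xpair_eqE -!val_eqE /= i0 jd !eqxx.
exists n => // a; set x := l a; set y := r a.
have e1 : x = x * (x ^+ c.-1 * y ^+ d) by rewrite mulrA -exprS prednK // -h.
have e2 : x = x * (x ^+ (c.-1 + i) * y ^+ j).
  by rewrite {1}e1 mulrCA -e -/x -/y exprD exprS; ring.
have e1' := absorb_exp j e1; have e2' := absorb_exp d e2.
rewrite exprS; transitivity (x * (x ^+ c.-1 * y ^+ d) ^+ j * x ^+ n); last by rewrite -e1'.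
rewrite {1}e2' !exprMn -!exprM (_ : (c.-1 + i) * d = c.-1 * j + n)%N; last by rewrite /n; nia.
by rewrite exprD [(j * d)%N]mulnC; ring.
Qed.

(** Cases on the exponents in l = l^c r^d and r = r^c' l^d'. If d = 0 or d' = 0, one map is already
    algebraic and [exp_transfer] carries this over; c = 0 or c' = 0 allows a substitution, c = 1 or
    c' = 1 the absorption of a power, and c, c' > 1 is [hard_case]. *)
Lemma algebraic_or l r : alg_map l -> alg_map r -> natural_family l r nat_fam ->
  (exists a, l a <> r a) -> degenerate l r -> degenerate r l ->
  exists2 e, (1 < e)%N & forall a, l a = l a ^+ e /\ r a = r a ^+ e.
Proof.
move=> lm rm nf ne deg1 deg2.
have ne' : exists a, r a <> l a by case: ne => a h; exists a => /esym.
have nf' := natural_swap nf.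
have bothz : (forall a, l a = 0) -> (forall a, r a = 0) -> False.
  by case: ne => a h z1 z2; apply: h; rewrite z1 z2.
have join e1 e2 : (1 < e1)%N -> (1 < e2)%N -> (forall a, l a = l a ^+ e1) ->
    (forall a, r a = r a ^+ e2) ->
    exists2 e, (1 < e)%N & forall a, l a = l a ^+ e /\ r a = r a ^+ e.
  (* x = x^e gives x = x^(1 + (e - 1) k) for all k, so 1 + (e1 - 1)(e2 - 1) serves both. *)
  move=> e1_1 e2_1 h1 h2; exists ((e1.-1 * e2.-1).+1); first by rewrite ltnS muln_gt0; lia.
  have gen (x : E) n k : (0 < n)%N -> x = x ^+ n -> x = x ^+ (n.-1 * k).+1.
    move=> n0 h; rewrite exprS exprM; apply: absorb_exp.
    by rewrite -exprS prednK.
  by move=> a; split; [|rewrite mulnC]; apply: gen => //; apply: ltnW.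
have one_sided (f g : A -> E) c d : alg_map f -> alg_map g ->
    (forall a, f a = 0) -> ~ (forall a, g a = 0) -> (1 < c + d)%N ->
    (forall a, g a = g a ^+ c * f a ^+ d) -> (1 < c)%N /\ forall a, g a = g a ^+ c.
  move=> lm' rm' z nz; case: d => [|d] cd h; last first.
    by case: nz => a; rewrite h z expr0n mulr0.
  by split=> [|a]; [rewrite addn0 in cd|rewrite {1}h expr0 mulr1].
have [lz|[c [d [cd _ hl]]]] := degenerate_exps lm rm ne deg1;
have [rz|[c' [d' [cd' _ hr]]]] := degenerate_exps rm lm ne' deg2.
- by case: bothz.
- have [//|c1 h] := one_sided l r _ _ lm rm lz _ cd' hr.
    by move=> rz; case: bothz.
  exists c' => // a; split; last exact: h.
  by rewrite lz expr0n gtn_eqF // ltnW.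
- have [//|c1 h] := one_sided r l _ _ rm lm rz _ cd hl.
    by move=> lz; case: bothz.
  exists c => // a; split; first exact: h.
  by rewrite rz expr0n gtn_eqF // ltnW.
case: d => [|d] in cd hl *.
  have c1 : (1 < c)%N by rewrite addn0 in cd.
  have hl' a : l a = l a ^+ c by rewrite {1}hl expr0 mulr1.
  case: d' => [|d'] in cd' hr *.
    apply: (join c c') => // [|a]; first by rewrite addn0 in cd'.
    by rewrite {1}hr expr0 mulr1.
  apply: (join c c) => //; apply: (exp_transfer lm rm _ _ hr hl') => //; exact: ltnW.
case: d' => [|d'] in cd' hr *.
  have c1 : (1 < c')%N by rewrite addn0 in cd'.
  have hr' a : r a = r a ^+ c' by rewrite {1}hr expr0 mulr1.
  apply: (join c' c') => //; apply: (exp_transfer rm lm _ _ hl hr') => //; exact: ltnW.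
have from_l e : (1 < e)%N -> (forall a, l a = l a ^+ e) ->
    exists2 e, (1 < e)%N & forall a, l a = l a ^+ e /\ r a = r a ^+ e.
  move=> e1 h; apply: (join e e) => //.
  apply: (exp_transfer lm rm _ _ hr h) => //; exact: ltnW.
have from_r e : (1 < e)%N -> (forall a, r a = r a ^+ e) ->
    exists2 e, (1 < e)%N & forall a, l a = l a ^+ e /\ r a = r a ^+ e.
  move=> e1 h; apply: (join e e) => //.
  apply: (exp_transfer rm lm _ _ hl h) => //; exact: ltnW.
have c_zero (f g : A -> E) k j' k' : (1 < k)%N -> (0 < k')%N ->
   (forall a, f a = f a ^+ 0 * g a ^+ k) -> (forall a, g a = g a ^+ j' * f a ^+ k') ->
   exists2 e, (1 < e)%N & forall a, g a = g a ^+ e.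
  move=> d1 d0 h h'; exists (j' + k * k')%N; first by case: k' d0 h' => // n _ _; nia.
  by move=> a; rewrite {1}h' h expr0 mul1r -exprM -exprD.
have c_one (f g : A -> E) k j' k' : (0 < k)%N -> (0 < j')%N -> (0 < k')%N ->
   (forall a, f a = f a ^+ 1 * g a ^+ k) -> (forall a, g a = g a ^+ j' * f a ^+ k') ->
   exists2 e, (1 < e)%N & forall a, g a = g a ^+ e.
  move=> d0 c0 d0' h h'; exists k.+1 => // a.
  rewrite exprS {2}h' -mulrA [X in _ = _ * X](_ : _ = f a ^+ k') -?h' //.
  have e : f a = f a * g a ^+ k by rewrite {1}h expr1.
  by rewrite -(prednK d0') exprSr -mulrA -e.
case: c => [|[|c]] in cd hl *.
- by have [e e1 h] := c_zero l r d.+1 _ d'.+1 cd isT hl hr; apply: (from_r e).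
- case: c' => [|c'] in cd' hr *.
    by have [e e1 h] := c_zero r l d'.+1 _ d.+1 cd' isT hr hl; apply: (from_l e).
  by have [e e1 h] := c_one l r d.+1 c'.+1 d'.+1 isT isT isT hl hr; apply: (from_r e).
case: c' => [|[|c']] in cd' hr *.
- by have [e e1 h] := c_zero r l d'.+1 _ d.+1 cd' isT hr hl; apply: (from_l e).
- by have [e e1 h] := c_one r l d'.+1 c.+2 d.+1 isT isT isT hr hl; apply: (from_l e).
have [lz|[n n0 h]] := @hard_case l r c.+2 d.+1 lm rm nf isT isT hl.
  by case: bothz => // a; rewrite hr lz expr0n mulr0.
by apply: (from_l n.+1).
Qed.
End Algebraic.

(** * Finite fields and the algebras A(F) and B(F, G, sigma) *)

Section FiniteField.
Variable (F : finFieldType).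
Notation q := #|F|.

Lemma card_finField_gt1 : (1 < q)%N.
Proof. exact: finNzRing_gt1. Qed.

Lemma card_finField : exists p v, [/\ prime p, p \in [pchar F] & q = (p ^ v)%N].
Proof.
by have [p pr pF] := finPcharP F; exists p, (logn p q); split=> //; rewrite {1}(card_pprimeChar pF).
Qed.

Lemma exprDn_card (E : comAlgType F) n (x y : E) :
  (x + y) ^+ (q ^ n) = x ^+ (q ^ n) + y ^+ (q ^ n).
Proof.
have [p [v [pr pF ->]]] := card_finField.
apply: exprDn_pchar; rewrite !pnatX pnatE //.
by have -> : p \in [pchar E] by rewrite (pchar_lalg E).
Qed.

Lemma exprZ_card (E : comAlgType F) n a (x : E) :
  (a *: x) ^+ (q ^ n) = a *: x ^+ (q ^ n).
Proof.
rewrite exprZn; congr (_ *: _).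
by elim: n => [|n IH]; rewrite ?expr1 // expnSr exprM IH expf_card.
Qed.

Lemma in_alg_card (E : comAlgType F) n a : (a%:A : E) ^+ (q ^ n) = a%:A.
Proof. by rewrite exprZ_card expr1n. Qed.
End FiniteField.

Section FiniteExtension.
Variables (F : finFieldType) (G : fieldExtType F).
Notation q := #|F|.

Lemma card_finvect : #|{: finvect_type G}| = (q ^ \dim {:G})%N.
Proof.
have e := @card_vspacef F (finvect_type G) (Vector.class (finvect_type G : vectType F)).
by rewrite -e (@card_vspace F (finvect_type G) (Vector.class (finvect_type G : vectType F))).
Qed.

Lemma expf_ext (b : G) : b ^+ (q ^ \dim {:G}) = b.
Proof. by rewrite -card_finvect; exact: (expf_card (b : finvect_type G)). Qed.

Lemma genPoly_ext : exists s : seq G,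
  'X^(q ^ \dim {:G}) - 'X = \prod_(b <- s) ('X - b%:P).
Proof.
exists (enum (finvect_type G)); rewrite -card_finvect.
by have := finField_genPoly (finvect_type G); rewrite -big_enum /=.
Qed.

Definition frob_fun j (x : G) : G := x ^+ (q ^ j).

Lemma frob_fun_zmod j : zmod_morphism (frob_fun j).
Proof.
move=> x y; rewrite /frob_fun exprDn_card -scaleN1r exprZ_card.
by rewrite scaleN1r.
Qed.

Lemma frob_fun_monoid j : monoid_morphism (frob_fun j).
Proof. by split=> [|x y]; rewrite /frob_fun ?expr1n ?exprMn. Qed.

Lemma frob_fun_scalable j : scalable (frob_fun j).
Proof. by move=> a x; apply: exprZ_card. Qed.

HB.instance Definition _ j := GRing.isZmodMorphism.Build G G (frob_fun j) (frob_fun_zmod j).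
HB.instance Definition _ j := GRing.isMonoidMorphism.Build G G (frob_fun j) (frob_fun_monoid j).
HB.instance Definition _ j := GRing.isScalable.Build F G G _ (frob_fun j) (frob_fun_scalable j).

Definition frob j : 'AEnd(G) := linfun_ahom (frob_fun j).

Lemma frobE j x : frob j x = x ^+ (q ^ j).
Proof. by rewrite lfunE. Qed.

Lemma frob_fixed (x : G) : x ^+ q = x -> x \in 1%VS.
Proof.
move=> xq; pose p := map_poly (in_alg G) ('X^q - 'X).
have: root p x.
  by rewrite /p rmorphB /= map_polyXn map_polyX rootE !hornerE xq subrr.
have -> : p = \prod_(z <- [seq b%:A | b : F]) ('X - z%:P).
  rewrite /p finField_genPoly rmorph_prod big_image /=.
  by apply: eq_bigr => b _; rewrite rmorphB /= map_polyX map_polyC.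
by rewrite root_prod_XsubC => /mapP[a _ ->]; rewrite memvZ // mem1v.
Qed.

(** Raising to the power q permutes the factors cyclically, since z^(q^dim G) = z; the coefficients
    are therefore fixed by Frobenius and lie in F. *)
Lemma orbit_poly (z : G) : exists h : {poly F},
  map_poly (in_alg G) h = \prod_(i < \dim {:G}) ('X - (z ^+ (q ^ i))%:P).
Proof.
set P := \prod_(i < _) _.
suff /polyOver1P[h ->] : P \is a polyOver 1%VS by exists h.
have eP : map_poly (frob_fun 1) P = P.
  rewrite /P map_prod_XsubC -(prednK (adim_gt0 {:G}%AS)).
  rewrite big_ord_recr big_ord_recl /= mulrC; congr (_ * _).
    by rewrite /frob_fun -exprM -expnD addn1 prednK ?adim_gt0 // expf_ext expr1.
  by apply: eq_bigr => i _; rewrite /frob_fun -exprM -expnD addn1.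
apply/polyOverP => i; apply: frob_fixed.
by rewrite -[in RHS]eP coef_map /= /frob_fun expn1.
Qed.

Variables (g : {poly F}) (z : G).
Hypotheses (irr : irreducible_poly g) (gz : horner_alg z g = 0).

Lemma irr_dvdp h : horner_alg z h = 0 -> g %| h.
Proof.
move=> hz; apply: contraT; rewrite -(irreducible_poly_coprime _ irr).
case/Bezout_eq1_coprimepP => -[u v] /= e.
have := congr1 (horner_alg z) e.
rewrite rmorphD !rmorphM /= gz hz !mulr0 addr0 rmorph1 => /esym/eqP.
by rewrite oner_eq0.
Qed.

Lemma dvdp_irr (E : comAlgType F) (x : E) h : g %| h ->
  horner_alg x g = 0 -> horner_alg x h = 0.
Proof. by move=> /dvdpP[k ->] gx; rewrite rmorphM /= gx mulr0. Qed.

Lemma irr_root_frob y : horner_alg y g = 0 -> exists2 j, (j < \dim {:G})%N & y = z ^+ (q ^ j).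
Proof.
move=> gy; have [h eh] := orbit_poly z.
have hz : horner_alg z h = 0.
  rewrite [LHS](_ : _ = (map_poly (in_alg G) h).[z]) // eh horner_prod.
  rewrite -(prednK (adim_gt0 {:G}%AS)) big_ord_recl !hornerE expn0 expr1.
  by rewrite subrr mul0r.
have : (map_poly (in_alg G) h).[y] = 0 := dvdp_irr (irr_dvdp hz) gy.
rewrite eh horner_prod => /eqP; rewrite prodf_seq_eq0 => /hasP[i _ /=].
by rewrite !hornerE subr_eq0 => /eqP ->; exists i.
Qed.
End FiniteExtension.

Lemma horner_algZ (F : fieldType) (E : comAlgType F) (x : E) c h :
  horner_alg x (c *: h) = c *: horner_alg x h.
Proof. by rewrite linearZ /= mulr_algl. Qed.

Section FieldTest.
Variables (F : finFieldType) (A : nualgType F) (E : comAlgType F).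
Variables (l r : A -> E).
Hypotheses (lm : alg_map l) (rm : alg_map r).
Variable (T : free_nualg F -> Prop).
Hypothesis (star : forall f, T f -> forall (a : nat -> A) (e : nat -> E),
  free_eval (fun k => (l (a k), e k, r (a k)) : Trialg E) f = 0).
Notation q := #|F|.

(** Up to the factor eta, l b is 1 and r b is 0, so the matrices with diagonal (l (u b), r (u b))
    and corner v multiply like (u, v) in A(F); the scalars are recovered since eta is nonzero. *)
Lemma satisfies_Aalg_F (b : A) (eta : E) : eta != 0 ->
  eta * l b = eta -> eta * r b = 0 -> forall f, T f -> satisfies (Aalg (Falg F)) f.
Proof.
move=> eta0 el er f Tf rho.
pose u k : F := (rho k).1; pose v k : F := (rho k).2.
have := @free_eval_rel F (Trialg E) (Aalg (Falg F)) (fun t s =>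
  [/\ eta * t.1.1 = (s.1 : F) *: eta, eta * t.1.2 = (s.2 : F) *: eta & eta * t.2 = 0])
  _ rho _ _ _ _ _ f.
move=> /(_ (fun k => (l (u k *: b), (v k)%:A, r (u k *: b)))); rewrite (star Tf).
case.
- move=> k; split => /=.
  + by rewrite (alg_mapZ lm) -scalerAr el.
  + by rewrite mulr_algr.
  + by rewrite (alg_mapZ rm) -scalerAr er scaler0.
- by split; rewrite /= ?mulr0 ?scale0r.
- move=> [[x w] y] [[x' w'] y'] [c d] [c' d'] /= [e1 e2 e3] [e4 e5 e6].
  by rewrite !mulrDr e1 e2 e3 e4 e5 e6 addr0 !scalerDl.
- move=> a [[x w] y] [c d] /= [e1 e2 e3].
  by rewrite -!scalerAr e1 e2 e3 scaler0 !scalerA.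
- move=> [[x w] y] [[x' w'] y'] [c d] [c' d'] /= [e1 e2 e3] [e4 e5 e6].
  split.
  + by rewrite mulrA e1 -scalerAl e4 scalerA.
  + by rewrite mulrDr [w * y']mulrC !mulrA e1 e6 mul0r addr0 -scalerAl e5 scalerA.
  + by rewrite mulrA e3 mul0r.
- case: (free_eval rho f) => [c d] /= e1 e2 _.
  move: e1 e2; rewrite !mulr0 => /esym/eqP e1 /esym/eqP e2.
  rewrite !scaler_eq0 (negPf eta0) !orbF in e1 e2.
  by rewrite (eqP e1) (eqP e2).
Qed.

Lemma satisfies_opposite_Aalg_F (b : A) (eta : E) : eta != 0 ->
  eta * l b = 0 -> eta * r b = eta ->
  forall f, T f -> satisfies (opposite (Aalg (Falg F))) f.
Proof.
move=> eta0 el er f Tf rho.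
pose u k : F := (rho k).1; pose v k : F := (rho k).2.
have := @free_eval_rel F (Trialg E) (opposite (Aalg (Falg F))) (fun t s =>
  [/\ eta * t.2 = (s.1 : F) *: eta, eta * t.1.2 = (s.2 : F) *: eta & eta * t.1.1 = 0])
  _ rho _ _ _ _ _ f.
move=> /(_ (fun k => (l (u k *: b), (v k)%:A, r (u k *: b)))); rewrite (star Tf).
case.
- move=> k; split => /=.
  + by rewrite (alg_mapZ rm) -scalerAr er.
  + by rewrite mulr_algr.
  + by rewrite (alg_mapZ lm) -scalerAr el scaler0.
- by split; rewrite /= ?mulr0 ?scale0r.
- move=> [[x w] y] [[x' w'] y'] [c d] [c' d'] /= [e1 e2 e3] [e4 e5 e6].
  by rewrite !mulrDr e1 e2 e3 e4 e5 e6 addr0 !scalerDl.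
- move=> a [[x w] y] [c d] /= [e1 e2 e3].
  by rewrite -!scalerAr e1 e2 e3 scaler0 !scalerA.
- move=> [[x w] y] [[x' w'] y'] [c d] [c' d'] /= [e1 e2 e3] [e4 e5 e6].
  split.
  + by rewrite [y * y']mulrC mulrA e4 -scalerAl e1 scalerA.
  + by rewrite mulrDr [w * y']mulrC !mulrA e3 mul0r add0r e4 -scalerAl e2 scalerA.
  + by rewrite mulrA e3 mul0r.
- case: (free_eval rho f) => [c d] /= e1 e2 _.
  move: e1 e2; rewrite !mulr0 => /esym/eqP e1 /esym/eqP e2.
  rewrite !scaler_eq0 (negPf eta0) !orbF in e1 e2.
  by rewrite (eqP e1) (eqP e2).
Qed.

Section Extension.
Variables (G : fieldExtType F) (g : {poly F}) (z : G).
Hypotheses (irr : irreducible_poly g) (gz : horner_alg z g = 0).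
Hypothesis (zgen : <<1; z>>%VS = fullv).

Lemma gen_poly (y : G) : exists h, y = horner_alg z h.
Proof.
have : y \in <<1; z>>%VS by rewrite zgen memvf.
by case/Fadjoin1_polyP => h ->; exists h.
Qed.

Lemma gen_poly0 (y : G) : z != 0 -> exists2 h : {poly F}, h`_0 = 0 & y = horner_alg z h.
Proof.
move=> z0; have [h eh] := gen_poly (y / z); exists (h * 'X); first by rewrite coefMX.
by rewrite rmorphM /= horner_algX -eh divfK.
Qed.

Lemma eta_dvdp (E' : comAlgType F) (eta x : E') h :
  eta * horner_alg x g = 0 -> horner_alg z h = 0 ->
  eta * horner_alg x h = 0.
Proof.
move=> ex /(irr_dvdp irr gz) /dvdpP[k ->].
by rewrite rmorphM /= mulrCA ex mulr0.
Qed.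

(** E need not be a field, but on multiples of eta the polynomials in x behave like their values at
    z in the field G; a Bezout relation replaces inversion. *)
Lemma eta_unit (eta x : E) h : eta * horner_alg x g = 0 ->
  eta * horner_alg x h = 0 -> eta = 0 \/ horner_alg z h = 0.
Proof.
move=> ex eh; have [/dvdpP[k ->]|] := boolP (g %| h).
  by right; rewrite rmorphM /= gz mulr0.
rewrite -(irreducible_poly_coprime _ irr) => /Bezout_eq1_coprimepP[[u v] /= e].
left; rewrite -[eta]mulr1 -(rmorph1 (horner_alg x)) -e rmorphD !rmorphM /=.
by rewrite mulrDr mulrCA ex mulrCA eh !mulr0 addr0.
Qed.

Lemma eta_frob (eta x y : E) j : eta * y = eta * x ^+ (q ^ j) -> forall h,
  eta * horner_alg y h = eta * horner_alg x h ^+ (q ^ j).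
Proof.
move=> er; elim/poly_ind => [|h c IH].
  by rewrite !rmorph0 expr0n expn_eq0 gtn_eqF ?mulr0 // ltnW // card_finField_gt1.
rewrite !rmorphD !rmorphM /= !horner_algX !horner_algC exprDn_card in_alg_card.
rewrite !mulrDr; congr (_ + _).
by rewrite exprMn mulrA IH mulrAC er mulrAC mulrA.
Qed.

(** Elements of G are polynomials in z, and l b is put for z. The diagonal must come from A, so its
    polynomial has no constant term, which z != 0 allows; up to eta its value under r is the q^j-th
    power of its value under l. *)
Lemma satisfies_Balg (b : A) (eta : E) j : eta != 0 -> z != 0 ->
  eta * horner_alg (l b) g = 0 -> eta * r b = eta * l b ^+ (q ^ j) ->
  forall f, T f -> satisfies (Balg (frob G j)) f.
Proof.
move=> eta0 z0 eg er f Tf rho.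
pose phi k := sval (cid2 (gen_poly0 (rho k).1 z0)).
have phi0 k : (phi k)`_0 = 0 by rewrite /phi; case: (cid2 _).
have phiE k : (rho k).1 = horner_alg z (phi k) by rewrite /phi; case: (cid2 _).
pose psi k := sval (cid (gen_poly (rho k).2)).
have psiE k : (rho k).2 = horner_alg z (psi k) by rewrite /psi; case: (cid _).
pose a k := sval (cid (alg_map_poly lm rm b (phi0 k))).
have aE k : l (a k) = horner_alg (l b) (phi k) /\ r (a k) = horner_alg (r b) (phi k).
  by rewrite /a; case: (cid _).
have etaP := eta_frob er.
pose rel (t : Trialg E) (s : Balg (frob G j)) := exists h k : {poly F},
  [/\ s = (horner_alg z h, horner_alg z k), eta * t.1.1 = eta * horner_alg (l b) h,
    eta * t.1.2 = eta * horner_alg (l b) k & eta * t.2 = eta * horner_alg (l b) h ^+ (q ^ j)].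
have := @free_eval_rel F (Trialg E) (Balg (frob G j)) rel
  (fun k => (l (a k), horner_alg (l b) (psi k), r (a k))) rho _ _ _ _ _ f.
rewrite (star Tf); case.
- move=> k; exists (phi k), (psi k); have [e1 e2] := aE k; split=> //=.
  + by rewrite -phiE -psiE; case: (rho k).
  + by rewrite e1.
  + by rewrite e2 etaP.
- exists 0, 0; split; rewrite /= ?rmorph0 ?mulr0 //.
  by rewrite expr0n expn_eq0 gtn_eqF ?mulr0 // ltnW // card_finField_gt1.
- move=> [[x w] y] [[x' w'] y'] _ _ [h [k [-> /= e1 e2 e3]]] [h' [k' [-> /= e4 e5 e6]]].
  exists (h + h'), (k + k'); split; rewrite /= ?rmorphD ?exprDn_card ?mulrDr; first by [].
  + by rewrite e1 e4.
  + by rewrite e2 e5.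
  + by rewrite e3 e6.
- move=> c [[x w] y] _ [h [k [-> /= e1 e2 e3]]].
  exists (c *: h), (c *: k); split; rewrite /= ?horner_algZ.
  + by congr pair; rewrite /= horner_algZ.
  + by rewrite -scalerAr e1 scalerAr.
  + by rewrite -scalerAr e2 scalerAr.
  + by rewrite -scalerAr e3 exprZ_card scalerAr.
- move=> [[x w] y] [[x' w'] y'] _ _ [h [k [-> /= e1 e2 e3]]] [h' [k' [-> /= e4 e5 e6]]].
  exists (h * h'), (h * k' + k * h' ^+ (q ^ j)); split; rewrite /= ?rmorphD !rmorphM ?rmorphXn /=.
  + by congr pair; rewrite /= frobE.
  + by rewrite mulrA e1 mulrAC e4 mulrAC mulrA.
  + rewrite !mulrDr; congr (_ + _).
      by rewrite mulrA e1 mulrAC e5 mulrAC mulrA.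
    by rewrite mulrA e2 mulrAC e6 mulrAC mulrA.
  + by rewrite mulrA e3 mulrAC e6 mulrAC exprMn mulrA.
- move=> h [k [-> /= e1 e2 _]].
  rewrite !mulr0 in e1 e2.
  have [e|->] := eta_unit eg (esym e1); first by rewrite e eqxx in eta0.
  by have [e|->] := eta_unit eg (esym e2); first by rewrite e eqxx in eta0.
Qed.
End Extension.
End FieldTest.

Definition one_of_five (F : fieldType) (P : nualgType F -> Prop) : Prop :=
  P (Aalg (Falg F)) \/ P (opposite (Aalg (Falg F))) \/
  P (Aalg (Calg F)) \/ P (opposite (Aalg (Calg F))) \/
  exists (G : fieldExtType F) (sigma : 'AEnd(G)),
    unique_maximal_subfield (fixedSpace sigma) /\ P (Balg sigma).

Lemma horner_algXn (F : fieldType) (E : comAlgType F) (x : E) n :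
  horner_alg x 'X^n = x ^+ n.
Proof. by rewrite rmorphXn /= horner_algX. Qed.

Lemma horner_alg_comp (F : fieldType) (E : comAlgType F) (x : E) (g h : {poly F}) :
  horner_alg (horner_alg x h) g = horner_alg x (g \Po h).
Proof.
elim/poly_ind: g => [|g c IH]; first by rewrite comp_poly0 !rmorph0.
rewrite comp_polyD comp_polyM comp_polyX comp_polyC !rmorphD !rmorphM /=.
by rewrite !horner_algX !horner_algC IH.
Qed.

Section UniqueMaximal.
Variables (F : fieldType) (G : fieldExtType F) (sigma : 'AEnd(G)).

(** A subfield that contains an element moved by sigma is all of G, so every other one lies in the
    invariant field. The condition on the invariant field is handled in this form throughout, by
    means of the converse below. *)
Lemma generators_unique_maximal :
  (exists z, sigma z != z) -> (forall y, sigma y != y -> <<1; y>>%VS = fullv) ->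
  unique_maximal_subfield (fixedSpace sigma).
Proof.
move=> [z sz] gen.
have nfull : (fixedSpace sigma : {vspace G}) <> fullv.
  by move=> e; move/eqP: sz; apply; apply/fixedSpaceP; rewrite e memvf.
have above (L : {subfield G}) : (L <= fixedSpace sigma)%VS \/ L = fullv :> {vspace G}.
  have [[y [yL sy]]|/forallNP h] := pselect (exists y, y \in L /\ sigma y != y).
    right; apply/eqP; rewrite eqEsubv subvf -(gen y sy).
    by apply/FadjoinP; split; rewrite ?sub1v.
  left; apply/subvP => y yL; apply/fixedSpaceP/eqP.
  by apply: contraT => sy; case: (h y).
split; first split=> // L KL.
  have [LK|->] := above L; [left|by right].
  by apply/eqP; rewrite eqEsubv LK KL.
move=> L [nL maxL]; have [LK|//] := above L.
by have [<-|] := maxL (fixedSpace_aspace sigma) LK.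
Qed.

Lemma unique_maximal_generators : unique_maximal_subfield (fixedSpace sigma) ->
  (exists z, sigma z != z) /\ forall y, sigma y != y -> <<1; y>>%VS = fullv.
Proof.
move=> [[nfull _] uniq]; split.
  apply: contra_notP nfull => /forallNP h; apply/eqP; rewrite eqEsubv subvf /=.
  apply/subvP => z _; apply/fixedSpaceP/eqP.
  by apply: contraT => sz; case: (h z).
move=> y sy; apply: contrapT => ny.
(* A proper subfield of largest dimension among those containing y is maximal, hence it is the
   invariant field and sigma fixes y. *)
have [L [yL nL maxL]] : exists L : {subfield G}, [/\ y \in L, (L : {vspace G}) <> fullv &
    forall L' : {subfield G}, (L <= L')%VS -> (L' : {vspace G}) <> fullv -> (\dim L' <= \dim L)%N].
  pose P n := `[< exists L : {subfield G}, [/\ y \in L, (L : {vspace G}) <> fullv & \dim L = n] >].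
  have exP : exists n, P n.
    exists (\dim <<1; y>>); apply/asboolP; exists <<1; y>>%AS; split=> //.
    exact: memv_adjoin.
  have ubP n : P n -> (n <= \dim {:G})%N.
    by move/asboolP => [L [_ _ <-]]; rewrite dimvS ?subvf.
  case: (ex_maxnP exP ubP) => n /asboolP[L [yL nL dL]] nmax.
  exists L; split=> // L' LL' nL'; rewrite dL; apply: nmax; apply/asboolP.
  by exists L'; split=> //; apply: (subvP LL').
have maxL' : maximal_subfield L.
  split=> // L' LL'; have [e|ne] := pselect (L' = fullv :> {vspace G}); [by right|left].
  by apply/esym/eqP; rewrite eqEdim LL' maxL.
move/eqP: sy; apply; apply/fixedSpaceP.
by rewrite -[fixedSpace sigma](uniq L maxL').
Qed.
End UniqueMaximal.

(** * The dichotomy for two algebra maps into a commutative algebra *)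

Section AbstractDichotomy.
Variables (F : finFieldType) (A : nualgType F) (E : comAlgType F).
Variables (l r : A -> E) (nat_fam : forall I : Type, ((I -> A) -> E) -> Prop).
Hypotheses (lm : alg_map l) (rm : alg_map r) (nf : natural_family l r nat_fam).
Notation q := #|F|.

(* Replacing a by a - a^Q, which acts nilpotently, forces x = x^Q. *)
Lemma frobenius_bound e : (1 < e)%N -> (forall a, l a = l a ^+ e /\ r a = r a ^+ e) ->
  exists2 m, (0 < m)%N & forall a, l a ^+ (q ^ m) = l a /\ r a ^+ (q ^ m) = r a.
Proof.
move=> e1 h; have [p [v [pr pF eq]]] := card_finField F.
pose k := e.-1; have k0 : (0 < k)%N by rewrite /k; lia.
(* e - 1 = n p^w with n prime to p, and Q is a power of q such that n divides Q - 1, by Euler. *)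
pose n := (k`_p^')%N; pose w := logn p k.
have kE : k = (n * p ^ w)%N by rewrite /n -p_part mulnC partnC.
have n0 : (0 < n)%N by apply: part_gt0.
have cop : coprime q n.
  rewrite eq coprimeXl // prime_coprime // -p'natE //; exact: part_pnat.
have m0 : (0 < totient n)%N by rewrite totient_gt0.
exists (totient n) => //; set Q := (q ^ totient n)%N.
have Q0 : (0 < Q)%N by rewrite expn_gt0 ltnW // card_finField_gt1.
have [t Qt] : exists t, Q.-1 = (n * t)%N.
  have /eqP := Euler_exp_totient cop; rewrite -/Q eqn_mod_dvd // => /dvdnP[t et].
  by exists t; rewrite mulnC -et subn1.
have pE : p \in [pchar E] by rewrite (pchar_lalg E).
(* 1 - x^n divides 1 - x^(Q-1), and its p^w-th power is 1 - x^(e-1), which x annihilates. *)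
have nil (x : E) : x = x ^+ e -> (x - x ^+ Q) ^+ (p ^ w) = 0.
  move=> xe; have -> : x - x ^+ Q = x * ((1 - x ^+ n) * \sum_(i < t) (x ^+ n) ^+ i).
    by rewrite -[1 - _]opprB mulNr -subrX1 opprB -exprM -Qt mulrBr mulr1 -exprS prednK.
  rewrite !exprMn mulrA (_ : x ^+ (p ^ w) * _ = 0) ?mul0r //.
  have -> : (1 - x ^+ n) ^+ (p ^ w) = 1 - x ^+ k.
    have pn : [pchar E].-nat (p ^ w)%N by rewrite pnatX pnatE // pE.
    by rewrite exprDn_pchar // expr1n exprNn_pchar // -exprM -kE.
  have pw0 : (0 < p ^ w)%N by rewrite expn_gt0 prime_gt0.
  rewrite -(prednK pw0).
  rewrite exprSr -mulrA mulrBr mulr1 -exprS prednK; last exact: ltnW.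
  by rewrite -xe subrr mulr0.
have fixe (x : E) : x = x ^+ e -> x ^+ (p ^ w) = 0 -> x = 0.
  move=> xe x0; have xi i : x = x ^+ (e ^ i).
    by elim: i => [|i IH]; rewrite ?expr1 // expnSr exprM -IH.
  rewrite (xi (p ^ w)%N) -(subnKC (ltnW (ltn_expl (p ^ w) e1))).
  by rewrite exprD x0 mul0r.
move=> a; have [b [lb rb]] := alg_map_subX lm rm a Q0.
have [hl hr] := h a; have [hlb hrb] := h b.
split; apply/esym/eqP; rewrite -subr_eq0.
  by rewrite -lb; apply/eqP/fixe => //; rewrite lb; apply: nil.
by rewrite -rb; apply/eqP/fixe => //; rewrite rb; apply: nil.
Qed.

Variable (T : free_nualg F -> Prop).
Hypothesis (star : forall f, T f -> forall (a : nat -> A) (e : nat -> E),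
  free_eval (fun k => (l (a k), e k, r (a k)) : Trialg E) f = 0).

Section Fixed.
Variables (m : nat).
Hypotheses (m0 : (0 < m)%N).
Hypothesis fixlr : forall a, l a ^+ (q ^ m) = l a /\ r a ^+ (q ^ m) = r a.
Let Q := (q ^ m)%N.

Lemma Q_gt1 : (1 < Q)%N.
Proof. by rewrite -(expn0 q) ltn_exp2l // card_finField_gt1. Qed.

Lemma fix_horner (x : E) g : x ^+ Q = x -> horner_alg x g ^+ Q = horner_alg x g.
Proof.
move=> xQ; elim/poly_ind: g => [|g c IH].
  by rewrite rmorph0 expr0n gtn_eqF // ltnW // Q_gt1.
rewrite rmorphD rmorphM /= horner_algX horner_algC exprDn_card in_alg_card.
by rewrite exprMn IH xQ.
Qed.

(** A weight eta cuts out the part of E under study. Being a multiple of l a - r a and fixed by the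
    power Q, it cannot annihilate l a - r a: this would give eta^2 = 0 and so eta = 0
    ([admissible_sub]). *)
Definition admissible (a : A) (eta : E) : Prop :=
  [/\ eta != 0, eta ^+ Q = eta & exists e, eta = (l a - r a) * e].

Lemma admissibleM a eta x : admissible a eta -> x ^+ Q = x -> eta * x != 0 ->
  admissible a (eta * x).
Proof.
move=> [_ etaQ [e ee]] xQ nz; split=> //; first by rewrite exprMn etaQ xQ.
by exists (e * x); rewrite ee mulrA.
Qed.

Lemma admissible_sub a eta : admissible a eta -> eta * (l a - r a) != 0.
Proof.
move=> [nz etaQ [e ee]]; apply: contraNneq nz => z.
rewrite -etaQ -(subnKC Q_gt1) exprD expr2 {2}ee mulrA z.
by rewrite !mul0r.
Qed.

(** For a factorization g = k h, either eta annihilates h at x, or eta times the value of h is again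
    a weight and is annihilated by k; the minimal size of g settles both cases. *)
Lemma minimal_irreducible (P : E -> Prop) (x : E) eta (g : {poly F}) :
  (forall eta, P eta -> eta != 0) ->
  (forall eta h, P eta -> eta * horner_alg x h != 0 -> P (eta * horner_alg x h)) ->
  P eta -> g != 0 -> eta * horner_alg x g = 0 ->
  (forall eta' h, P eta' -> h != 0 -> eta' * horner_alg x h = 0 -> (size g <= size h)%N) ->
  irreducible_poly g.
Proof.
move=> Pnz PM Peta g0 eg gmin; split.
  rewrite ltnNge; apply/negP => /size1_polyC gC; move: g0 eg.
  rewrite gC polyC_eq0 horner_algC mulr_algr => g0 /eqP.
  by rewrite scaler_eq0 (negPf g0) (negPf (Pnz _ Peta)).
move=> h szh /dvdpP[k gk]; rewrite -dvdp_size_eqp ?gk ?dvdp_mull // -gk.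
have h0 : h != 0 by apply: contraNneq g0 => h0; rewrite gk h0 mulr0.
have k0 : k != 0 by apply: contraNneq g0 => k0; rewrite gk k0 mul0r.
have [eh|neh] := eqVneq (eta * horner_alg x h) 0.
  by rewrite eqn_leq (gmin _ _ Peta h0 eh) gk dvdp_leq ?mulf_neq0 ?dvdp_mull.
have := gmin _ k (PM _ _ Peta neh) k0.
rewrite -mulrA -rmorphM /= [h * k]mulrC -gk => /(_ eg).
rewrite gk size_mul //; have := szh; rewrite -size_poly_eq0 in h0.
by case: (size h) h0 => [|[|sh]] // _ _; rewrite addnS /= addnS ltnNge leq_addr.
Qed.

Definition annihilated (n : nat) : Prop := exists a eta (g : {poly F}),
  [/\ admissible a eta, g != 0, size g = n & eta * horner_alg (l a) g = 0].

Lemma exp_pred_unit (g : {poly F}) (x eta : E) : coprimep g 'X -> x ^+ Q = x ->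
  eta * horner_alg x g = 0 -> eta * x ^+ Q.-1 = eta.
Proof.
move=> /Bezout_eq1_coprimepP[[u v] /= e] xQ eg.
have ev : eta = eta * horner_alg x v * x.
  rewrite -[LHS]mulr1 -(rmorph1 (horner_alg x)) -e rmorphD !rmorphM /= horner_algX.
  by rewrite mulrDr mulrCA eg mulr0 add0r mulrA.
rewrite {1}ev -mulrA -exprS prednK ?xQ //.
by apply: ltnW; apply: Q_gt1.
Qed.

(** Chinese remainders: v h is 1 modulo g and 0 modulo h. The factor X^(Q-1) removes the constant
    term and acts as 1 on the side of x by [exp_pred_unit]. *)
Lemma separating_poly (g h : {poly F}) (x y eta : E) : coprimep g h -> coprimep g 'X ->
  x ^+ Q = x -> eta * horner_alg x g = 0 -> eta * horner_alg y h = 0 ->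
  exists2 k : {poly F}, k`_0 = 0 & eta * horner_alg x k = eta /\ eta * horner_alg y k = 0.
Proof.
move=> /Bezout_eq1_coprimepP[[u v] /= e] gX xQ eg eh.
have Q1 : (0 < Q.-1)%N by have := Q_gt1; case: (Q) => [|[]].
exists (v * h * 'X^(Q.-1)); first by rewrite coefMXn Q1.
rewrite !rmorphM !rmorphXn /= !horner_algX; split; last first.
  by rewrite mulrA mulrCA eh mulr0 mul0r.
have evh : eta * (horner_alg x v * horner_alg x h) = eta.
  rewrite -rmorphM /= (_ : v * h = 1 - u * g); last by rewrite -e [u * g + _]addrC addrK.
  by rewrite rmorphB rmorph1 rmorphM /= mulrBr mulr1 mulrCA eg mulr0 subr0.
by rewrite mulrA evh (exp_pred_unit gX xQ).
Qed.

(** A separating polynomial can be built on a side whose polynomial is prime to X, and two coprime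
    irreducible polynomials are not both associate to X; the side decides between A(F) and its
    opposite. *)
Lemma separating_coprime a eta (g h : {poly F}) : eta != 0 -> coprimep g h ->
  irreducible_poly g -> irreducible_poly h ->
  eta * horner_alg (l a) g = 0 -> eta * horner_alg (r a) h = 0 ->
  (forall f, T f -> satisfies (Aalg (Falg F)) f) \/
  (forall f, T f -> satisfies (opposite (Aalg (Falg F))) f).
Proof.
move=> eta0 cop irrg irrh eg eh; have [la ra] := fixlr a.
have [gX|] := boolP (coprimep g 'X).
  have [k k0 [e1 e2]] := separating_poly cop gX la eg eh.
  have [b [lb rb]] := alg_map_poly lm rm a k0.
  by left; apply: (satisfies_Aalg_F lm rm star (b := b) eta0); rewrite ?lb ?rb.
rewrite irreducible_poly_coprime // negbK => gdX.
have hX : coprimep h 'X.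
  have eqX (k : {poly F}) : irreducible_poly k -> k %| 'X -> k %= 'X.
    move=> [k1 _] kX; rewrite -dvdp_size_eqp // eqn_leq dvdp_leq ?polyX_eq0 //.
    by rewrite size_polyX.
  rewrite irreducible_poly_coprime //; apply: contraL cop => hdX.
  rewrite irreducible_poly_coprime // negbK.
  by rewrite (eqp_dvdl _ (eqX g irrg gdX)) (eqp_dvdr 'X (eqX h irrh hdX)).
rewrite coprimep_sym in cop.
have [k k0 [e1 e2]] := separating_poly cop hX ra eh eg.
have [b [lb rb]] := alg_map_poly lm rm a k0.
by right; apply: (satisfies_opposite_Aalg_F lm rm star (b := b) eta0); rewrite ?lb ?rb.
Qed.

Theorem abstract_fixed : (exists a, l a <> r a) ->
  one_of_five (fun B => forall f, T f -> satisfies B f).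
Proof.
move=> [a0 ne0].
have exn : exists n, `[< annihilated n >].
  have d0 : l a0 - r a0 != 0 by rewrite subr_eq0; apply/eqP.
  have [la ra] := fixlr a0.
  exists (size ('X^Q - 'X : {poly F})); apply/asboolP.
  exists a0, (l a0 - r a0), ('X^Q - 'X); split=> //.
  - split=> //; last by exists 1; rewrite mulr1.
    by rewrite -scaleN1r exprDn_card exprZ_card la ra.
  - by rewrite -size_poly_eq0 size_polyDl ?size_polyXn // size_polyN size_polyX ltnS Q_gt1.
  - by rewrite rmorphB rmorphXn /= horner_algX la subrr mulr0.
(* The size of g is minimal over all a and eta at once; the end of the proof uses this for another
   element b. *)
case: (ex_minnP exn) => n /asboolP[a [eta [g [adm g0 sg eg]]]] nmin {exn a0 ne0}.
have gmin a' eta' (h : {poly F}) : admissible a' eta' -> h != 0 -> eta' * horner_alg (l a') h = 0 ->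
    (size g <= size h)%N.
  by move=> ad h0 eh; rewrite sg; apply: nmin; apply/asboolP; exists a', eta', h.
have [la ra] := fixlr a.
have irrg : irreducible_poly g.
  apply: (minimal_irreducible (P := admissible a) (x := l a)) adm g0 eg _ => [e []//|e h ad nz|].
    exact: admissibleM (fix_horner _ la) nz.
  exact: gmin.
pose P e := admissible a e /\ e * horner_alg (l a) g = 0.
have PM e x : P e -> x ^+ Q = x -> e * x != 0 -> P (e * x).
  by move=> [ad ez] xQ nz; split; [apply: admissibleM|rewrite mulrAC ez mul0r].
(* A second minimization, for r a, among the weights on which g still annihilates l a. *)
pose P2 n := exists e (h : {poly F}), [/\ P e, h != 0, size h = n & e * horner_alg (r a) h = 0].
have exn2 : exists n, `[< P2 n >].
  exists (size ('X^Q - 'X : {poly F})); apply/asboolP.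
  exists eta, ('X^Q - 'X); split=> //.
  - by rewrite -size_poly_eq0 size_polyDl ?size_polyXn // size_polyN size_polyX ltnS Q_gt1.
  - by rewrite rmorphB rmorphXn /= horner_algX ra subrr mulr0.
case: (ex_minnP exn2) => n2 /asboolP[eta2 [h [[ad2 eg2] h0 sh eh]]] nmin2 {exn2}.
have irrh : irreducible_poly h.
  apply: (minimal_irreducible (P := P) (x := r a) _ _ (conj ad2 eg2)) h0 eh _ =>
    [e [[]]//|e k Pe nz|e k Pe k0 ek].
    exact: PM (fix_horner _ ra) nz.
  by rewrite sh; apply: nmin2; apply/asboolP; exists e, k.
have eta20 : eta2 != 0 by case: ad2.
have [cop|] := boolP (coprimep g h).
  have [?|?] := separating_coprime eta20 cop irrg irrh eg2 eh; first by left.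
  by right; left.
rewrite irreducible_poly_coprime // negbK => gh.
have eg2r : eta2 * horner_alg (r a) g = 0.
  case: irrh => h1 irrh; have gh' : g %= h by apply: irrh => //; case: irrg; case: (size g) => [|[]].
  have /dvdpP[k ->] : h %| g by rewrite (eqp_dvdr h gh').
  by rewrite rmorphM /= mulrCA eh mulr0.
have [G dimG [z]] := irredp_FAdjoin irrg.
rewrite /root => /eqP gz zgen; rewrite -/(horner_alg z g) in gz.
have [h1 eh1] := orbit_poly z; set M := \dim {:G} in eh1.
have h1z : horner_alg z h1 = 0.
  rewrite [LHS](_ : _ = (map_poly (in_alg G) h1).[z]) // eh1 horner_prod.
  rewrite /M -(prednK (adim_gt0 {:G}%AS)) big_ord_recl !hornerE expn0 expr1.
  by rewrite subrr mul0r.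
(* D = h1 (Y) - prod_i (Y - X^(q^i)) vanishes at X = z, so its coefficients, polynomials in X, are
   multiples of g. At X = l a, Y = r a it shows that eta2 annihilates the product of the r a - l
   a^(q^i). *)
pose D := map_poly polyC h1 - \prod_(i < M) ('X - ('X^(q ^ i) : {poly F})%:P).
have Dz : map_poly (horner_alg z) D = 0.
  rewrite rmorphB /= rmorph_prod /= -map_poly_comp.
  rewrite (eq_map_poly (g := in_alg G)) => [|c]; last by rewrite /= horner_algC.
  rewrite eh1; apply/eqP; rewrite subr_eq0; apply/eqP; apply: eq_bigr => i _.
  by rewrite map_polyXsubC /= horner_algXn.
have chain0 : eta2 * \prod_(i < M) (r a - l a ^+ (q ^ i)) = 0.
  have : eta2 * (map_poly (horner_alg (l a)) D).[r a] = 0.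
    rewrite horner_coef mulr_sumr big1 // => i _; rewrite coef_map mulrA /=.
    rewrite (eta_dvdp irrg gz eg2) ?mul0r //.
    by rewrite -coef_map Dz coef0.
  rewrite rmorphB /= rmorph_prod /= -map_poly_comp.
  rewrite (eq_map_poly (g := in_alg E)) => [|c]; last by rewrite /= horner_algC.
  rewrite hornerD hornerN mulrBr (eta_dvdp irrg gz eg2r h1z) sub0r => /eqP.
  rewrite oppr_eq0 horner_prod => /eqP e; rewrite -[RHS]e; congr (_ * _).
  by apply: eq_bigr => i _; rewrite map_polyXsubC /= horner_algXn !hornerE.
(* A way around zero divisors: the last nonzero partial product is a weight on which r a = l
   a^(q^j). *)
pose chain N := eta2 * \prod_(i < N) (r a - l a ^+ (q ^ i)).
have exN : exists N, chain N == 0 by exists M; rewrite /chain chain0.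
case: (ex_minnP exN) => -[|j] /eqP cN Nmin.
  by move: cN; rewrite /chain big_ord0 mulr1 => /eqP; rewrite (negPf eta20).
have c0 : chain j != 0 by apply/negP => /Nmin; rewrite ltnn.
have [adm3 eg3] : P (chain j).
  apply: PM => //; rewrite -prodrXl; apply: eq_bigr => i _.
  rewrite -scaleN1r exprDn_card exprZ_card ra; congr (_ + _ *: _).
  by rewrite exprAC la.
have eg3r : chain j * horner_alg (r a) g = 0 by rewrite /chain mulrAC eg2r mul0r.
have er : chain j * r a = chain j * l a ^+ (q ^ j).
  by apply/eqP; rewrite -subr_eq0 -mulrBr -cN /chain big_ord_recr mulrA.
have sub3 := admissible_sub adm3.
move: (chain j) c0 adm3 eg3 eg3r er sub3 => eta3 eta30 adm3 eg3 eg3r er sub3.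
(* If z = 0, the weight annihilates both l a and r a, hence their difference. *)
have z0 : z != 0.
  apply: contraNneq sub3 => z0; have zX : horner_alg z 'X = 0 by rewrite horner_algX.
  have := eta_dvdp irrg gz eg3 zX; have := eta_dvdp irrg gz eg3r zX.
  by rewrite !horner_algX mulrBr => -> ->; rewrite subrr.
do 4 right; exists G, (frob G j); split; last first.
  exact: (satisfies_Balg lm rm star irrg gz zgen eta30 z0 eg3 er).
apply: generators_unique_maximal.
  exists z; apply: contraNneq sub3; rewrite frobE => ez.
  have := eta_dvdp irrg gz eg3 (h := 'X^(q ^ j) - 'X).
  rewrite !rmorphB !rmorphXn /= !horner_algX ez subrr => /(_ (erefl _)) /eqP.
  rewrite mulrBr -er -mulrBr => /eqP e.
  by rewrite -opprB mulrN e oppr0.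
(* An element y moved by the automorphism comes from some b on which l and r still differ, so the
   minimality of g bounds the degree of y below by dim G. *)
move=> y; rewrite frobE => ny.
have [phi phi0 yphi] := gen_poly0 zgen y z0.
have [b [lb rb]] := alg_map_poly lm rm a phi0.
have lrb : eta3 * (l b - r b) = eta3 * horner_alg (l a) (phi - phi ^+ (q ^ j)).
  rewrite lb rb rmorphB rmorphXn /= !mulrBr; congr (_ - _).
  exact: (eta_frob er).
have eta40 : eta3 * (l b - r b) != 0.
  apply: contra ny => /eqP; rewrite lrb => /(eta_unit irrg gz eg3)[e|].
    by rewrite e eqxx in eta30.
  by rewrite rmorphB rmorphXn /= -yphi => /eqP; rewrite subr_eq0 eq_sym.
have adm4 : admissible b (eta3 * (l b - r b)).
  split=> //; last by exists eta3; rewrite mulrC.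
  have [_ e3 _] := adm3; have [lbQ rbQ] := fixlr b.
  by rewrite exprMn e3 -[- r b]scaleN1r exprDn_card exprZ_card lbQ rbQ.
have /polyOver1P[g' eg'] := minPolyOver 1%AS y.
have g'0 : g' != 0.
  by rewrite -(map_poly_eq0 (in_alg G)) -eg' monic_neq0 // monic_minPoly.
have g'y : horner_alg y g' = 0.
  by rewrite [LHS](_ : _ = (map_poly (in_alg G) g').[y]) // -eg'; apply/rootP/root_minPoly.
have := gmin _ _ g' adm4 g'0.
rewrite lb horner_alg_comp mulrAC (eta_dvdp irrg gz eg3) ?mul0r; last first.
  by rewrite -horner_alg_comp -yphi.
move=> /(_ (erefl _)); rewrite -(size_map_poly (in_alg G) g') -eg' size_minPoly => szg.
apply/eqP; rewrite eqEdim subvf dim_Fadjoin dimv1 muln1 dimG.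
by move: szg; case: (size g).
Qed.
End Fixed.

Theorem abstract_dichotomy :
  (exists a, l a <> r a) -> one_of_five (fun B => forall f, T f -> satisfies B f).
Proof.
move=> ne.
have [d1|nd1] := pselect (degenerate l r); last first.
  by do 2 right; left; exact: (satisfies_Aalg_C lm rm nf star nd1).
have [d2|nd2] := pselect (degenerate r l); last first.
  by do 3 right; left; exact: (satisfies_opposite_Aalg_C lm rm nf star nd2).
have [e e1 he] := algebraic_or lm rm nf ne d1 d2.
have [m m0 hm] := frobenius_bound e1 he.
exact: abstract_fixed m0 hm ne.
Qed.
End AbstractDichotomy.

(** * The centroid of an ideal *)

Section Iterated.
Variables (F : fieldType) (R : nualgType F).

(* gam m.+1 is the set of the values of lie_word m. *)
Fixpoint gam (k : nat) (x : R) : Prop :=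
  if k is k'.+1 then exists y z, gam k' y /\ x = nucomm y z else True.

Definition iter_comm (xs : seq R) (v : R) : R := foldl (@nucomm _ _) v xs.

Lemma gam_iter k xs v : gam k v -> gam (k + size xs) (iter_comm xs v).
Proof.
elim: xs k v => [|x xs IH] k v gv; first by rewrite addn0.
by rewrite /= addnS -addSn; apply: IH; exists v, x.
Qed.

Lemma gam_split k M x : gam (k + M) x ->
  exists y xs, [/\ gam k y, size xs = M & x = iter_comm xs y].
Proof.
elim: M x => [|M IH] x; first by rewrite addn0 => gx; exists x, [::].
rewrite addnS => -[_ [z [/IH[y [xs [gy sx ->]]] ->]]].
exists y, (rcons xs z); split=> //; first by rewrite size_rcons sx.
by rewrite /iter_comm foldl_rcons.
Qed.

Lemma nucommDl (x y z : R) : nucomm (x + y) z = nucomm x z + nucomm y z.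
Proof. by rewrite /nucomm numulDl numulDr opprD addrACA. Qed.

Lemma nucomm0 (z : R) : nucomm 0 z = 0.
Proof. by rewrite /nucomm numul0r numulr0 subrr. Qed.

Lemma iter_commD xs (v w : R) : iter_comm xs (v + w) = iter_comm xs v + iter_comm xs w.
Proof. by elim: xs v w => //= x xs IH v w; rewrite nucommDl IH. Qed.

Lemma iter_comm0 xs : iter_comm xs 0 = 0.
Proof. by elim: xs => //= x xs IH; rewrite nucomm0 IH. Qed.

Lemma nucomm_morph (phi : R -> R) : nualg_morphism phi -> forall x y,
  phi (nucomm x y) = nucomm (phi x) (phi y).
Proof.
move=> pm x y; rewrite /nucomm (nualg_morphismD pm) (nualg_morphismN pm).
by rewrite !(nualg_morphismM pm).
Qed.

Lemma gam_morph (phi : R -> R) : nualg_morphism phi -> forall k x, gam k x -> gam k (phi x).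
Proof.
move=> pm; elim=> // k IH _ [y [z [/IH gy ->]]].
by exists (phi y), (phi z); split=> //; rewrite nucomm_morph.
Qed.

Lemma gamS k x : gam k.+1 x -> gam k x.
Proof.
elim: k x => // k IH _ [y [z [gy ->]]]; by exists y, z; split=> //; apply: IH.
Qed.

Lemma gam_le k j x : (j <= k)%N -> gam k x -> gam j x.
Proof.
move=> /subnK <-; elim: (k - j)%N => // n IH; rewrite addSn => /gamS; exact: IH.
Qed.
End Iterated.

Section CentralEndomorphisms.
Variables (F : fieldType) (R : nualgType F) (S : R -> Prop).

Record ideal_of : predArgType :=
  IdealOf { ideal_val :> R; _ : ideal_val \in nuideal_genb S }.

HB.instance Definition _ := [isSub for ideal_val].
HB.instance Definition _ := [Choice of ideal_of by <:].
HB.instance Definition _ := [SubChoice_isSubLmodule of ideal_of by <:].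

Lemma ideal_ofP (w : ideal_of) : nuideal_gen S (val w).
Proof. exact/nuideal_genbP/valP. Qed.

Lemma lact_proof x (w : ideal_of) : x ** val w \in nuideal_genb S.
Proof. by apply/nuideal_genbP; have [_ _ _ h] := nuideal_genP S; case: (h x _ (ideal_ofP w)). Qed.

Lemma ract_proof x (w : ideal_of) : val w ** x \in nuideal_genb S.
Proof. by apply/nuideal_genbP; have [_ _ _ h] := nuideal_genP S; case: (h x _ (ideal_ofP w)). Qed.

Definition lact x w : ideal_of := IdealOf (lact_proof x w).
Definition ract x w : ideal_of := IdealOf (ract_proof x w).

Definition bimodule_map (f : ideal_of -> ideal_of) : Prop :=
  [/\ linear f, forall x w, f (lact x w) = lact x (f w)
    & forall x w, f (ract x w) = ract x (f w)].

Definition is_cend (f : ideal_of -> ideal_of) : Prop :=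
  bimodule_map f /\ forall g, bimodule_map g -> forall w, f (g w) = g (f w).

(* The center of the ring of bimodule endomorphisms of the ideal. *)
Record cend0 : predArgType :=
  Cend { cend_fun :> ideal_of -> ideal_of; _ : `[< is_cend cend_fun >] }.

HB.instance Definition _ := [isSub for cend_fun].
HB.instance Definition _ := [Choice of cend0 by <:].

Lemma cendP (f : cend0) : is_cend f.
Proof. exact/asboolP/(valP f). Qed.

Lemma cend_ext (f g : cend0) : (forall w, f w = g w) -> f = g.
Proof. by move=> fg; apply: val_inj; apply/funext. Qed.

Notation L := ideal_of.

Lemma cend_linear (f : cend0) : linear f.
Proof. by have [[]] := cendP f. Qed.

Lemma cendD (f : cend0) : {morph f : x y / x + y}.
Proof. by move=> x y; rewrite -[x]scale1r (cend_linear f) !scale1r. Qed.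

Lemma cend_0 (f : cend0) : f 0 = 0.
Proof. by apply: (addrI (f 0)); rewrite -cendD !addr0. Qed.

Lemma cendZ (f : cend0) c x : f (c *: x) = c *: f x.
Proof. by rewrite -[c *: x]addr0 (cend_linear f) cend_0 addr0. Qed.

Lemma bimodule_mapD g : bimodule_map g -> {morph g : x y / x + y}.
Proof. by move=> [gl _ _] x y; rewrite -[x]scale1r gl !scale1r. Qed.

Lemma bimodule_map0 g : bimodule_map g -> g 0 = 0.
Proof. by move=> gm; apply: (addrI (g 0)); rewrite -(bimodule_mapD gm) !addr0. Qed.

Lemma bimodule_mapZ g : bimodule_map g -> forall c x, g (c *: x) = c *: g x.
Proof.
by move=> gm c x; have [gl _ _] := gm; rewrite -[c *: x]addr0 gl (bimodule_map0 gm) addr0.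
Qed.

Lemma lact_linear x : linear (lact x).
Proof. by move=> c v w; apply: val_inj; rewrite /= numulDr numulZr. Qed.

Lemma ract_linear x : linear (ract x).
Proof. by move=> c v w; apply: val_inj; rewrite /= numulDl numulZl. Qed.

Lemma is_cend_zero : is_cend (fun _ => 0).
Proof.
split; last by move=> g gm w; rewrite bimodule_map0.
split=> [c v w|x w|x w]; first by rewrite scaler0 addr0.
  by apply: val_inj; rewrite /= numulr0.
by apply: val_inj; rewrite /= numul0r.
Qed.

Lemma is_cend_id : is_cend id.
Proof. by []. Qed.

Lemma is_cend_add (f g : cend0) : is_cend (fun w => f w + g w).
Proof.
have [[fl fL fR] fc] := cendP f; have [[gl gL gR] gc] := cendP g.
split; last by move=> h hm w; rewrite fc // gc // (bimodule_mapD hm).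
split=> [c v w|x w|x w].
- by rewrite fl gl scalerDr addrACA.
- by rewrite fL gL; apply: val_inj; rewrite /= numulDr.
- by rewrite fR gR; apply: val_inj; rewrite /= numulDl.
Qed.

Lemma is_cend_scale c (f : cend0) : is_cend (fun w => c *: f w).
Proof.
have [[fl fL fR] fc] := cendP f.
split; last by move=> h hm w; rewrite fc // (bimodule_mapZ hm).
split=> [d v w|x w|x w].
- by rewrite fl scalerDr !scalerA mulrC.
- by rewrite fL; apply: val_inj; rewrite /= numulZr.
- by rewrite fR; apply: val_inj; rewrite /= numulZl.
Qed.

Lemma is_cend_comp (f g : cend0) : is_cend (fun w => f (g w)).
Proof.
have [[fl fL fR] fc] := cendP f; have [[gl gL gR] gc] := cendP g.
split; last by move=> h hm w; rewrite gc // fc.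
by split=> [c v w|x w|x w]; rewrite ?gl ?fl ?gL ?fL ?gR ?fR.
Qed.

Definition mk_cend f (h : is_cend f) : cend0 := Cend (asboolT h).

Definition cend_zero := mk_cend is_cend_zero.
Definition cend_one := mk_cend is_cend_id.
Definition cend_add f g := mk_cend (is_cend_add f g).
Definition cend_scale c f := mk_cend (is_cend_scale c f).
Definition cend_opp f := cend_scale (-1) f.
Definition cend_mul f g := mk_cend (is_cend_comp f g).

Lemma cend_addA : associative cend_add.
Proof. by move=> f g h; apply: cend_ext => w; rewrite /= addrA. Qed.
Lemma cend_addC : commutative cend_add.
Proof. by move=> f g; apply: cend_ext => w; rewrite /= addrC. Qed.
Lemma cend_add0 : left_id cend_zero cend_add.
Proof. by move=> f; apply: cend_ext => w; rewrite /= add0r. Qed.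
Lemma cend_addN : left_inverse cend_zero cend_opp cend_add.
Proof. by move=> f; apply: cend_ext => w; rewrite /= scaleN1r addNr. Qed.

(** The argument [nz] makes 1 differ from 0, as the ring structure below demands. *)
Definition cend (nz : exists w : L, w != 0) : Type := cend0.
Variable nz : exists w : L, w != 0.
Notation E := (cend nz).
HB.instance Definition _ := Choice.on E.
HB.instance Definition _ := GRing.isZmodule.Build E cend_addA cend_addC cend_add0 cend_addN.

Lemma cend_mulA : associative cend_mul.
Proof. by move=> f g h; apply: cend_ext. Qed.
Lemma cend_mulC : commutative cend_mul.
Proof. by move=> f g; apply: cend_ext => w /=; have [gm _] := cendP g; have [_ ->] := cendP f. Qed.
Lemma cend_mul1 : left_id cend_one cend_mul.
Proof. by move=> f; apply: cend_ext. Qed.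
Lemma cend_mulDl : left_distributive cend_mul cend_add.
Proof. by move=> f g h; apply: cend_ext. Qed.
Lemma cend_one_neq0 : cend_one != cend_zero.
Proof.
case: (nz) => w w0; apply: contraNneq w0 => e.
by rewrite -[w]/(cend_one w) e.
Qed.

HB.instance Definition _ := GRing.Zmodule_isComNzRing.Build E
  cend_mulA cend_mulC cend_mul1 cend_mulDl cend_one_neq0.

Lemma cend_scaleA a b (f : E) : cend_scale a (cend_scale b f) = cend_scale (a * b) f.
Proof. by apply: cend_ext => w; rewrite /= scalerA. Qed.
Lemma cend_scale1 : left_id 1 cend_scale.
Proof. by move=> f; apply: cend_ext => w; rewrite /= scale1r. Qed.
Lemma cend_scaleDr : right_distributive cend_scale (+%R : E -> E -> E).
Proof. by move=> c f g; apply: cend_ext => w; rewrite /= scalerDr. Qed.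
Lemma cend_scaleDl (f : E) : {morph (fun c : F => cend_scale c f : E) : a b / a + b}.
Proof. by move=> a b; apply: cend_ext => w; rewrite /= scalerDl. Qed.

HB.instance Definition _ := GRing.Zmodule_isLmodule.Build F E
  cend_scaleA cend_scale1 cend_scaleDr cend_scaleDl.

Lemma cend_scaleAl (c : F) (f g : E) : c *: (f * g) = (c *: f) * g.
Proof. by apply: cend_ext. Qed.

HB.instance Definition _ := GRing.Lmodule_isLalgebra.Build F E cend_scaleAl.
HB.instance Definition _ := GRing.Lalgebra_isComAlgebra.Build F E.

Definition cendAlg : comAlgType F := E.

Lemma cendDE (f g : E) w : (f + g : E) w = f w + g w.
Proof. by []. Qed.
Lemma cendME (f g : E) w : (f * g : E) w = f (g w).
Proof. by []. Qed.
Lemma cendZE c (f : E) w : (c *: f : E) w = c *: f w.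
Proof. by []. Qed.
End CentralEndomorphisms.

(** * The two actions on the ideal of the elements central on it *)

Section CentralElements.
Variables (F : fieldType) (R : nualgType F) (S : R -> Prop).
Notation L := (ideal_of S).
Notation endo := (@nualg_morphism F R R).

(** The quantifier over phi makes the set stable under endomorphisms; at phi = id it makes both
    multiplications by a bimodule endomorphisms of L. *)
Definition central_elt (a : R) : Prop :=
  forall phi, endo phi -> forall x w, nuideal_gen S w ->
    nucomm (phi a) x ** w = 0 /\ w ** nucomm (phi a) x = 0.

Definition central_eltb : R -> bool := fun a => `[< central_elt a >].

Lemma central_eltP a : reflect (central_elt a) (a \in central_eltb).
Proof. exact: asboolP. Qed.

Lemma nucommZl c (x y : R) : nucomm (c *: x) y = c *: nucomm x y.
Proof. by rewrite /nucomm numulZl numulZr scalerBr. Qed.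

Lemma central_elt_submod : subsemimod_closed central_eltb.
Proof.
split; first split.
- apply/central_eltP => phi pm x w _.
  by rewrite (nualg_morphism0 pm) nucomm0 numul0r numulr0.
- move=> a b /central_eltP ca /central_eltP cb; apply/central_eltP => phi pm x w Lw.
  have [a1 a2] := ca phi pm x w Lw; have [b1 b2] := cb phi pm x w Lw.
  by rewrite (nualg_morphismD pm) nucommDl numulDl numulDr a1 a2 b1 b2 addr0.
- move=> c a /central_eltP ca; apply/central_eltP => phi pm x w Lw.
  have [a1 a2] := ca phi pm x w Lw.
  by rewrite (nualg_morphismZ pm) nucommZl numulZl numulZr a1 a2 scaler0.
Qed.

HB.instance Definition _ :=
  GRing.isSubmodClosed.Build F R central_eltb central_elt_submod.

Record central : predArgType := Central { central_val :> R; _ : central_val \in central_eltb }.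
HB.instance Definition _ := [isSub for central_val].
HB.instance Definition _ := [Choice of central by <:].
HB.instance Definition _ := [SubChoice_isSubLmodule of central by <:].

Lemma nucommM (x y z : R) : nucomm (x ** y) z = x ** nucomm y z + nucomm x z ** y.
Proof.
by rewrite /nucomm numulBr numulBl !numulA addrA subrK.
Qed.

Lemma gen_mull x w : nuideal_gen S w -> nuideal_gen S (x ** w).
Proof. by move=> Lw; have [_ _ _ h] := nuideal_genP S; case: (h x _ Lw). Qed.

Lemma gen_mulr x w : nuideal_gen S w -> nuideal_gen S (w ** x).
Proof. by move=> Lw; have [_ _ _ h] := nuideal_genP S; case: (h x _ Lw). Qed.

Lemma central_mul_proof (a b : central) : val a ** val b \in central_eltb.
Proof.
have /central_eltP ca := valP a; have /central_eltP cb := valP b.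
apply/central_eltP => phi pm x w Lw.
have [a1 _] := ca phi pm x _ (gen_mull (phi (val b)) Lw).
have [_ a2] := ca phi pm x w Lw; have [b1 _] := cb phi pm x w Lw.
have [_ b2] := cb phi pm x _ (gen_mulr (phi (val a)) Lw).
rewrite (nualg_morphismM pm) nucommM (numulDl _ _ w) (numulDr w); split.
  by rewrite -!numulA b1 a1 numulr0 addr0.
by rewrite !numulA b2 a2 numul0r addr0.
Qed.

Definition central_mul (a b : central) : central := Central (central_mul_proof a b).

Lemma central_mulA : associative central_mul.
Proof. by move=> a b c; apply: val_inj; rewrite /= numulA. Qed.
Lemma central_mulDl : left_distributive central_mul +%R.
Proof. by move=> a b c; apply: val_inj; rewrite /= numulDl. Qed.
Lemma central_mulDr : right_distributive central_mul +%R.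
Proof. by move=> a b c; apply: val_inj; rewrite /= numulDr. Qed.
Lemma central_mulZl (c : F) (a b : central) : central_mul (c *: a) b = c *: central_mul a b.
Proof. by apply: val_inj; rewrite /= numulZl. Qed.
Lemma central_mulZr (c : F) (a b : central) : central_mul a (c *: b) = c *: central_mul a b.
Proof. by apply: val_inj; rewrite /= numulZr. Qed.

HB.instance Definition _ := Lmodule_isNUAlgebra.Build F central
  central_mulA central_mulDl central_mulDr central_mulZl central_mulZr.

Lemma central_val_morphism : nualg_morphism (central_val : central -> R).
Proof. by []. Qed.

Lemma comm_lact (a : central) x w : nuideal_gen S w -> (a : R) ** x ** w = x ** a ** w.
Proof.
move=> Lw; have /central_eltP ca := valP a.
have [a1 _] := ca id (nualg_morphism_id R) x w Lw.
by apply/eqP; rewrite -subr_eq0 -numulBl; apply/eqP.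
Qed.

Lemma comm_ract (a : central) x w : nuideal_gen S w -> w ** (a : R) ** x = w ** x ** a.
Proof.
move=> Lw; have /central_eltP ca := valP a.
have [_ a1] := ca id (nualg_morphism_id R) x w Lw.
by apply/eqP; rewrite -subr_eq0 -!numulA -numulBr; apply/eqP.
Qed.

Lemma is_cend_lact (a : central) : is_cend (@lact F R S a).
Proof.
split; last by move=> g [_ gl _] w; rewrite gl.
split; first exact: lact_linear.
  by move=> x w; apply: val_inj; rewrite /= !numulA comm_lact //; apply: ideal_ofP.
by move=> x w; apply: val_inj; rewrite /= numulA.
Qed.

Lemma is_cend_ract (a : central) : is_cend (@ract F R S a).
Proof.
split; last by move=> g [_ _ gr] w; rewrite gr.
split; first exact: ract_linear.
  by move=> x w; apply: val_inj; rewrite /= numulA.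
by move=> x w; apply: val_inj; rewrite /= comm_ract //; apply: ideal_ofP.
Qed.

Variable nz : exists w : L, w != 0.
Notation E := (cendAlg nz).

Definition lE (a : central) : E := mk_cend (is_cend_lact a).
Definition rE (a : central) : E := mk_cend (is_cend_ract a).

Lemma lE_alg : alg_map lE.
Proof.
split=> [c a b|a b]; apply: cend_ext => w; apply: val_inj.
  by rewrite cendDE cendZE /= numulDl numulZl.
by rewrite cendME /= numulA.
Qed.

Lemma rE_alg : alg_map rE.
Proof.
split=> [c a b|a b]; apply: cend_ext => w; apply: val_inj.
  by rewrite cendDE cendZE /= numulDr numulZr.
by rewrite cendME /= -comm_ract ?numulA //; apply: ideal_ofP.
Qed.

(** Equivariance: an endomorphism applied to the tuple and to the argument is applied to the value.
    It makes the ideal of values stable under endomorphisms. The primed variables avoid choosing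
    induced maps on [central] and [ideal_of]. *)
Definition nat_famE (I : Type) (X : (I -> central) -> E) : Prop :=
  forall phi, endo phi -> forall a a', (forall i, val (a' i) = phi (val (a i))) ->
  forall w w' : L, val w' = phi (val w) ->
    val ((X a' : cend nz) w') = phi (val ((X a : cend nz) w)).

End CentralElements.

Lemma free_evalD (F : fieldType) (B : nualgType F) (rho : nat -> B) f g :
  free_eval rho (f + g) = free_eval rho f + free_eval rho g.
Proof. exact: linearD. Qed.

Lemma free_evalZ (F : fieldType) (B : nualgType F) (rho : nat -> B) c f :
  free_eval rho (c *: f) = c *: free_eval rho f.
Proof. exact: linearZ. Qed.

Lemma free_eval0 (F : fieldType) (B : nualgType F) (rho : nat -> B) :
  free_eval rho 0 = 0.
Proof. exact: linear0. Qed.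

Lemma nualg_morphism_ideal (F : fieldType) (R : nualgType F) (S : R -> Prop) (phi : R -> R) :
  nualg_morphism phi -> (forall x, S x -> S (phi x)) ->
  forall x, nuideal_gen S x -> nuideal_gen S (phi x).
Proof.
move=> pm Sphi x Lx; have [g0 gD gZ gM] := nuideal_genP S.
apply: (Lx (fun x => nuideal_gen S (phi x))); last first.
  by move=> s Ss I idI; apply; apply: Sphi.
split=> [|y z Ly Lz|c y Ly|y z Lz].
- by rewrite (nualg_morphism0 pm).
- by rewrite (nualg_morphismD pm); apply: gD.
- by rewrite (nualg_morphismZ pm); apply: gZ.
- by rewrite !(nualg_morphismM pm); apply: gM.
Qed.

(** * Primeness of equivariant families, and evaluation at triangular matrices *)

Section Relative.
Variables (F : fieldType) (R : nualgType F).
Notation endo := (@nualg_morphism F R R).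

Definition critical : Prop := forall I : R -> Prop, nuideal I ->
  (forall phi, endo phi -> forall x, I x -> I (phi x)) ->
  (exists2 x, I x & x <> 0) -> exists M, forall x, gam M x -> I x.

Definition nonnilpotent : Prop := forall M, exists2 x : R, gam M x & x <> 0.

Hypotheses (crit : critical) (nn : nonnilpotent).

Variables (S : R -> Prop).
Hypothesis Sinv : forall phi, endo phi -> forall x, S x -> S (phi x).
Hypothesis L2 : forall u v : R, nuideal_gen S u -> nuideal_gen S v -> u ** v = 0.
Notation L := (ideal_of S).
Variable nz : exists w : L, w != 0.
Notation E := (cendAlg nz).
Notation A := (central S).

Lemma endo_ideal phi : endo phi -> forall w : L, exists w' : L, val w' = phi (val w).
Proof.
move=> pm w; have h : phi (val w) \in nuideal_genb S.
  apply/nuideal_genbP; apply: (nualg_morphism_ideal pm); [exact: Sinv|exact: ideal_ofP].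
by exists (IdealOf h).
Qed.

Lemma endo_central phi : endo phi -> forall a : A, exists a' : A, val a' = phi (val a).
Proof.
move=> pm a; have h : phi (val a) \in central_eltb S.
  apply/central_eltP => psi qm x w Lw; have /central_eltP ca := valP a.
  exact: (ca _ (nualg_morphism_comp pm qm)).
by exists (Central h).
Qed.

Section Image.
Variables (I : Type) (X : (I -> A) -> E).
Hypothesis nX : nat_famE X.

(** Sums of values already form an ideal, since X a is a bimodule map. *)
Inductive image_ideal : R -> Prop :=
| image_gen a (w : L) : image_ideal (val ((X a : cend nz) w))
| image_0 : image_ideal 0
| image_D x y : image_ideal x -> image_ideal y -> image_ideal (x + y).

Lemma image_endo phi : endo phi -> forall x, image_ideal x -> image_ideal (phi x).
Proof.
move=> pm x; elim=> [a w||y z _ IHy _ IHz].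
- have [w' w'E] := endo_ideal pm w.
  have [a' a'E] := choice (fun i => endo_central pm (a i)).
  rewrite -(nX pm a'E w'E); exact: image_gen.
- by rewrite (nualg_morphism0 pm); apply: image_0.
- by rewrite (nualg_morphismD pm); apply: image_D.
Qed.

Lemma image_nuideal : nuideal image_ideal.
Proof.
split; first exact: image_0; first exact: image_D.
  move=> c x; elim=> [a w||y z _ IHy _ IHz].
  - rewrite -[c *: _]/(val (c *: ((X a : cend nz) w))) -cendZ; exact: image_gen.
  - by rewrite scaler0; apply: image_0.
  - by rewrite scalerDr; apply: image_D.
move=> x y; elim=> [a w||z t _ [IHz1 IHz2] _ [IHt1 IHt2]].
- have [[_ hl hr] _] := cendP (X a : cend nz); split.
    rewrite -[x ** _]/(val (lact x ((X a : cend nz) w))) -hl; exact: image_gen.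
  rewrite -[_ ** x]/(val (ract x ((X a : cend nz) w))) -hr; exact: image_gen.
- by rewrite numulr0 numul0r; split; apply: image_0.
- by rewrite numulDr numulDl; split; apply: image_D.
Qed.

Lemma image_gam : (exists a, X a <> 0) -> exists M, forall x, gam M x -> image_ideal x.
Proof.
move=> [a Xa]; apply: crit; first exact: image_nuideal; first exact: image_endo.
apply: contrapT => h; apply: Xa; apply: cend_ext => w; apply: val_inj.
apply: contrapT => hw; apply: h; exists (val ((X a : cend nz) w)) => //.
exact: image_gen.
Qed.

Lemma image_annihilated (Y : E) : (forall a, Y * X a = 0) ->
  forall w : L, image_ideal (val w) -> (Y : cend nz) w = 0.
Proof.
move=> YX w; move e : (val w) => x h; elim: h w e => [a v w e||y z hy IHy hz IHz w e].
- have -> : w = (X a : cend nz) v by apply: val_inj.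
  by rewrite -cendME YX.
- by move=> w e; rewrite (_ : w = 0) ?cend_0 //; apply: val_inj.
- have sub u : image_ideal u -> u \in nuideal_genb S.
    elim=> [a v||u1 u2 _ h1 _ h2]; first exact: valP; first exact: rpred0.
    exact: rpredD.
  rewrite (_ : w = IdealOf (sub y hy) + IdealOf (sub z hz)); last exact: val_inj.
  by rewrite cendD IHy // IHz // addr0.
Qed.
End Image.

(** If neither family is zero, the image of X contains [gam M] and that of Y contains [gam N]. An
    element of [gam (N + M)] is an iterated commutator of a sum of values Y b w; the bimodule map Y
    b lets the commutator pass to w, which thereby enters the image of X and is annihilated by Y b.
    So [gam (N + M)] would be zero. *)
Lemma nat_famE_prime I J (X : (I -> A) -> E) (Y : (J -> A) -> E) : nat_famE X -> nat_famE Y ->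
  (forall a b, X a * Y b = 0) -> (forall a, X a = 0) \/ (forall b, Y b = 0).
Proof.
move=> nX nY XY; have [X0|nX0] := pselect (forall a, X a = 0); first by left.
have [Y0|nY0] := pselect (forall a, Y a = 0); [by right | exfalso].
have ex K (Z : (K -> A) -> E) : ~ (forall a, Z a = 0) -> exists a, Z a <> 0.
  by move=> h; apply: contrapT => h'; apply: h => a; apply: contrapT => h; apply: h'; exists a.
have [M hM] := image_gam nX (ex _ _ nX0); have [N hN] := image_gam nY (ex _ _ nY0).
have [x gx x0] := nn (N + M); apply: x0.
have [y [xs [gy sx ->]]] := gam_split gx.
have key (w : L) : exists2 w' : L, val w' = iter_comm xs (val w) & gam M (val w').
  have iterL (u : R) ys : nuideal_gen S u -> nuideal_gen S (iter_comm ys u).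
    elim: ys u => //= t ys IH u Lu; apply: IH; have [_ gD gZ _] := nuideal_genP S.
    rewrite /nucomm -scaleN1r; apply: gD; first exact: gen_mulr.
    by apply: gZ; apply: gen_mull.
  have h : iter_comm xs (val w) \in nuideal_genb S.
    by apply/nuideal_genbP; apply: iterL; apply: ideal_ofP.
  by exists (IdealOf h) => //=; rewrite -sx -[size xs]add0n; apply: gam_iter.
have comm b (w w' : L) : val w' = iter_comm xs (val w) ->
    val ((Y b : cend nz) w') = iter_comm xs (val ((Y b : cend nz) w)).
  elim: xs w w' {sx key gx} => [|t xs IH] w w' /= e.
    by congr (val (cend_fun _ _)); apply: val_inj.
  rewrite (IH (ract t w - lact t w) _ e) //.
  have [[_ hl hr] _] := cendP (Y b : cend nz).
  congr iter_comm; rewrite -scaleN1r cendD cendZ hl hr.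
  by rewrite scaleN1r.
have := hN y gy; elim=> [b w||y1 y2 _ h1 _ h2].
- have [w' w'E gw'] := key w; rewrite -(comm b w w' w'E).
  rewrite (image_annihilated (X := X) (Y := Y b)) //; last exact: hM.
  by move=> a; rewrite mulrC.
- exact: iter_comm0.
- by rewrite iter_commD h1 h2 addr0.
Qed.

Lemma nat_famE_natural : natural_family (lE nz) (rE nz) (@nat_famE F R S nz).
Proof.
split.
- by move=> I i phi pm a a' aE w w' wE /=; rewrite (nualg_morphismM pm) wE -aE.
- by move=> I i phi pm a a' aE w w' wE /=; rewrite (nualg_morphismM pm) wE -aE.
- move=> I c X nX phi pm a a' aE w w' wE.
  rewrite [LHS]/= [in RHS]/= (nualg_morphismZ pm); congr (_ *: _); exact: nX.
- by move=> I phi pm a a' aE w w' wE.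
- move=> I X Y nX nY phi pm a a' aE w w' wE.
  rewrite [LHS]/= [in RHS]/= (nualg_morphismD pm); congr (_ + _); [exact: nX|exact: nY].
- move=> I X Y nX nY phi pm a a' aE w w' wE.
  by apply: nX => //; apply: nY.
- move=> I J h X nX phi pm a a' aE w w' wE; apply: nX => // i; exact: aE.
- move=> I J X Y; exact: nat_famE_prime.
Qed.

(** The k-th variable is evaluated at a k + e k w. Since products of two elements of L vanish, the
    value of a polynomial is its value at a plus the corner of the triangular matrix applied to
    w. *)
Lemma identity_triangular f : satisfies R f -> forall (a : nat -> A) (e : nat -> E),
  free_eval (fun k => (lE nz (a k), e k, rE nz (a k)) : Trialg E) f = 0.
Proof.
move=> Rf a e.
set tau := (tau in free_eval tau f); pose rho (w : L) k := val (a k) + val ((e k : cend nz) w).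
have key g : let t := free_eval tau g in let c := free_eval a g in
    [/\ t.1.1 = lE nz c, t.2 = rE nz c &
      forall w, free_eval (rho w) g = val c + val ((t.1.2 : cend nz) w)].
  elim/free_nualg_ind: g => [i||g h|k g|g h]; cbn zeta.
  - by rewrite !free_eval_var; split=> // w; rewrite free_eval_var.
  - rewrite !free_eval0 (alg_map0 (lE_alg nz)) (alg_map0 (rE_alg nz)); split=> // w.
    by rewrite free_eval0 addr0.
  - rewrite !free_evalD; move: (free_eval tau g) (free_eval tau h) => [[x1 x2] x3] [[y1 y2] y3].
    move=> []; cbn [fst snd] => -> -> hg []; cbn [fst snd] => -> -> hh.
    rewrite Tri_addE (alg_mapD (lE_alg nz)) (alg_mapD (rE_alg nz)); split=> // w.
    by rewrite free_evalD /= hg hh addrACA.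
  - rewrite !free_evalZ; case: (free_eval tau g) => [[x1 x2] x3] []; cbn [fst snd] => -> -> hg.
    rewrite Tri_scaleE (alg_mapZ (lE_alg nz)) (alg_mapZ (rE_alg nz)); split=> // w.
    by rewrite free_evalZ /= hg scalerDr.
  - rewrite !free_evalM; move: (free_eval tau g) (free_eval tau h) => [[x1 x2] x3] [[y1 y2] y3].
    move=> []; cbn [fst snd] => -> -> hg []; cbn [fst snd] => -> -> hh.
    rewrite Tri_mulE (lE_alg nz).2 (rE_alg nz).2; split=> // w.
    rewrite free_evalM hg hh numulDl !numulDr.
    rewrite (L2 (ideal_ofP ((x2 : cend nz) w)) (ideal_ofP ((y2 : cend nz) w))) addr0.
    rewrite -addrA; congr (_ + (_ + _)).
    have [[_ _ hr] _] := cendP (x2 : cend nz).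
    by rewrite -[RHS]/(val ((x2 : cend nz) (ract (val (free_eval a h)) w))) hr.
have fa0 : free_eval a f = 0.
  apply: val_inj; exact: (etrans (nualg_morphism_free_eval a f (central_val_morphism S)) (Rf _)).
have := key f; cbn zeta; rewrite fa0 (alg_map0 (lE_alg nz)) (alg_map0 (rE_alg nz)).
move: (free_eval tau f) => [[x1 x2] x3] []; cbn [fst snd] => -> -> hf.
congr (_, _, _); apply: cend_ext => w; apply: val_inj.
by have := hf w; rewrite Rf add0r.
Qed.

End Relative.

(** * The descent when the two actions agree *)

Section Core.
Variables (F : finFieldType) (R : nualgType F) (T : free_nualg F -> Prop).
Notation endo := (@nualg_morphism F R R).
Hypotheses (crit : critical R) (nn : nonnilpotent R).
Hypothesis RT : forall f, T f -> satisfies R f.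
Hypothesis not5 : ~ one_of_five (fun B => forall f, T f -> satisfies B f).

Section OneIdeal.
Variable m : nat.
Notation L := (nuideal_gen (@gam F R m)).
Hypothesis L2 : forall u v, L u -> L v -> u ** v = 0.

(** Otherwise the maps l and r differ at a, and the dichotomy yields one of the five algebras. *)
Lemma central_commutes a w : central_elt (@gam F R m) a -> L w -> a ** w = w ** a.
Proof.
move=> ca Lw; apply: contrapT => aw; apply: not5.
have nz : exists w : ideal_of (@gam F R m), w != 0.
  have wL : w \in nuideal_genb (@gam F R m) by apply/nuideal_genbP.
  exists (IdealOf wL); apply/eqP => /(congr1 val) /= w0; apply: aw.
  by rewrite w0 numulr0 numul0r.
have inv phi : endo phi -> forall x, gam m x -> gam m (phi x).
  by move=> pm x; apply: gam_morph.
apply: (@abstract_dichotomy F _ _ _ _ _ (lE_alg nz) (rE_alg nz)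
  (nat_famE_natural crit nn inv nz)).
  by move=> f Tf b e; apply: identity_triangular => //; apply: RT.
have aC : a \in central_eltb (@gam F R m) by apply/central_eltP.
exists (Central aC) => e; apply: aw.
have wL : w \in nuideal_genb (@gam F R m) by apply/nuideal_genbP.
by have /(congr1 val) := congr1 (fun f : cend nz => f (IdealOf wL)) e.
Qed.
End OneIdeal.

(** The descent lowers c at the cost of raising m; [gam 0] is all of R. *)
Definition annihilates c m : Prop := forall g w, gam c g -> nuideal_gen (@gam F R m) w ->
  g ** w = 0 /\ w ** g = 0.

Lemma gen_gam_le j k : (j <= k)%N -> forall x : R, nuideal_gen (gam k) x -> nuideal_gen (gam j) x.
Proof.
move=> jk x Lx I idI gI; apply: Lx => // s gs; apply: gI; exact: gam_le gs.
Qed.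

Lemma gam_gen k (x : R) : gam k x -> nuideal_gen (gam k) x.
Proof. by move=> gx I _; apply. Qed.

(* From [x, t y] central on L for all t one gets
   [x, t] [y, [s, w]] = 0. *)
Lemma annihilates_step c m :
  (forall u v : R, nuideal_gen (gam m) u -> nuideal_gen (gam m) v -> u ** v = 0) ->
  annihilates c.+1 m -> exists m', annihilates c m'.
Proof.
move=> L2 ann; exists m.+2; set L := nuideal_gen (@gam F R m) in L2.
have Zc z : gam c z -> central_elt (@gam F R m) z.
  move=> gz phi pm x w Lw; apply: ann => //; exists (phi z), x; split=> //.
  exact: gam_morph.
have comm z w : gam c z -> L w -> z ** w = w ** z.
  by move=> /Zc cz; apply: central_commutes.
have lm (x w : R) : L w -> L (x ** w) by apply: gen_mull.
have rm (x w : R) : L w -> L (w ** x) by apply: gen_mulr.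
have lmc (x w : R) : L w -> L (nucomm x w).
  move=> Lw; rewrite /nucomm -scaleN1r; have [_ gD gZ _] := nuideal_genP (@gam F R m).
  by apply: gD; [exact: lm|apply: gZ; exact: rm].
have swap z x w : gam c z -> L w -> z ** x ** w = x ** z ** w.
  move=> gz Lw; have [h _] := Zc z gz id (nualg_morphism_id R) x w Lw.
  by apply/eqP; rewrite -subr_eq0 -numulBl; apply/eqP.
have kill (z g : R) : gam c z -> gam m.+2 g -> z ** g = 0.
  (* For c = 0 all of R commutes with L, so g, a commutator of an element of L, is zero. For c > 0,
     z is a value of the derivation Z = [x, -], all of whose values commute with L. *)
  case: c ann Zc comm swap => [|c] ann Zc comm swap; last first.
    move=> [x [t [gx ->]]] [_ [y [[w [s [gw ->]]] ->]]].
    have Lw : L w by apply: gam_gen.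
    pose Z u := nucomm x u.
    have gZ u : gam c.+1 (Z u) by exists x, u.
    have ZM u y' : Z (u ** y') = Z u ** y' + u ** Z y'.
      by rewrite /Z /nucomm numulBl numulBr !numulA addrA subrK.
    rewrite -/(Z t); clearbody Z.
    (* From the commutation of Z (u v) with w' and the Leibniz rule for Z. *)
    have rule u v w' : L w' -> Z u ** nucomm v w' = - (Z v ** nucomm u w').
      move=> Lw'; have := comm _ _ (gZ (u ** v)) Lw'; rewrite ZM numulDl numulDr => e.
      apply/eqP; rewrite -addr_eq0 /nucomm !numulBr !numulA.
      rewrite -(swap _ _ _ (gZ v) Lw') !numulA in e.
      rewrite (comm _ _ (gZ u) Lw') -[Z v ** w' ** u]numulA.
      by rewrite (comm _ _ (gZ v) (rm u _ Lw')) addrACA e -opprD subrr.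
    have nN (u v : R) : nucomm u v = - nucomm v u by rewrite /nucomm opprB.
    rewrite (nN w s) [nucomm (- _) _]/nucomm numulNr numulrN opprK addrC (numulBr (Z t)).
    (* Z (t y) [s, w] is computed by the Leibniz rule and by [rule]; the terms t (Z s) [y, w]
       cancel, which leaves (Z t) y [s, w] = (Z t) [s, w] y. *)
    have := rule (t ** y) s w Lw.
    rewrite ZM (numulDl _ _ (nucomm s w)) nucommM (numulDr (Z s)) opprD -(numulA t).
    rewrite (rule y s w Lw) numulrN !numulA (swap _ _ _ (gZ s) (lmc y w Lw)) addrC.
    by move/addrI => ->; rewrite -numulNr -rule // addNr.
  move=> _ [y [t [/gamS/gam_gen Ly ->]]].
  by rewrite /nucomm (comm t y) // subrr numulr0.
move=> z w gz Lw; have [Lw' zw] : L w /\ z ** w = 0; last by split=> //; rewrite -(comm z w).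
split; first by apply: gen_gam_le Lw; rewrite -addn2 leq_addr.
have [g0 gD gZ _] := nuideal_genP (@gam F R m).
apply: (proj2 (Lw (fun w => L w /\ z ** w = 0) _ _)); last first.
  move=> s gs; split; last exact: kill.
  apply: gam_gen; apply: gam_le gs; exact: leqW.
split.
- by rewrite numulr0.
- by move=> u v [Lu zu] [Lv zv]; rewrite numulDr zu zv addr0; split=> //; apply: gD.
- by move=> k u [Lu zu]; rewrite numulZr zu scaler0; split=> //; apply: gZ.
- move=> x u [Lu zu]; rewrite !numulA swap // zu numul0r -numulA zu numulr0.
  by do 2 split=> //; [exact: lm|exact: rm].
Qed.

Theorem no_square_zero_ideal :
  ~ (exists n, forall u v : R, nuideal_gen (gam n) u -> nuideal_gen (gam n) v -> u ** v = 0).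
Proof.
move=> [n L2].
have mono c m m' : (m <= m')%N -> annihilates c m -> annihilates c m'.
  by move=> mm ann g w gc Lw; apply: ann => //; apply: gen_gam_le Lw.
have : exists m, annihilates n m by exists n => g w /gam_gen Lg Lw; split; apply: L2.
have desc c : (exists m, annihilates c m) -> exists m, annihilates 0 m.
  elim: c => // c IH [m ann]; apply: IH.
  apply: (@annihilates_step c (maxn n m)); last by apply: mono ann; apply: leq_maxr.
  have nm := leq_maxl n m.
  by move=> u v Lu Lv; apply: L2; [apply: gen_gam_le Lu|apply: gen_gam_le Lv].
(* At c = 0, R annihilates the ideal generated by [gam m], so all of [gam m.+1] is zero. *)
move/desc => [m ann]; have [_ [y [z [/gam_gen Ly ->]]]] := nn m.+1; apply.
by have [zy yz] := ann z y I Ly; rewrite /nucomm zy yz subrr.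
Qed.

End Core.

(** * Relatively free algebras *)

Section QuotientFacts.
Variables (F : fieldType) (A : nualgType F) (S : A -> Prop).

Lemma nuquot_pi_morphism : nualg_morphism (@nuquot_pi F A S).
Proof.
split=> [c x y|x y]; first by rewrite nuquot_piD nuquot_piZ.
by rewrite -nuquot_mulE.
Qed.

Lemma nuquot_pi_eq0 x : nuquot_pi S x = 0 <-> nuideal_gen S x.
Proof.
rewrite -(nualg_morphism0 nuquot_pi_morphism).
split=> [/nuquotP|h]; last apply/nuquotP.
  by rewrite subr0 => /nuideal_genbP.
by rewrite subr0; apply/nuideal_genbP.
Qed.

Lemma nuideal_gen_id : nuideal S -> forall x, nuideal_gen S x <-> S x.
Proof. by move=> idS x; split=> [/(_ _ idS)|Sx I _]; apply. Qed.

Lemma free_eval_nuquot (rho : nat -> nuquot S) f :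
  free_eval rho f = nuquot_pi S (free_eval (fun i => nuquot_repr (rho i)) f).
Proof.
rewrite (nualg_morphism_free_eval _ _ nuquot_pi_morphism).
by congr free_eval; apply/funext => i; rewrite /= nuquot_reprK.
Qed.
End QuotientFacts.

Section LieWords.
Variables (F : fieldType) (A : nualgType F).

Lemma free_eval_comm (rho : nat -> A) f g :
  free_eval rho (nucomm f g) = nucomm (free_eval rho f) (free_eval rho g).
Proof. by rewrite /nucomm linearB /= !free_evalM. Qed.

Lemma lie_word_gam (rho : nat -> A) m : gam m.+1 (free_eval rho (lie_word F m)).
Proof.
elim: m => [|m IH]; rewrite free_eval_comm.
  by exists (free_eval rho (free_var F 0)), (free_eval rho (free_var F 1)).
by exists (free_eval rho (lie_word F m)), (free_eval rho (free_var F m.+2)).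
Qed.

Lemma lie_word_ext (rho tau : nat -> A) m : (forall i, (i < m.+2)%N -> rho i = tau i) ->
  free_eval rho (lie_word F m) = free_eval tau (lie_word F m).
Proof.
elim: m => [|m IH] e; rewrite !free_eval_comm !free_eval_var e //; first by rewrite e.
by rewrite IH // => i im; apply: e; apply: ltnW.
Qed.

Lemma gam_lie_word m (x : A) : gam m.+1 x -> exists rho, x = free_eval rho (lie_word F m).
Proof.
elim: m x => [|m IH] x.
  move=> [y [z [_ ->]]]; exists (fun i => if i == 0%N then y else z).
  by rewrite free_eval_comm !free_eval_var.
move=> [y [z [/IH[rho ->] ->]]]; exists (fun i => if (i < m.+2)%N then rho i else z).
rewrite free_eval_comm free_eval_var ltnn; congr nucomm.
by apply: lie_word_ext => i ->.
Qed.

Lemma satisfies_lie_word m : satisfies A (lie_word F m) <-> forall x : A, gam m.+1 x -> x = 0.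
Proof.
split=> [h x /gam_lie_word[rho ->]|h rho]; first exact: h.
by apply: h; apply: lie_word_gam.
Qed.
End LieWords.

Section TIdeals.
Variable F : fieldType.
Notation FX := (free_nualg F).
Implicit Types (V W : nualgType F -> Prop) (T : FX -> Prop).

Definition models T (A : nualgType F) : Prop := forall f, T f -> satisfies A f.

Lemma models_variety T : is_variety (models T).
Proof. by exists T. Qed.

Lemma variety_models V : is_variety V -> forall A, V A <-> models (identities V) A.
Proof.
move=> [S VS] A; split=> [VA f|h]; first exact.
by apply/VS => f Sf; apply: h => B /VS; apply.
Qed.

Lemma satisfies_morphism (A : nualgType F) (phi : FX -> FX) f : nualg_morphism phi ->
  satisfies A f -> satisfies A (phi f).
Proof.
move=> pm Af rho.
rewrite -[f]free_eval_id (nualg_morphism_free_eval _ _ pm).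
by rewrite (nualg_morphism_free_eval _ _ (free_eval_morphism rho)).
Qed.

Lemma identities_T_ideal V : T_ideal (identities V).
Proof.
split=> [|phi pm f Vf A /Vf]; last exact: satisfies_morphism.
split.
- by move=> A _ rho; rewrite linear0.
- by move=> f g Vf Vg A VA rho; rewrite linearD /= Vf // Vg // addr0.
- by move=> c f Vf A VA rho; rewrite linearZ /= Vf // scaler0.
- by move=> f g Vg; split=> A VA rho; rewrite free_evalM Vg // ?numulr0 ?numul0r.
Qed.

Section RelativelyFree.
Variable T : FX -> Prop.
Hypothesis tT : T_ideal T.
Notation R := (nuquot T).
Notation pi := (@nuquot_pi F FX T).

Lemma relfree_eq0 f : pi f = 0 <-> T f.
Proof. by rewrite nuquot_pi_eq0 nuideal_gen_id //; case: tT. Qed.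

Lemma relfree_models : models T R.
Proof.
move=> f Tf rho; rewrite free_eval_nuquot; apply/relfree_eq0.
by have [_ tphi] := tT; apply: tphi => //; apply: free_eval_morphism.
Qed.

Lemma relfree_eval f : free_eval (fun i => pi (free_var F i)) f = pi f.
Proof.
by rewrite -[in RHS](free_eval_id f) (nualg_morphism_free_eval _ _ (nuquot_pi_morphism T)).
Qed.

Lemma relfree_satisfies f : satisfies R f -> T f.
Proof. by move=> /(_ (fun i => pi (free_var F i))); rewrite relfree_eval => /relfree_eq0. Qed.

Lemma relfree_lift (B : nualgType F) (rho : nat -> B) : models T B ->
  exists2 phi : R -> B, nualg_morphism phi & forall f, phi (pi f) = free_eval rho f.
Proof.
move=> TB; pose phi (x : R) := free_eval rho (nuquot_repr x).
have phipi f : phi (pi f) = free_eval rho f.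
  apply/eqP; rewrite -subr_eq0 -linearB /=; apply/eqP.
  apply: TB; apply/relfree_eq0; apply/nuquot_pi_eq0.
  by apply/nuideal_genbP; apply: nuquot_piB.
exists phi => //; have [pl pM] := nuquot_pi_morphism T.
split=> [c x y|x y]; rewrite -(nuquot_reprK x) -(nuquot_reprK y).
  by rewrite -pl !phipi linearP.
by rewrite -pM !phipi free_evalM.
Qed.

Lemma relfree_endo (phi : R -> R) : nualg_morphism phi ->
  exists2 psi, nualg_morphism psi & forall f, phi (pi f) = pi (psi f).
Proof.
move=> pm; pose tau i := nuquot_repr (phi (pi (free_var F i))).
exists (free_eval tau); first exact: free_eval_morphism.
move=> f; rewrite -{1}[f]free_eval_id.
rewrite (nualg_morphism_free_eval _ _ (nuquot_pi_morphism T)).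
rewrite (nualg_morphism_free_eval _ _ pm) (nualg_morphism_free_eval _ _ (nuquot_pi_morphism T)).
by congr free_eval; apply/funext => i; rewrite /= /tau nuquot_reprK.
Qed.
End RelativelyFree.
End TIdeals.

(** * The relatively free algebra of an almost Lie nilpotent variety *)

Section AlmostNilpotent.
Variables (F : finFieldType) (V : nualgType F -> Prop).
Notation FX := (free_nualg F).
Hypotheses (V_variety : is_variety V) (V_aln : almost_lie_nilpotent V).
Notation T := (identities V).
Notation R := (nuquot T).
Notation pi := (@nuquot_pi F FX T).
Notation tT := (identities_T_ideal V).

Lemma relfree_variety : V R.
Proof. apply/(variety_models V_variety); apply: relfree_models; exact: tT. Qed.

Lemma relfree_nonnilpotent : nonnilpotent R.
Proof.
move=> M; apply: contrapT => h; have [nn _] := V_aln; apply: nn.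
exists M; apply: (relfree_satisfies tT); apply/satisfies_lie_word => x gx.
apply: contrapT => x0; apply: h; exists x => //; exact: gamS.
Qed.

(** The polynomials with image in I define a proper subvariety, which is Lie nilpotent. It contains
    R / I because I is stable under endomorphisms, so some Lie word vanishes in R / I. *)
Lemma relfree_critical : critical R.
Proof.
move=> I idI invI [x Ix x0]; have [_ sub] := V_aln.
pose W := models (fun f => T f \/ I (pi f)).
have [|m Wm] := sub W.
  split; first split; first exact: models_variety.
    by move=> A WA; apply/(variety_models V_variety) => f Tf; apply: WA; left.
  move=> /(_ _ relfree_variety) WR; apply: x0; rewrite -(nuquot_reprK x).
  apply/(relfree_eq0 tT); apply: (relfree_satisfies tT).
  by apply: WR; right; rewrite nuquot_reprK.
exists m.+1 => y gy; apply/(nuideal_gen_id idI)/nuquot_pi_eq0.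
have [rho ->] := gam_lie_word gy.
rewrite (nualg_morphism_free_eval _ _ (nuquot_pi_morphism I)); apply: Wm => f Tf tau.
rewrite free_eval_nuquot; apply/nuquot_pi_eq0/(nuideal_gen_id idI).
have [phi pm <-] := relfree_lift tT (fun i => nuquot_repr (tau i)) (relfree_models tT).
apply: invI => //; case: Tf => // /(relfree_eq0 tT) ->; by have [] := idI.
Qed.

Lemma almost_nilpotent_five :
  (exists n, forall u v : R, nuideal_gen (gam n) u -> nuideal_gen (gam n) v -> u ** v = 0) ->
  one_of_five V.
Proof.
move=> L2; have [h|h] := pselect (one_of_five (models T)); last first.
  by have := no_square_zero_ideal relfree_critical relfree_nonnilpotent (relfree_models tT) h L2.
have VT B : models T B -> V B by have [] := variety_models V_variety B.
case: h => [/VT|[/VT|[/VT|[/VT|[G [s [us /VT h]]]]]]]; rewrite /one_of_five; try tauto.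
by do 4 right; exists G, s.
Qed.

Lemma relfree_image_ideal (K : FX -> Prop) : nuideal K ->
  nuideal (fun x : R => exists2 f, K f & pi f = x).
Proof.
move=> [K0 KD KZ KM]; have [_ piM] := nuquot_pi_morphism T.
split; first by exists 0 => //; apply/(nualg_morphism0 (nuquot_pi_morphism T)).
- by move=> _ _ [f Kf <-] [g Kg <-]; exists (f + g); [exact: KD|rewrite nuquot_piD].
- by move=> c _ [f Kf <-]; exists (c *: f); [exact: KZ|rewrite nuquot_piZ].
- move=> x _ [f Kf <-]; rewrite -(nuquot_reprK x) -!piM.
  have [K1 K2] := KM (nuquot_repr x) f Kf.
  by split; [exists (nuquot_repr x ** f)|exists (f ** nuquot_repr x)].
Qed.

(** The images in R of two T-ideals that refute primeness are nonzero and stable, so each contains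
    all commutators of some length; the larger length serves for both factors. *)
Lemma nonprime_square : ~ prime_variety V ->
  exists n, forall u v : R, nuideal_gen (gam n) u -> nuideal_gen (gam n) v -> u ** v = 0.
Proof.
move=> np.
have [I [J [tI tJ IJ nI nJ]]] : exists I J : FX -> Prop, [/\ T_ideal I, T_ideal J,
    forall f, nuideal_mul I J f -> T f, ~ (forall f, I f -> T f) & ~ (forall f, J f -> T f)].
  apply: contrapT => h; apply: np => I J tI tJ IJ.
  apply: contrapT => /not_orP[nI nJ]; apply: h; by exists I, J.
have gamI (K : FX -> Prop) : T_ideal K -> ~ (forall f, K f -> T f) ->
    exists M, forall x : R, gam M x -> exists2 f, K f & pi f = x.
  move=> [idK tK] nK.
  apply: relfree_critical.
  - exact: relfree_image_ideal.
  - move=> phi pm _ [f Kf <-]; have [psi psim ->] := relfree_endo pm.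
    by exists (psi f) => //; apply: tK.
  - apply: contrapT => h; apply: nK => f Kf; apply/(relfree_eq0 tT).
    by apply: contrapT => pf; apply: h; exists (pi f) => //; exists f.
have genI (K : FX -> Prop) M n : T_ideal K ->
    (forall x : R, gam M x -> exists2 f, K f & pi f = x) ->
    (M <= n)%N -> forall x : R, nuideal_gen (gam n) x -> exists2 f, K f & pi f = x.
  move=> [idK tK] hK Mn x.
  move=> /(_ (fun x => exists2 f, K f & pi f = x)); apply; last first.
    by move=> s gs; apply: hK; apply: gam_le gs.
  exact: relfree_image_ideal.
have [M hM] := gamI I tI nI; have [N hN] := gamI J tJ nJ.
exists (maxn M N) => u v Lu Lv.
have [f If <-] := genI I M _ tI hM (leq_maxl M N) u Lu.
have [g Jg <-] := genI J N _ tJ hN (leq_maxr M N) v Lv.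
rewrite -(nualg_morphismM (nuquot_pi_morphism T)); apply/(relfree_eq0 tT)/IJ.
exists 1%N, (fun=> f), (fun=> g); split=> //; by rewrite big_ord1.
Qed.

(** A subvariety that contains B is not Lie nilpotent, hence not proper. *)
Lemma almost_nilpotent_generated B : V B -> (forall m, ~ satisfies B (lie_word F m)) ->
  generated_by V B.
Proof.
move=> VB nB; split=> // W [S WS] WB A VA; apply: contrapT => nWA.
have [_ sub] := V_aln.
have [|m h] := sub (models (fun f => T f \/ S f)).
  split; last by move=> /(_ A VA) h; apply: nWA; apply/WS => f Sf; apply: h; right.
  split; first exact: models_variety.
  by move=> D h; apply/(variety_models V_variety) => f Tf; apply: h; left.
apply: (nB m); apply: h => f [Tf|Sf]; first exact: Tf.
by move/WS: WB; apply.
Qed.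
End AlmostNilpotent.

(* Zorn: a maximal T-ideal among those that avoid all the Lie words. *)
Lemma almost_nilpotent_exists (F : finFieldType) (W : nualgType F -> Prop) : is_variety W ->
  ~ lie_nilpotent W ->
  exists W0, [/\ is_variety W0, forall A, W0 A -> W A & almost_lie_nilpotent W0].
Proof.
move=> vW nW; pose FX := free_nualg F.
pose good (J : FX -> Prop) := [/\ T_ideal J, forall f, identities W f -> J f
  & forall m, ~ J (lie_word F m)].
have goodW : good (identities W).
  split=> // [|m Wm]; first exact: identities_T_ideal.
  by apply: nW; exists m.
have [J [[eJ|gJ] Jmax]] : exists J : set FX, (J = set0 \/ good J) /\
    forall K : set FX, (J `<` K)%classic -> ~ (K = set0 \/ good K).
  have [] := @Zorn_bigcup FX [set J : set FX | J = set0 \/ good J]; last first.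
    by move=> J [h1 h2]; exists J; split=> // K /h2.
  move=> Ch good_Ch tot.
  have [[J0 CJ0 gJ0]|ne] := pselect (exists2 J, Ch J & good J); last first.
    left; apply/seteqP; split=> // f [J CJ Jf]; case: (good_Ch J CJ) => [eJ|gJ].
      by rewrite eJ in Jf.
    by case: ne; exists J.
  have gd J f : Ch J -> J f -> good J.
    by move=> CJ Jf; case: (good_Ch J CJ) => // eJ; rewrite eJ in Jf.
  right; have [[[z0 _ _ _] _] sub0 _] := gJ0; split.
  - split; first split.
    + by exists J0.
    + move=> f g [J CJ Jf] [K CK Kg]; have [[[_ JD _ _] _] _ _] := gd _ _ CJ Jf.
      have [[[_ KD _ _] _] _ _] := gd _ _ CK Kg.
      have [JK|KJ] := tot J K CJ CK; first by exists K => //; apply: KD => //; apply: JK.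
      by exists J => //; apply: JD => //; apply: KJ.
    + move=> c f [J CJ Jf]; have [[[_ _ JZ _] _] _ _] := gd _ _ CJ Jf.
      by exists J => //; apply: JZ.
    + move=> f g [J CJ Jg]; have [[[_ _ _ JM] _] _ _] := gd _ _ CJ Jg.
      by have [h1 h2] := JM f g Jg; split; exists J.
    + move=> phi pm f [J CJ Jf]; have [[_ tJ] _ _] := gd _ _ CJ Jf.
      by exists J => //; apply: tJ.
  - by move=> f Wf; exists J0 => //; apply: sub0.
  - by move=> m [J CJ Jm]; have [_ _ nJ] := gd _ _ CJ Jm; apply: (nJ m).
- case: (Jmax (identities W)); last by right.
  rewrite eJ; split=> [f []|/(_ 0)]; apply.
  by have [[[z0 _ _ _] _] _ _] := goodW.
have [tJ WJ nJ] := gJ.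
exists (models J); split; first exact: models_variety.
  by move=> A JA; apply/(variety_models vW) => f /WJ; apply: JA.
split=> [[m h]|U [[vU UJ] nJU]].
  by apply: (nJ m); apply: (relfree_satisfies tJ); apply: h; apply: relfree_models.
apply: contrapT => nU; apply: (Jmax (identities U)); last first.
  right; split=> [|f Wf A UA|m Um]; first exact: identities_T_ideal.
    by apply: UJ => //; apply: WJ.
  by apply: nU; exists m.
split=> [f Jf A UA|JU]; first exact: UJ.
by apply: nJU => A JA; apply/(variety_models vU) => f Uf; apply: JA; apply: JU.
Qed.

(** * Comparison of the five algebras *)

Section Transfer.
Variables (F : fieldType) (B B' : nualgType F).

(* nupow x n is the (n + 1)-st power of x. *)
Fixpoint nupow (A : nualgType F) (x : A) n : A := if n is n'.+1 then x ** nupow x n' else x.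

Lemma free_eval_nupow (A : nualgType F) (rho : nat -> A) f n :
  free_eval rho (nupow f n) = nupow (free_eval rho f) n.
Proof. by elim: n => //= n IH; rewrite free_evalM IH. Qed.

(** Equivalently, B' lies in the variety generated by B. *)
Definition sat_incl : Prop := forall f : free_nualg F, satisfies B f -> satisfies B' f.
Hypothesis incl : sat_incl.
Local Notation "''x_' i" := (free_var F i) (at level 8, i at level 2, format "''x_' i").
Notation vals s := (fun i => nth 0 s i).

Lemma free_evalB (A : nualgType F) (rho : nat -> A) f g :
  free_eval rho (f - g) = free_eval rho f - free_eval rho g.
Proof. by rewrite linearB. Qed.

Let evalE := (free_evalM, free_evalB, free_eval_comm, free_eval_nupow, free_eval_var).

Lemma incl_comm_mulr : (forall x y z : B, nucomm x y ** z = 0) ->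
  forall x y z : B', nucomm x y ** z = 0.
Proof.
move=> h x y z; have := @incl (nucomm 'x_0 'x_1 ** 'x_2) _ (vals [:: x; y; z]).
by rewrite !evalE; apply=> rho; rewrite !evalE.
Qed.

Lemma incl_comm_mull : (forall x y z : B, z ** nucomm x y = 0) ->
  forall x y z : B', z ** nucomm x y = 0.
Proof.
move=> h x y z; have := @incl ('x_2 ** nucomm 'x_0 'x_1) _ (vals [:: x; y; z]).
by rewrite !evalE; apply=> rho; rewrite !evalE.
Qed.

Lemma incl_pow_eq n : (forall x y : B, nupow x n ** y = x ** y) ->
  forall x y : B', nupow x n ** y = x ** y.
Proof.
move=> h x y; have := @incl (nupow 'x_0 n ** 'x_1 - 'x_0 ** 'x_1) _ (vals [:: x; y]).
rewrite !evalE => e; apply/eqP; rewrite -subr_eq0; apply/eqP/e => rho.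
by rewrite !evalE h subrr.
Qed.

Lemma incl_pow0 n : (forall x y : B, nupow x n ** y = 0) ->
  forall x y : B', nupow x n ** y = 0.
Proof.
move=> h x y; have := @incl (nupow 'x_0 n ** 'x_1) _ (vals [:: x; y]).
by rewrite !evalE; apply=> rho; rewrite !evalE.
Qed.

Lemma incl_pow_sub n : (forall x y : B, (nupow x n - x) ** (nupow y n - y) = 0) ->
  forall x y : B', (nupow x n - x) ** (nupow y n - y) = 0.
Proof.
move=> h x y.
have := @incl ((nupow 'x_0 n - 'x_0) ** (nupow 'x_1 n - 'x_1)) _ (vals [:: x; y]).
by rewrite !evalE; apply=> rho; rewrite !evalE.
Qed.

(** For n + 1 = q^j this identity of B(F, G, sigma) records that sigma is the power q^j
    ([Balg_twist]). *)
Lemma incl_twist n : (forall x y z : B, nucomm x y ** z = nupow z n ** nucomm x y) ->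
  forall x y z : B', nucomm x y ** z = nupow z n ** nucomm x y.
Proof.
move=> h x y z; have := @incl (nucomm 'x_0 'x_1 ** 'x_2 - nupow 'x_2 n ** nucomm 'x_0 'x_1) _
  (vals [:: x; y; z]).
rewrite !evalE => e; apply/eqP; rewrite -subr_eq0; apply/eqP/e => rho.
by rewrite !evalE h subrr.
Qed.

(** Without a unit, s cannot be set to 1, and both forms enter the proof that the ideal generated by
    commutators squares to zero. *)
Definition comm_square0 (A : nualgType F) : Prop := forall x y s z t : A,
  nucomm x y ** nucomm z t = 0 /\ nucomm x y ** s ** nucomm z t = 0.

Lemma incl_comm_square0 : comm_square0 B -> comm_square0 B'.
Proof.
move=> h x y s z t; pose rho := vals [:: x; y; s; z; t]; split.
  have := @incl (nucomm 'x_0 'x_1 ** nucomm 'x_3 'x_4) _ rho.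
  by rewrite !evalE; apply=> tau; rewrite !evalE;
    case: (h (tau 0%N) (tau 1%N) 0 (tau 3%N) (tau 4%N)).
have := @incl (nucomm 'x_0 'x_1 ** 'x_2 ** nucomm 'x_3 'x_4) _ rho.
by rewrite !evalE; apply=> tau; rewrite !evalE;
  case: (h (tau 0%N) (tau 1%N) (tau 2%N) (tau 3%N) (tau 4%N)).
Qed.
End Transfer.

Lemma comm_square0_gen (F : fieldType) (R : nualgType F) : comm_square0 R ->
  forall u v : R, nuideal_gen (gam 1) u -> nuideal_gen (gam 1) v -> u ** v = 0.
Proof.
move=> h u v Lu.
have [h1 h2] : (forall z t, u ** nucomm z t = 0) /\ (forall s z t, u ** s ** nucomm z t = 0).
  move: Lu => /(_ (fun u => (forall z t, u ** nucomm z t = 0) /\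
    (forall s z t, u ** s ** nucomm z t = 0))); apply.
    split; first by split=> *; rewrite !numul0r.
    - by move=> a b [a1 a2] [b1 b2]; split=> *; rewrite !numulDl ?a1 ?a2 ?b1 ?b2 addr0.
    - by move=> c a [a1 a2]; split=> *; rewrite !numulZl ?a1 ?a2 scaler0.
    - move=> a b [b1 b2]; split; split=> *.
      + by rewrite -numulA b1 numulr0.
      + by rewrite -!numulA (numulA b) b2 numulr0.
      + exact: b2.
      + by rewrite -(numulA b) b2.
  by move=> _ [y [z [_ ->]]]; split=> [a b|s a b]; [case: (h y z 0 a b)|case: (h y z s a b)].
suff : nuideal_gen (gam 1) v -> u ** v = 0 /\ (forall s, u ** s ** v = 0).
  by move=> /[apply] -[].
move/(_ (fun v => u ** v = 0 /\ (forall s, u ** s ** v = 0))); apply; last first.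
  by move=> _ [y [z [_ ->]]].
split; first by split=> *; rewrite numulr0.
- by move=> a b [a1 a2] [b1 b2]; split=> *; rewrite numulDr ?a1 ?a2 ?b1 ?b2 addr0.
- by move=> c a [a1 a2]; split=> *; rewrite numulZr ?a1 ?a2 scaler0.
- move=> a b [b1 b2]; split; split=> *.
  + by rewrite numulA b2.
  + by rewrite numulA -(numulA u) b2.
  + by rewrite numulA b1 numul0r.
  + by rewrite numulA b2 numul0r.
Qed.

Section Opposites.
Variable F : fieldType.
Notation FX := (free_nualg F).

Definition reverse (f : FX) : FX := free_eval (free_var F : nat -> opposite FX) f.

Lemma free_eval_opposite (A : nualgType F) (rho : nat -> A) f :
  free_eval (rho : nat -> opposite A) f = free_eval rho (reverse f).
Proof.
have := nualg_morphism_free_eval (free_var F : nat -> opposite FX) f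
  (opposite_morphism (free_eval_morphism rho)).
move=> ->; congr (free_eval (_ : nat -> opposite A)); apply/funext => i /=.
by rewrite free_eval_var.
Qed.

Lemma reverseM f g : reverse (f ** g) = reverse g ** reverse f.
Proof. by rewrite /reverse free_evalM. Qed.

Lemma reverseK f : reverse (reverse f) = f.
Proof.
elim/free_nualg_ind: f => [i||f g IHf IHg|a f IH|f g IHf IHg].
- by rewrite /reverse !free_eval_var.
- by rewrite /reverse !free_eval0.
- by rewrite /reverse !free_evalD -/(reverse _) -/(reverse g) -!/(reverse _) IHf IHg.
- by rewrite /reverse !free_evalZ -!/(reverse _) IH.
- by rewrite !reverseM IHf IHg.
Qed.

Lemma satisfies_opposite (A : nualgType F) f : satisfies (opposite A) f <-> satisfies A (reverse f).
Proof. by split=> h rho; have := h rho; rewrite free_eval_opposite. Qed.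

Lemma sat_incl_opposite (B B' : nualgType F) : sat_incl (opposite B) (opposite B') -> sat_incl B B'.
Proof.
move=> incl f Bf; rewrite -[f]reverseK; apply/satisfies_opposite/incl/satisfies_opposite.
by rewrite reverseK.
Qed.
End Opposites.

Section CommutativeAalg.
Variables (F : fieldType) (U : nualgType F).
Hypothesis UC : forall x y : U, x ** y = y ** x.

Lemma Aalg_oppE (u v : U) : - ((u, v) : Aalg U) = (- u, - v).
Proof. by []. Qed.

Lemma Aalg_nucomm (x y : Aalg U) : nucomm x y = (0, x.1 ** y.2 - y.1 ** x.2).
Proof.
move: x y => [u v] [u' v']; rewrite /nucomm !Aalg_mulE Aalg_oppE Aalg_addE.
by rewrite UC subrr.
Qed.

Lemma Aalg_comm_mulr (x y z : Aalg U) : nucomm x y ** z = 0.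
Proof.
by rewrite Aalg_nucomm; case: z => u v; rewrite Aalg_mulE !numul0r.
Qed.

Lemma Aalg_nupow1 (x : Aalg U) n : (nupow x n).1 = nupow x.1 n.
Proof. by elim: n => //= n ->. Qed.

Lemma gam_Aalg k (u v : U) : gam k ((0, v) : Aalg U) -> gam k.+1 ((0, u ** v) : Aalg U).
Proof.
move=> gv; exists (0, v), (- u, 0); split=> //.
by rewrite Aalg_nucomm /= numul0r numulNr opprK add0r.
Qed.

Lemma opposite_nucomm (A : nualgType F) (x y : opposite A) :
  nucomm x y = nucomm (y : A) (x : A).
Proof. by []. Qed.

Lemma gam_opposite_Aalg k (u v : U) : gam k ((0, v) : opposite (Aalg U)) ->
  gam k.+1 ((0, u ** v) : opposite (Aalg U)).
Proof.
move=> gv; exists (0, v), (u, 0); split=> //.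
by rewrite opposite_nucomm Aalg_nucomm /= numul0r subr0.
Qed.
End CommutativeAalg.

Lemma not_nilpotent (F : fieldType) (B : nualgType F) :
  (forall k, exists2 x : B, gam k x & x <> 0) -> forall m, ~ satisfies B (lie_word F m).
Proof.
by move=> h m /satisfies_lie_word h0; have [x gx x0] := h m.+1; apply/x0/h0.
Qed.

(* gam 2 would vanish. *)
Lemma not_nilpotent_comm_mul (F : fieldType) (B : nualgType F) :
  (forall m, ~ satisfies B (lie_word F m)) ->
  (forall x y z : B, nucomm x y ** z = 0) -> (forall x y z : B, z ** nucomm x y = 0) -> False.
Proof.
move=> nB h1 h2; apply: (nB 1%N); apply/satisfies_lie_word => _ [_ [z [[x [y [_ ->]]] ->]]].
by rewrite {1}/nucomm h1 h2 subrr.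
Qed.

Section FieldAalg.
Variable F : finFieldType.
Notation U := (Falg F).

Lemma Falg_comm (x y : U) : x ** y = y ** x.
Proof. exact: (mulrC (x : F)). Qed.

Lemma gam_Aalg_F k : gam k ((0, 1 : F) : Aalg U) /\ gam k ((0, 1 : F) : opposite (Aalg U)).
Proof.
have e : (1 : F) = (1 : U) ** (1 : U) by rewrite [RHS](mulr1 (1 : F)).
elim: k => // k [IH1 IH2]; rewrite e; split.
  exact: (gam_Aalg Falg_comm).
exact: (gam_opposite_Aalg Falg_comm).
Qed.

Lemma Aalg_F_neq0 : ((0, 1 : F) : Aalg U) <> 0.
Proof. by move=> /(congr1 snd) /= /eqP; rewrite oner_eq0. Qed.

Lemma not_nilpotent_Aalg_F m : ~ satisfies (Aalg U) (lie_word F m).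
Proof.
move: m; apply: not_nilpotent => k; exists (0, 1 : F); last exact: Aalg_F_neq0.
by have [] := gam_Aalg_F k.
Qed.

Lemma not_nilpotent_opposite_Aalg_F m : ~ satisfies (opposite (Aalg U)) (lie_word F m).
Proof.
move: m; apply: not_nilpotent => k; exists (0, 1 : F); last exact: Aalg_F_neq0.
by have [] := gam_Aalg_F k.
Qed.

Lemma Falg_nupow (x : U) n : nupow x n = (x : F) ^+ n.+1.
Proof. by elim: n => [|n IH]; rewrite ?expr1 // exprS -IH. Qed.

Lemma Aalg_F_pow (x y : Aalg U) : nupow x #|F|.-1 ** y = x ** y.
Proof.
have q0 : (0 < #|F|)%N by apply: ltnW; apply: card_finField_gt1.
have e : (nupow x #|F|.-1).1 = x.1 by rewrite Aalg_nupow1 Falg_nupow prednK // expf_card.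
by rewrite -[LHS]/(Aalg_mul _ _) /Aalg_mul e.
Qed.
End FieldAalg.

Section ExteriorAalg.
Variable F : finFieldType.
Notation C := (Calg F).

(** Decreasing, so that the next word arises by a factor on the left, as in [gam_Aalg]. *)
Let iw k := rev (iota 0 k.+1).

Lemma Cword_iw_neq0 k : Cword F (iw k) <> 0.
Proof.
apply: Cword_neq0; last by rewrite rev_uniq iota_uniq.
by rewrite -size_eq0 size_rev size_iota.
Qed.

Lemma Cword_iwS k : Cword F (iw k.+1) = Cword F [:: k.+1] ** Cword F (iw k).
Proof.
have e : iw k.+1 = k.+1 :: iw k by rewrite /iw -[in LHS]addn1 iotaD rev_cat.
rewrite e /Cword map_cons nuprod_cons //.
by rewrite -size_eq0 size_map size_rev size_iota.
Qed.

Lemma gam_Aalg_C k :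
  gam k ((0, Cword F (iw k)) : Aalg C) /\ gam k ((0, Cword F (iw k)) : opposite (Aalg C)).
Proof.
elim: k => // k [IH1 IH2]; rewrite Cword_iwS; split.
  exact: (gam_Aalg (@Calg_comm F)).
exact: (gam_opposite_Aalg (@Calg_comm F)).
Qed.

Lemma Aalg_C_neq0 k : ((0, Cword F (iw k)) : Aalg C) <> 0.
Proof. by move=> /(congr1 snd) /= /Cword_iw_neq0. Qed.

Lemma not_nilpotent_Aalg_C m : ~ satisfies (Aalg C) (lie_word F m).
Proof.
move: m; apply: not_nilpotent => k; exists (0, Cword F (iw k)); last exact: Aalg_C_neq0.
by have [] := gam_Aalg_C k.
Qed.

Lemma not_nilpotent_opposite_Aalg_C m : ~ satisfies (opposite (Aalg C)) (lie_word F m).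
Proof.
move: m; apply: not_nilpotent => k; exists (0, Cword F (iw k)); last exact: Aalg_C_neq0.
by have [] := gam_Aalg_C k.
Qed.

Lemma ab_l_nupow (f : free_nualg F) n : ab_l (nupow f n) = ab_l f ^+ n.+1.
Proof. by elim: n => [|n IH]; rewrite ?expr1 //= ab_lM IH [RHS]exprS. Qed.

(** Taking q-th powers is additive and F-linear, and the q-th power of a variable is not squarefree
    as q >= 2. *)
Lemma nosqf_card (f : free_nualg F) : nosqf ((ab_l f : Ppoly F) ^+ #|F|).
Proof.
have q1 := card_finField_gt1 F.
have qD (x y : Ppoly F) : (x + y) ^+ #|F| = x ^+ #|F| + y ^+ #|F|.
  by have := exprDn_card 1 x y; rewrite expn1.
have qZ a (x : Ppoly F) : (a *: x) ^+ #|F| = a *: x ^+ #|F|.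
  by have := exprZ_card 1 a x; rewrite expn1.
elim/free_nualg_ind: f => [i||f g IHf IHg|a f IH|f g IHf IHg].
- rewrite ab_l_var -(subnK q1) exprD expr2; apply: nosqfM; exact: nosqf_sq.
- rewrite ab_l.unlock linear0 expr0n gtn_eqF ?(ltnW q1) //; exact: nosqf0.
- by rewrite ab_lD qD; apply: nosqfD.
- by rewrite ab_lZ qZ; apply: nosqfZ.
- by rewrite ab_lM exprMn; apply: nosqfM.
Qed.

Lemma Calg_pow0 (x : C) : nupow x #|F|.-1 = 0.
Proof.
have [f ->] := Calg_lift x.
have -> : nupow (Cpi f) #|F|.-1 = Cpi (nupow f #|F|.-1).
  elim: (_.-1) => //= n ->; by rewrite (nualg_morphismM (@Cpi_morphism F)).
apply: nosqf_Cpi; rewrite ab_l_nupow prednK; first exact: nosqf_card.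
by apply: ltnW; apply: card_finField_gt1.
Qed.

Lemma Calg_pow_ge0 (x : C) n : (#|F|.-1 <= n)%N -> nupow x n = 0.
Proof.
move=> /subnK <-; elim: (n - _)%N => [|k IH]; first exact: Calg_pow0.
by rewrite addSn /= IH numulr0.
Qed.

Lemma Aalg_C_pow (x y : Aalg C) : nupow x #|F|.-1 ** y = 0.
Proof.
by rewrite -[LHS]/(Aalg_mul _ _) /Aalg_mul Aalg_nupow1 Calg_pow0 !numul0r.
Qed.
End ExteriorAalg.

Section Balg.
Variables (F : finFieldType) (G : fieldExtType F) (sigma : 'AEnd(G)).
Notation q := #|F|.
Notation B := (Balg sigma).

Lemma exists_irreducible (z : G) : exists2 g : {poly F}, irreducible_poly g & horner_alg z g = 0.
Proof.
pose P n := `[< exists g : {poly F}, [/\ g != 0, size g = n & horner_alg z g = 0] >].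
have exP : exists n, P n.
  pose Q := (q ^ \dim {:G})%N.
  have Q1 : (1 < Q)%N.
    by rewrite -(expn0 q) ltn_exp2l ?card_finField_gt1 // adim_gt0.
  exists (size ('X^Q - 'X : {poly F})); apply/asboolP; exists ('X^Q - 'X); split=> //.
    rewrite -size_poly_gt0 size_polyDl size_polyXn //.
    by rewrite size_polyN size_polyX.
  by rewrite rmorphB /= horner_algXn horner_algX expf_ext subrr.
case: (ex_minnP exP) => n /asboolP[g [g0 szg gz]] gmin.
exists g => //; apply: (@minimal_irreducible F G (fun eta => eta != 0) z 1 g) => //.
- exact: oner_neq0.
- by rewrite gz mulr0.
- move=> eta h eta0 h0 /eqP; rewrite mulf_eq0 (negPf eta0) /= => /eqP hz.
  by rewrite szg; apply: gmin; apply/asboolP; exists h.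
Qed.

Lemma horner_alg_aend (z : G) h : horner_alg (sigma z) h = sigma (horner_alg z h).
Proof.
elim/poly_ind: h => [|h c IH]; first by rewrite !rmorph0.
by rewrite !rmorphD !rmorphM /= !horner_algX !horner_algC IH linearZ /= rmorph1.
Qed.

Hypothesis us : unique_maximal_subfield (fixedSpace sigma).

(** An element z moved by sigma generates G, and sigma z, a root of the irreducible polynomial of z,
    is a Frobenius conjugate of z. *)
Lemma aend_frobenius : exists j, forall y, sigma y = y ^+ (q ^ j).
Proof.
have [[z sz] gen] := unique_maximal_generators us.
have [g irr gz] := exists_irreducible z.
have [|j _ ej] := irr_root_frob irr gz (y := sigma z).
  by rewrite horner_alg_aend gz rmorph0.
exists j => y; have [h ->] := gen_poly (gen z sz) y.
rewrite -horner_alg_aend.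
have := @eta_frob F G 1 z (sigma z) j _ h; rewrite !mul1r; apply; exact: ej.
Qed.

Lemma Balg_nucomm (b c b' c' : G) : nucomm ((b, c) : B) (b', c') =
  (0, b * c' + c * sigma b' - (b' * c + c' * sigma b)).
Proof.
rewrite /nucomm -[LHS]/(b * b' - b' * b, b * c' + c * sigma b' - (b' * c + c' * sigma b)).
by rewrite [b * b']mulrC subrr.
Qed.

Lemma Balg_nucomm1 (x y : B) : (nucomm x y).1 = 0.
Proof. by case: x y => [b c] [b' c']; rewrite Balg_nucomm. Qed.

Lemma Balg_nupow1 (x : B) n : (nupow x n).1 = x.1 ^+ n.+1.
Proof. by elim: n => [|n IH]; rewrite ?expr1 // [RHS]exprS -IH. Qed.

Lemma Balg_mul01 (x y : B) : x.1 = 0 -> y.1 = 0 -> x ** y = 0.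
Proof.
move: x y => [b c] [b' c'] /= -> ->; rewrite -[LHS]/(Balg_mul _ _) /Balg_mul /=.
by rewrite !mul0r rmorph0 mulr0 addr0.
Qed.

Lemma Balg_comm_square0 : comm_square0 B.
Proof.
move=> x y s z t; split; apply: Balg_mul01; rewrite ?Balg_nucomm1 //.
by rewrite -[_.1]/((nucomm x y).1 * s.1) Balg_nucomm1 mul0r.
Qed.

Lemma gam_Balg k b (c : G) : gam k ((0, c) : B) -> gam k.+1 ((0, c * (sigma b - b)) : B).
Proof.
move=> gc; exists (0, c), (b, 0); split=> //.
by rewrite Balg_nucomm mul0r add0r mul0r addr0 mulrBr [b * c]mulrC.
Qed.

Lemma not_nilpotent_Balg m : ~ satisfies B (lie_word F m).
Proof.
have [[z sz] _] := unique_maximal_generators us.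
move: m; apply: not_nilpotent => k; exists (0, (sigma z - z) ^+ k).
  by elim: k => // k IH; rewrite exprSr; apply: gam_Balg.
move/(congr1 snd) => /= /eqP; rewrite expf_eq0 subr_eq0 (negPf sz) andbF.
by [].
Qed.

Lemma Balg_comm_mulr_neq0 : ~ forall x y z : B, nucomm x y ** z = 0.
Proof.
have [[z sz] _] := unique_maximal_generators us.
move=> /(_ (0, 1) (z, 0) (1, 0)) /(congr1 snd); rewrite Balg_nucomm.
rewrite -[LHS]/(0 * 0 + (0 * 0 + 1 * sigma z - (z * 1 + 0 * sigma 0)) * sigma 1).
rewrite !mul0r rmorph1 !mulr1 mul1r addr0 !add0r => /eqP.
by rewrite subr_eq0 (negPf sz).
Qed.

Lemma Balg_comm_mull_neq0 : ~ forall x y z : B, z ** nucomm x y = 0.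
Proof.
have [[z sz] _] := unique_maximal_generators us.
move=> /(_ (0, 1) (z, 0) (1, 0)) /(congr1 snd); rewrite Balg_nucomm.
rewrite -[LHS]/(1 * (0 * 0 + 1 * sigma z - (z * 1 + 0 * sigma 0)) + 0 * sigma 0).
rewrite !mul0r !mulr1 !mul1r !addr0 !add0r => /eqP.
by rewrite subr_eq0 (negPf sz).
Qed.

Lemma Balg_pow_sub (x y : B) : let n := (q ^ \dim {:G}).-1 in
  (nupow x n - x) ** (nupow y n - y) = 0.
Proof.
have Q0 : (0 < q ^ \dim {:G})%N by rewrite expn_gt0 ltnW // card_finField_gt1.
have e (u : B) : (nupow u (q ^ \dim {:G}).-1 - u).1 = 0.
  rewrite -[LHS]/((nupow u (q ^ \dim {:G}).-1).1 - u.1) Balg_nupow1 prednK //.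
  by rewrite expf_ext subrr.
by apply: Balg_mul01.
Qed.

Lemma Balg_twist j : (forall y, sigma y = y ^+ (q ^ j)) -> forall x y z : B,
  nucomm x y ** z = nupow z (q ^ j).-1 ** nucomm x y.
Proof.
move=> ej x y z; have s0 : (0 < q ^ j)%N by rewrite expn_gt0 ltnW // card_finField_gt1.
have := Balg_nupow1 z (q ^ j).-1; rewrite prednK // -ej.
have := Balg_nucomm1 x y; move: (nucomm x y) (nupow z _) => [b c] [b' c'].
case: z => [b'' c''] /= -> ->.
rewrite -[LHS]/(Balg_mul _ _) -[RHS]/(Balg_mul _ _) /Balg_mul /=.
by rewrite !mul0r !mulr0 rmorph0 mulr0 add0r addr0 mulrC.
Qed.
End Balg.

Section CompareBalg.
Variables (F : finFieldType) (G G' : fieldExtType F) (sigma : 'AEnd(G)) (sigma' : 'AEnd(G')).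
Notation q := #|F|.
Hypotheses (us : unique_maximal_subfield (fixedSpace sigma))
  (us' : unique_maximal_subfield (fixedSpace sigma'))
  (incl : sat_incl (Balg sigma) (Balg sigma')).

(** In the twist identity the commutator of (0, 1) and (z, 0) has the corner sigma' z - z; for z
    moved by sigma' it can be cancelled, which leaves sigma' y = y^(q^j). *)
Lemma aend_transfer : exists j, (forall y, sigma y = y ^+ (q ^ j)) /\
  (forall y, sigma' y = y ^+ (q ^ j)).
Proof.
have [j ej] := aend_frobenius us; exists j; split=> // y.
have [[z sz] _] := unique_maximal_generators us'.
have s0 : (0 < q ^ j)%N by rewrite expn_gt0 ltnW // card_finField_gt1.
have := incl_twist incl (Balg_twist ej) (0, 1) (z, 0) (y, 0).
have := Balg_nupow1 ((y, 0) : Balg sigma') (q ^ j).-1.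
rewrite prednK // Balg_nucomm; case: (nupow _ _) => [b c] /= -> /(congr1 snd).
set d := _ - _.
have dE : d = sigma' z - z by rewrite /d !mul0r mul1r mulr1 addr0 add0r.
rewrite -[LHS]/(0 * 0 + d * sigma' y) -[RHS]/(y ^+ (q ^ j) * d + c * sigma' 0).
rewrite mul0r add0r rmorph0 mulr0 addr0 mulrC; apply: mulIf.
by rewrite dE subr_eq0.
Qed.

Lemma ext_transfer (b : G') : b ^+ (q ^ \dim {:G}) = b.
Proof.
have Q0 : (0 < q ^ \dim {:G})%N by rewrite expn_gt0 ltnW // card_finField_gt1.
have := incl_pow_sub incl (@Balg_pow_sub F G sigma) (b, 0) (b, 0).
move/(congr1 fst); set u := nupow _ _.
rewrite -[LHS]/((u.1 - b) * (u.1 - b)) Balg_nupow1 prednK //= => /eqP.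
by rewrite mulf_eq0 orbb subr_eq0 => /eqP.
Qed.

(** An element z of G' moved by sigma' is a root of an irreducible g, which splits in G because z is
    a root of X^(q^dim G) - X. A root y of g in G is moved by sigma, as both automorphisms are the
    same Frobenius power, and so generates G; the values h (z) and h (y) then correspond. *)
Lemma Balg_compare : sat_incl (Balg sigma') (Balg sigma).
Proof.
have [j [ej ej']] := aend_transfer.
have [[z sz] _] := unique_maximal_generators us'.
have [_ gen] := unique_maximal_generators us.
have [g irr gz] := exists_irreducible z.
have [y gy] : exists y : G, horner_alg y g = 0.
  have [s es] := genPoly_ext G.
  have /dvdpP[k ek] : g %| 'X^(q ^ \dim {:G}) - 'X.
    apply: (irr_dvdp irr gz).
    by rewrite rmorphB /= horner_algXn horner_algX ext_transfer subrr.
  have gs : map_poly (in_alg G) g %| \prod_(b <- s) ('X - b%:P).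
    rewrite -es (_ : 'X^_ - 'X = map_poly (in_alg G) (k * g)).
      by rewrite rmorphM dvdp_mull.
    by rewrite -ek rmorphB /= map_polyXn map_polyX.
  have [m gm] := dvdp_prod_XsubC gs.
  have : size (map_poly (in_alg G) g) = size (\prod_(b <- mask m s) ('X - b%:P)).
    exact: eqp_size.
  rewrite size_map_poly size_prod_XsubC; case: (mask m s) gm => [|y t] gm.
    by move=> sz1; have [] := irr; rewrite sz1.
  move=> _; exists y; apply/eqP; rewrite -[horner_alg y g]/((map_poly (in_alg G) g).[y]).
  by rewrite -rootE (eqp_root gm) root_prod_XsubC mem_head.
have sy : sigma y != y.
  apply: contraNneq sz => sy; apply/eqP.
  have hy : horner_alg y ('X^(q ^ j) - 'X : {poly F}) = 0.
    by rewrite rmorphB /= horner_algXn horner_algX -ej sy subrr.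
  have := dvdp_irr (irr_dvdp irr gy hy) gz.
  rewrite rmorphB /= horner_algXn horner_algX -ej' => /eqP.
  by rewrite subr_eq0 => /eqP.
have ygen := gen y sy.
move=> f Bf rho.
pose u k := sval (cid (gen_poly ygen (rho k).1)); pose v k := sval (cid (gen_poly ygen (rho k).2)).
have uE k : (rho k).1 = horner_alg y (u k) by rewrite /u; case: (cid _).
have vE k : (rho k).2 = horner_alg y (v k) by rewrite /v; case: (cid _).
pose rel (x : Balg sigma') (x' : Balg sigma) := exists h1 h2 : {poly F},
  x = (horner_alg z h1, horner_alg z h2) /\ x' = (horner_alg y h1, horner_alg y h2).
have [] : rel (free_eval (fun k => (horner_alg z (u k), horner_alg z (v k)) : Balg sigma') f)
    (free_eval rho f).
  apply: free_eval_rel.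
  - by move=> k; exists (u k), (v k); split=> //; rewrite -uE -vE; case: (rho k).
  - by exists 0, 0; rewrite !rmorph0.
  - move=> _ _ _ _ [h1 [h2 [-> ->]]] [k1 [k2 [-> ->]]]; exists (h1 + k1), (h2 + k2).
    by rewrite !rmorphD.
  - move=> c _ _ [h1 [h2 [-> ->]]]; exists (c *: h1), (c *: h2).
    by rewrite !horner_algZ.
  - move=> _ _ _ _ [h1 [h2 [-> ->]]] [k1 [k2 [-> ->]]].
    exists (h1 * k1), (h1 * k2 + h2 * k1 ^+ (q ^ j)).
    split; rewrite -[LHS]/(Balg_mul _ _) /Balg_mul /= rmorphD !rmorphM rmorphXn /=.
      by rewrite ej'.
    by rewrite ej.
move=> h1 [h2 []]; rewrite Bf => -[e1 e2] ->.
by rewrite (dvdp_irr (irr_dvdp irr gz (esym e1)) gy) (dvdp_irr (irr_dvdp irr gz (esym e2)) gy).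
Qed.
End CompareBalg.

(** * Separating the five algebras, and the equivalence *)

Section Final.
Variable F : finFieldType.
Notation q := #|F|.
Notation AF := (Aalg (Falg F)).
Notation AC := (Aalg (Calg F)).

Lemma nupow_comm (A : nualgType F) (x : A) k : x ** nupow x k = nupow x k ** x.
Proof. by elim: k => //= k IH; rewrite -numulA -IH. Qed.

Lemma nupow_opposite (A : nualgType F) (x : A) k : nupow (x : opposite A) k = nupow x k.
Proof. by elim: k => //= k ->; rewrite nupow_comm. Qed.

Lemma five_map (P Q : nualgType F -> Prop) : (forall B, P B -> Q B) ->
  one_of_five P -> one_of_five Q.
Proof.
rewrite /one_of_five => PQ [/PQ|[/PQ|[/PQ|[/PQ|[G [s [us /PQ h]]]]]]]; try tauto.
by do 4 right; exists G, s.
Qed.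

Lemma five_not_nilpotent (P : nualgType F -> Prop) : one_of_five P ->
  one_of_five (fun B => P B /\ forall m, ~ satisfies B (lie_word F m)).
Proof.
case=> [h|[h|[h|[h|[G [s [us h]]]]]]].
- by left; split=> //; apply: not_nilpotent_Aalg_F.
- by right; left; split=> //; apply: not_nilpotent_opposite_Aalg_F.
- by do 2 right; left; split=> //; apply: not_nilpotent_Aalg_C.
- by do 3 right; left; split=> //; apply: not_nilpotent_opposite_Aalg_C.
- by do 4 right; exists G, s; do 2 split=> //; apply: not_nilpotent_Balg.
Qed.

Lemma Aalg_comm_square0 (U : nualgType F) : (forall x y : U, x ** y = y ** x) ->
  comm_square0 (Aalg U) /\ comm_square0 (opposite (Aalg U)).
Proof.
move=> UC; have h := Aalg_comm_mulr UC; split=> x y s z t; first by rewrite !h numul0r.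
have h' (a b c : opposite (Aalg U)) : c ** nucomm a b = 0 by exact: (h b a c).
by rewrite !h'.
Qed.

Lemma Aalg_comm_mull (U : nualgType F) : (forall x y : U, x ** y = y ** x) ->
  forall x y z : opposite (Aalg U), z ** nucomm x y = 0.
Proof. by move=> UC x y z; exact: (Aalg_comm_mulr UC y x z). Qed.

Lemma five_comm_square0 (P : nualgType F -> Prop) : one_of_five P ->
  one_of_five (fun B => P B /\ comm_square0 B).
Proof.
have [a b] := Aalg_comm_square0 (@Falg_comm F).
have [c d] := Aalg_comm_square0 (@Calg_comm F).
case=> [h|[h|[h|[h|[G [s [us h]]]]]]]; rewrite /one_of_five; try tauto.
by do 4 right; exists G, s; do 2 split=> //; apply: Balg_comm_square0.
Qed.

(** x^q y = x y in A(F), while x^q y = 0 in A(C). *)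
Lemma incl_AF_AC : ~ sat_incl AF AC.
Proof.
move=> incl; have := incl_pow_eq incl (@Aalg_F_pow F).
move=> /(_ (Cword F [:: 1%N], 0) (Cword F [:: 0%N], 0)).
rewrite Aalg_C_pow Aalg_mulE => /(congr1 fst) /= e.
by have := @Cword_iw_neq0 F 1; rewrite Cword_iwS; apply.
Qed.

Lemma incl_AC_AF : ~ sat_incl AC AF.
Proof.
move=> incl; have := incl_pow0 incl (@Aalg_C_pow F) (1, 0) (1, 0).
rewrite Aalg_F_pow Aalg_mulE => /(congr1 fst) /= /eqP.
by rewrite -[_ ** _]/((1 : F) * 1) mulr1 oner_eq0.
Qed.

Section FromBalg.
Variables (G : fieldExtType F) (sigma : 'AEnd(G)).
Hypothesis us : unique_maximal_subfield (fixedSpace sigma).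

(** In A(F) the left side of the twist identity is always zero, the right side is not. *)
Lemma incl_Balg_AF : ~ sat_incl (Balg sigma) AF.
Proof.
have [j ej] := aend_frobenius us => incl.
have := incl_twist incl (Balg_twist ej).
move=> /(_ (0, 1) (-1, 0) (1, 0)); rewrite (Aalg_comm_mulr (@Falg_comm F)).
have := Aalg_nupow1 ((1, 0) : AF) (q ^ j).-1; rewrite Falg_nupow expr1n.
case: (nupow _ _) => [a b] /= ->; rewrite Aalg_nucomm; last exact: Falg_comm.
rewrite Aalg_mulE => /(congr1 snd) /=; rewrite numulNr numul0r sub0r opprK.
by rewrite -[_ ** _]/((1 : F) * (1 * 1)) !mulr1 => /esym/eqP; rewrite oner_eq0.
Qed.

(** The twist identity turns z [x, y] = 0 into [x, y] z = 0, and both together force Lie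
    nilpotence. *)
Lemma incl_Balg_oAF : ~ sat_incl (Balg sigma) (opposite AF).
Proof.
have [j ej] := aend_frobenius us => incl.
have tw := incl_twist incl (Balg_twist ej).
apply: (not_nilpotent_comm_mul (@not_nilpotent_opposite_Aalg_F F)) => x y z; last first.
  exact: (Aalg_comm_mull (@Falg_comm F)).
by rewrite tw (Aalg_comm_mull (@Falg_comm F)).
Qed.

(** Powers of exponent at least q vanish in C, so (x^Q - x)(y^Q - y) = 0 would make all products in
    C vanish. *)
Lemma incl_Balg_AC : ~ sat_incl (Balg sigma) AC /\ ~ sat_incl (Balg sigma) (opposite AC).
Proof.
set c := Cword F [:: 1%N]; set d := Cword F [:: 0%N].
have cd : c ** d <> 0 by have := @Cword_iw_neq0 F 1; rewrite Cword_iwS.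
pose n := (q ^ \dim {:G}).-1.
have nq : (q.-1 <= n)%N.
  have q0 := ltnW (card_finField_gt1 F).
  rewrite -ltnS !prednK ?expn_gt0 ?q0 // -{1}(expn1 q) leq_exp2l ?card_finField_gt1 //.
  exact: adim_gt0.
have pow (x : Calg F) : (nupow ((x, 0) : AC) n - (x, 0)).1 = - x.
  rewrite -[LHS]/((nupow ((x, 0) : AC) n).1 - x) Aalg_nupow1 Calg_pow_ge0 //.
  by rewrite sub0r.
split=> incl; apply: cd.
  have := congr1 fst (incl_pow_sub incl (@Balg_pow_sub F G sigma) (c, 0) (d, 0)).
  rewrite -[LHS]/((nupow ((c, 0) : AC) n - (c, 0)).1 ** (nupow ((d, 0) : AC) n - (d, 0)).1).
  by rewrite !pow numulNr numulrN opprK.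
have := congr1 fst (incl_pow_sub incl (@Balg_pow_sub F G sigma) (d, 0) (c, 0)).
rewrite !nupow_opposite.
rewrite -[LHS]/((nupow ((c, 0) : AC) n - (c, 0)).1 ** (nupow ((d, 0) : AC) n - (d, 0)).1).
by rewrite !pow numulNr numulrN opprK.
Qed.

End FromBalg.

(** Of the 25 pairs only those of equal type survive, the others being separated by an identity; for
    two algebras B(F, G, sigma), [Balg_compare] reverses the inclusion. *)
Lemma five_compare (P Q : nualgType F -> Prop) : one_of_five P -> one_of_five Q ->
  (forall B B', P B -> Q B' -> sat_incl B B') ->
  exists B B', [/\ P B, Q B' & sat_incl B' B].
Proof.
have fF := @Falg_comm F; have fC := @Calg_comm F.
have lF := Aalg_comm_mulr fF; have lC := Aalg_comm_mulr fC.
have rF := Aalg_comm_mull fF; have rC := Aalg_comm_mull fC.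
move=> hP hQ incl.
have noL B' : (forall m, ~ satisfies B' (lie_word F m)) ->
   (forall x y z : B', z ** nucomm x y = 0) ->
   ~ sat_incl AF B' /\ ~ sat_incl AC B'.
  move=> nB r; split=> i; apply: (not_nilpotent_comm_mul nB) => //; exact: (incl_comm_mulr i).
have noR B' : (forall m, ~ satisfies B' (lie_word F m)) ->
   (forall x y z : B', nucomm x y ** z = 0) ->
   ~ sat_incl (opposite AF) B' /\ ~ sat_incl (opposite AC) B'.
  move=> nB l; split=> i; apply: (not_nilpotent_comm_mul nB) => //; exact: (incl_comm_mull i).
have [n1 n2] := noL _ (@not_nilpotent_opposite_Aalg_F F) rF.
have [n3 n4] := noL _ (@not_nilpotent_opposite_Aalg_C F) rC.
have [n5 n6] := noR _ (@not_nilpotent_Aalg_F F) lF.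
have [n7 n8] := noR _ (@not_nilpotent_Aalg_C F) lC.
have n9 := incl_AF_AC; have n10 := incl_AC_AF.
have n11 := fun i => n9 (sat_incl_opposite i); have n12 := fun i => n10 (sat_incl_opposite i).
have balg (G : fieldExtType F) (s : 'AEnd(G)) : unique_maximal_subfield (fixedSpace s) ->
    [/\ ~ sat_incl AF (Balg s), ~ sat_incl AC (Balg s), ~ sat_incl (opposite AF) (Balg s)
      & ~ sat_incl (opposite AC) (Balg s)].
  move=> us; split=> i.
  - exact: (Balg_comm_mulr_neq0 us (incl_comm_mulr i lF)).
  - exact: (Balg_comm_mulr_neq0 us (incl_comm_mulr i lC)).
  - exact: (Balg_comm_mull_neq0 us (incl_comm_mull i rF)).
  - exact: (Balg_comm_mull_neq0 us (incl_comm_mull i rC)).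
case: hP => [h|[h|[h|[h|[G [s [us h]]]]]]];
  case: hQ => [h'|[h'|[h'|[h'|[G' [s' [us' h']]]]]]]; have i := incl _ _ h h'.
- by exists AF, AF; split.
- by case: (n1 i).
- by case: (n9 i).
- by case: (n3 i).
- by have [b _ _ _] := balg _ _ us'; case: (b i).
- by case: (n5 i).
- by exists (opposite AF), (opposite AF); split.
- by case: (n7 i).
- by case: (n11 i).
- by have [_ _ b _] := balg _ _ us'; case: (b i).
- by case: (n10 i).
- by case: (n2 i).
- by exists AC, AC; split.
- by case: (n4 i).
- by have [_ b _ _] := balg _ _ us'; case: (b i).
- by case: (n6 i).
- by case: (n12 i).
- by case: (n8 i).
- by exists (opposite AC), (opposite AC); split.
- by have [_ _ _ b] := balg _ _ us'; case: (b i).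
- by case: (incl_Balg_AF us i).
- by case: (incl_Balg_oAF us i).
- by have [b _] := incl_Balg_AC s; case: (b i).
- by have [_ b] := incl_Balg_AC s; case: (b i).
- by exists (Balg s), (Balg s'); split=> //; apply: Balg_compare.
Qed.
End Final.

Theorem theorem2 (F : finFieldType) (V : nualgType F -> Prop)
    (V_variety : is_variety V) (V_nonprime : ~ prime_variety V) :
  almost_lie_nilpotent V <->
  generated_by V (Aalg (Falg F)) \/
  generated_by V (opposite (Aalg (Falg F))) \/
  generated_by V (Aalg (Calg F)) \/
  generated_by V (opposite (Aalg (Calg F))) \/
  exists (G : fieldExtType F) (sigma : 'AEnd(G)),
    unique_maximal_subfield (fixedSpace sigma) /\
    generated_by V (Balg sigma).
Proof.
rewrite -/(one_of_five (generated_by V)); split=> [aln|gen].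
  have h := almost_nilpotent_five V_variety aln (nonprime_square V_variety aln V_nonprime).
  apply: five_map (five_not_nilpotent h) => B [VB nB].
  exact: almost_nilpotent_generated.
have ex (P : nualgType F -> Prop) : one_of_five P -> exists B, P B.
  by case=> [|[|[|[|[G [s [_]]]]]]]; eexists; eassumption.
split.
  have [B [[_ VB _] nB]] := ex _ (five_not_nilpotent gen).
  by move=> [m h]; apply: (nB m); apply: h.
move=> W [[vW WV] nVW]; apply: contrapT => nW.
have [W0 [vW0 W0W aln]] := almost_nilpotent_exists vW nW.
have genW0 A : W0 A -> V A by move=> /W0W; apply: WV.
(* The generated variety is compared with the variety defined by f alone. *)
have incl B A : generated_by V B -> W0 A -> sat_incl B A.
  move=> [_ _ min] /genW0 VA f Bf.
  have := min (models (fun g => g = f)) (models_variety _).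
  by move=> /(_ (fun g e => ltac:(rewrite e; exact: Bf)) A VA f erefl).
have sq : exists n, forall u v : nuquot (identities W0),
    nuideal_gen (gam n) u -> nuideal_gen (gam n) v -> u ** v = 0.
  (* [gam 1] is the set of commutators, and the identities [comm_square0] pass from a generator of V
     to the relatively free algebra of W0. *)
  exists 1%N; apply: comm_square0_gen.
  have [B [gB sB]] := ex _ (five_comm_square0 gen).
  exact: (incl_comm_square0 (incl _ _ gB (relfree_variety vW0)) sB).
have h := almost_nilpotent_five vW0 aln sq.
have [B [B' [gB W0B' inv]]] := five_compare gen h incl.
(* The generator B of V satisfies the identities of W0, so V lies in W0 and hence in W. *)
apply: nVW => A VA; have [_ _ min] := gB.
apply: min VA => //; apply: W0W; apply/(variety_models vW0) => f Tf.
by apply: inv; apply: Tf.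
Qed.
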